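(* Let $n\ge1$, $V=\mathbb{C}^n$, and let $T=T(V)\otimes T(V^* )$ be the mixed tensor algebra over $V$. The map $G\mapsto T^G$ is a one-to-one correspondence between the lattice of linear algebraic $*$-subgroups $G$ of $\mathrm{GL}(n,\mathbb{C})$ and the lattice of nondegenerate contraction-closed graded $*$-subalgebras of $T$, and it is a Galois connection: it reverses inclusion.
   Context: $T(V)=\bigoplus_{k\ge 0}V^{\otimes k}$, $T(V^* )=\bigoplus_{k\ge 0}V^{*\otimes k}$, and $T=T(V)\otimes T(V^* )\cong\bigoplus_{k,l\ge 0}V^{\otimes k}\otimes V^{*\otimes l}$, with multiplication (also written $\otimes$) $(x\otimes y)\otimes(x'\otimes y')=(x\otimes x')\otimes(y\otimes y')$ for $x,x'\in T(V)$, $y,y'\in T(V^* )$. For $U\in \mathrm{GL}(n,\mathbb{C})$, $z\mapsto z^U$ is the unique algebra endomorphism of $T$ with $x^U=Ux$ for $x\in V$ and $y^U=(U^{\mathsf T})^{-1}y$ for $y\in V^*$ (coordinates with respect to the dual basis; i.e. $y^U=y\circ U^{-1}$). For $G\subseteq \mathrm{GL}(n,\mathbb{C})$, $T^G:=\{z\in T\mid z^U=z \text{ for all } U\in G\}$. A subgroup $G$ of $\mathrm{GL}(n,\mathbb{C})$ is a $*$-subgroup if $G=G^*:=\{U^*\mid U\in G\}$ ($U^*$ the conjugate transpose). It is linear algebraic if it is Zariski closed in $\mathrm{GL}(n,\mathbb{C})$, i.e. it is the set of $U\in\mathrm{GL}(n,\mathbb{C})$ whose entries satisfy some collection of polynomial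 equations with complex coefficients. Graded: for $A\subseteq T$ put $A_{k,l}:=A\cap(V^{\otimes k}\otimes V^{*\otimes l})$; a subalgebra $A$ of $T$ is graded if $A=\bigoplus_{k,l\ge0}A_{k,l}$. $*$-operation: let $e_1,\ldots,e_n$ be the standard basis of $V$ and $e_1^*,\ldots,e_n^*$ the dual basis of $V^*$. The map $e_i\mapsto e_i^*$ extends to a unique function $x\mapsto x^*$ on $T$ with $(x^* )^*=x$, $(\lambda x)^*=\overline{\lambda}x^*$, $(x+y)^*=x^*+y^*$, $(x\otimes y)^*=y^*\otimes x^*$ for all $x,y\in T$, $\lambda\in\mathbb{C}$. A subalgebra $A$ of $T$ is a $*$-subalgebra if $A^*=A$. Nondegenerate: a subalgebra $A$ of $T$ is nondegenerate if there is no proper subspace $W$ of $V$ with $A\subseteq T(W)\otimes T(W^* )$, where $W^*$ is regarded as the subspace $\{w^*\mid w\in W\}$ of $V^*$. Contraction-closed: a graded subalgebra is contraction-closed if it is closed under all contraction operators $V^{\otimes k}\otimes V^{*\otimes l}\to V^{\otimes (k-1)}\otimes V^{*\otimes (l-1)}$ ($k,l\ge1$) that pair the $i$-th $V$-factor with the $j$-th $V^*$-factor, $1\le i\le k$, $1\le j\le l$. *)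

(* Defs.v *)
From HB Require Import structures.
From mathcomp Require Import all_boot all_order all_algebra finmap.
From mathcomp Require Import all_classical all_reals.
From mathcomp Require Import complex.
(* The notations of these two files clash with those of other libraries. *)
From mathcomp Require Import -(notations) mpoly monalg.

Set Implicit Arguments.
Unset Strict Implicit.
Unset Printing Implicit Defensive.

Import Order.TTheory GRing.Theory Num.Theory.

Local Open Scope classical_set_scope.
Local Open Scope ring_scope.
Local Open Scope sesquilinear_scope.

(** * The mixed tensor algebra

  V = C^n is 'cV[C]_n. In the standard basis e_1, ..., e_n of V and the dual
  basis e_1^*, ..., e_n^* of V^*, the space T = T(V) (x) T(V^* ) has the basis
    e_(i1) (x) ... (x) e_(ik) (x) e_(j1)^* (x) ... (x) e_(jl)^*
  indexed by the pairs of words ([:: i1; ...; ik], [:: j1; ...; jl]), and such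
  basis elements are multiplied by concatenating both words separately. So T
  is the monoid algebra of the product of two free monoids on 'I_n. *)

Definition biword (n : nat) : Type := (seq 'I_n * seq 'I_n)%type.

HB.instance Definition _ (n : nat) := Choice.on (biword n).

Definition biword_cat (n : nat) (u v : biword n) : biword n :=
  (u.1 ++ v.1, u.2 ++ v.2).

Lemma biword_catA (n : nat) : associative (@biword_cat n).
Proof. by move=> u v w; rewrite /biword_cat /= !catA. Qed.

Lemma biword_cat0w (n : nat) : left_id ([::], [::]) (@biword_cat n).
Proof. by case. Qed.

Lemma biword_catw0 (n : nat) : right_id ([::], [::]) (@biword_cat n).
Proof. by case=> u v; rewrite /biword_cat /= !cats0. Qed.

Lemma biword_cat_unit (n : nat) (u v : biword n) :
  biword_cat u v = ([::], [::]) -> u = ([::], [::]) /\ v = ([::], [::]).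
Proof. by case: u v => [[|? ?] [|? ?]] [[|? ?] [|? ?]]. Qed.

HB.instance Definition _ (n : nat) := Choice_isMonomialDef.Build (biword n)
  (@biword_catA n) (@biword_cat0w n) (@biword_catw0 n) (@biword_cat_unit n).

Definition tensors (C : numClosedFieldType) (n : nat) : Type :=
  malg (biword n) C.

(* The algebra structure is that of [malg], locked for efficiency. *)
HB.lock Definition tensors_class (C : numClosedFieldType) (n : nat) :
  GRing.Lalgebra C (malg (biword n) C) :=
  GRing.Lalgebra.class (malg (biword n) C).

HB.instance Definition _ (C : numClosedFieldType) (n : nat) :=
  GRing.Lalgebra.copy (tensors C n)
    (GRing.Lalgebra.Pack (tensors_class C n)).

Section TensorsE.
Context {C : numClosedFieldType} {n : nat}.
Local Notation T := (tensors C n).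
Local Notation M := (malg (biword n) C).
Local Notation P := (GRing.Lalgebra.Pack (tensors_class C n)).

Lemma tensors0E : (0 : T) = (0 : M).
Proof. by rewrite -[LHS]/(0 : P) tensors_class.unlock. Qed.

Lemma tensors1E : (1 : T) = (1 : M).
Proof. by rewrite -[LHS]/(1 : P) tensors_class.unlock. Qed.

Lemma tensorsDE (x y : T) : x + y = (x : M) + (y : M).
Proof. by rewrite -[LHS]/((x : P) + (y : P)) tensors_class.unlock. Qed.

Lemma tensorsZE (a : C) (x : T) : a *: x = a *: (x : M).
Proof. by rewrite -[LHS]/(a *: (x : P)) tensors_class.unlock. Qed.

Lemma tensorsME (x y : T) : x * y = (x : M) * (y : M).
Proof. by rewrite -[LHS]/((x : P) * (y : P)) tensors_class.unlock. Qed.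

End TensorsE.

HB.lock Definition basis (C : numClosedFieldType) (n : nat) (w : biword n) :
  tensors C n := mkmalgU w 1.
Arguments basis C {n} w.

Section Tensors.
Context {C : numClosedFieldType} {n : nat}.
Local Notation T := (tensors C n).

(* The inclusions of V and of V^* in T; an element of V^* is given by the
   column of its coordinates in the dual basis. *)
Definition vec (x : 'cV[C]_n) : T :=
  \sum_(i < n) x i 0 *: basis C ([:: i], [::]).

Definition covec (y : 'cV[C]_n) : T :=
  \sum_(i < n) y i 0 *: basis C ([::], [:: i]).

(* z^U: the image of a basis element is the product of the U e_i and of the
   (U^T)^-1 e_j^*; see [gl_act_unique]. *)
Definition gl_act (U : 'M[C]_n) (z : T) : T :=
  \sum_(w <- monalg.msupp z) monalg.mcoeff w z *:
    ((\prod_(i <- w.1) vec (col i U))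
     * (\prod_(j <- w.2) covec (col j (invmx U^T)))).

Definition invariants (G : set 'M[C]_n) : set T :=
  [set z | forall U, G U -> gl_act U z = z].

(* z^*; see [star_vec], [starK], [starZ], [starD] and [starM]. *)
Definition star (z : T) : T :=
  \sum_(w <- monalg.msupp z) (monalg.mcoeff w z)^* *: basis C (rev w.2, rev w.1).

(* V^{(x) k} (x) V^{* (x) l} *)
Definition homog (k l : nat) : set T :=
  [set z | forall w, w \in monalg.msupp z -> size w.1 = k /\ size w.2 = l].

Definition remove_nth (S : Type) (i : nat) (s : seq S) : seq S :=
  take i s ++ drop i.+1 s.

(* The pairing of the V-factor i with the V^*-factor j, both counted from 0.
   It is extended to all of T: it vanishes on the basis elements that have no
   V-factor i or no V^*-factor j. *)
Definition contract (i j : nat) (z : T) : T :=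
  \sum_(w <- monalg.msupp z | (i < size w.1)%N && (onth w.1 i == onth w.2 j))
    monalg.mcoeff w z *: basis C (remove_nth i w.1, remove_nth j w.2).

(** * Subalgebras of T *)

Definition subalgebra (A : set T) : Prop :=
  [/\ A 1,
      (forall (a : C) (x y : T), A x -> A y -> A (a *: x + y)) &
      (forall x y : T, A x -> A y -> A (x * y))].

(* A is the sum of the A_(k,l). That this sum is direct, and contained in A,
   is clear for a subspace A. *)
Definition graded (A : set T) : Prop :=
  forall z, A z -> exists (N : nat) (f : nat -> nat -> T),
    (forall k l, (A `&` homog k l) (f k l)) /\
    z = \sum_(k < N) \sum_(l < N) f k l.

Definition star_stable (A : set T) : Prop := star @` A = A.

Definition contraction_closed (A : set T) : Prop :=
  forall k l i j : nat, (i < k)%N -> (j < l)%N ->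
  forall z, (A `&` homog k l) z -> A (contract i j z).

(* T(W) (x) T(W^* ), the span of the products
   x_1 (x) ... (x) x_k (x) y_1^* (x) ... (x) y_l^*, with the x_i, y_j in W *)
Definition tensors_over (W : {vspace 'cV[C]_n}) : set T :=
  [set z | exists s : seq (C * (seq 'cV[C]_n * seq 'cV[C]_n)),
     (forall t, t \in s ->
        {in t.2.1, forall x, x \in W} /\ {in t.2.2, forall y, y \in W}) /\
     z = \sum_(t <- s) t.1 *:
           ((\prod_(x <- t.2.1) vec x) * (\prod_(y <- t.2.2) star (vec y)))].

Definition nondegenerate (A : set T) : Prop :=
  ~ exists W : {vspace 'cV[C]_n}, W != fullv /\ A `<=` tensors_over W.

Definition tensor_subalgebras : set (set T) :=
  [set A | [/\ subalgebra A, graded A, star_stable A, contraction_closed A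
             & nondegenerate A]].

(** * Subgroups of GL(n, C) *)

Definition GL_subgroup (G : set 'M[C]_n) : Prop :=
  [/\ (forall U, G U -> U \in unitmx),
      G 1%:M,
      (forall U U', G U -> G U' -> G (U *m U')) &
      (forall U, G U -> G (invmx U))].

Definition star_invariant (G : set 'M[C]_n) : Prop :=
  [set U ^t* | U in G] = G.

(* The entries of U are listed in the order of [mxvec U]. *)
Definition zariski_closed (G : set 'M[C]_n) : Prop :=
  exists P : set (mpoly (n * n) C),
    G = [set U | U \in unitmx /\
           forall p, P p -> meval (fun k => mxvec U 0 k) p = 0].

Definition algebraic_star_subgroups : set (set 'M[C]_n) :=
  [set G | [/\ GL_subgroup G, zariski_closed G & star_invariant G]].

End Tensors.

(** * Lattices of sets, ordered by inclusion *)

Definition is_lattice (X : Type) (L : set (set X)) : Prop :=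
  forall A B, L A -> L B ->
    (exists M, [/\ L M, M `<=` A, M `<=` B &
       forall D, L D -> D `<=` A -> D `<=` B -> D `<=` M]) /\
    (exists J, [/\ L J, A `<=` J, B `<=` J &
       forall D, L D -> A `<=` D -> B `<=` D -> J `<=` D]).

(** * Sanity checks for [gl_act] and [star] *)

Section SemilinearExtension.
Context {C : numClosedFieldType} {n : nat}.
Local Notation T := (tensors C n).

Definition semilin (c : {rmorphism C -> C}) (h : biword n -> T) (z : T) : T :=
  \sum_(w <- monalg.msupp z) c (monalg.mcoeff w z) *: h w.

Lemma semilinEw c h (D : {fset biword n}) (z : T) :
  (monalg.msupp z `<=` D)%fset ->
  semilin c h z = \sum_(w <- D) c (monalg.mcoeff w z) *: h w.
Proof.
move=> le; rewrite /semilin (big_fset_incl _ le) //= => w _.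
by move/monalg.mcoeff_outdom=> ->; rewrite rmorph0 scale0r.
Qed.

Lemma semilinD c h : {morph semilin c h : x y / x + y}.
Proof.
move=> x y; have le : (monalg.msupp (x + y : T) `<=`
    monalg.msupp x `|` monalg.msupp y)%fset.
  by rewrite tensorsDE; exact: monalg.msuppD_le.
rewrite (semilinEw c h le).
rewrite (semilinEw c h (fsubsetUl (monalg.msupp x) (monalg.msupp y))).
rewrite (semilinEw c h (fsubsetUr (monalg.msupp x) (monalg.msupp y))).
rewrite -big_split; apply: eq_bigr => w _.
by rewrite /= (tensorsDE x y) monalg.mcoeffD rmorphD scalerDl.
Qed.

Lemma semilinZ c h a z : semilin c h (a *: z) = c a *: semilin c h z.
Proof.
have le : (monalg.msupp (a *: z : T) `<=` monalg.msupp z)%fset.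
  by rewrite tensorsZE; exact: monalg.msuppZ_le.
rewrite (semilinEw c h le) scaler_sumr.
by apply: eq_bigr => w _; rewrite (tensorsZE a z) monalg.mcoeffZ rmorphM scalerA.
Qed.

Lemma semilin0 c h : semilin c h 0 = 0.
Proof. by rewrite -[X in semilin _ _ X](scale0r (0 : T)) semilinZ rmorph0 scale0r. Qed.

Lemma semilin_sum c h I (r : seq I) (F : I -> T) :
  semilin c h (\sum_(i <- r) F i) = \sum_(i <- r) semilin c h (F i).
Proof. exact: (big_morph _ (semilinD c h) (semilin0 c h)). Qed.

Lemma semilin_basis c h w : semilin c h (basis C w) = h w.
Proof.
rewrite /semilin basis.unlock monalg.msuppU1 big_seq_fset1 monalg.mcoeffUU.
by rewrite rmorph1 scale1r.
Qed.

Lemma basisM (u v : biword n) :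
  basis C u * basis C v = basis C (biword_cat u v) :> T.
Proof. by rewrite tensorsME basis.unlock monalg.malgM_def monalg.fgmulUU mulr1. Qed.

Lemma scale_basis (a : C) (w : biword n) : a *: basis C w = mkmalgU w a.
Proof.
rewrite tensorsZE basis.unlock; apply/monalg.malgP => k.
by rewrite monalg.mcoeffZ !monalg.mcoeffU mulrnAr mulr1.
Qed.

Lemma basisE (z : T) :
  z = \sum_(w <- monalg.msupp z) monalg.mcoeff w z *: basis C w.
Proof.
under eq_bigr do rewrite scale_basis.
rewrite {1}[z]monalg.monalgE.
apply: (big_morph (fun x : malg (biword n) C => x : T)) => [x y|].
  by rewrite tensorsDE.
by rewrite tensors0E.
Qed.

End SemilinearExtension.

Section Checks.
Context {C : numClosedFieldType} {n : nat}.
Local Notation T := (tensors C n).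
Implicit Types (x y z : T) (u v w : biword n) (a : C).

Lemma tensor_scaleAr a x y : x * (a *: y) = a *: (x * y).
Proof.
rewrite [x]basisE [y]basisE !mulr_suml !scaler_sumr; apply: eq_bigr => u _.
rewrite !mulr_sumr scaler_sumr; apply: eq_bigr => v _.
rewrite scalerA !scale_basis !tensorsME tensorsZE.
rewrite !monalg.malgM_def !monalg.fgmulUU.
by apply/monalg.malgP => k; rewrite monalg.mcoeffZ !monalg.mcoeffU mulrnAr mulrCA.
Qed.

Lemma vec_covecC (s t : 'cV[C]_n) : vec s * covec t = covec t * vec s.
Proof.
have swap (i j : 'I_n) : basis C ([:: i], [::]) * basis C ([::], [:: j])
    = basis C ([::], [:: j]) * basis C ([:: i], [::]) :> T by rewrite [LHS]basisM [RHS]basisM.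
rewrite /vec /covec mulr_suml mulr_sumr; apply: eq_bigr => i _.
rewrite mulr_sumr mulr_suml; apply: eq_bigr => j _.
rewrite !tensor_scaleAr -!scalerAl swap.
rewrite !scalerA.
by congr (_ *: _); exact: mulrC.
Qed.

Lemma basis1 : basis C ([::], [::]) = 1 :> T.
Proof. by rewrite tensors1E basis.unlock. Qed.

Lemma vec_delta (i : 'I_n) : vec (delta_mx i 0) = basis C ([:: i], [::]) :> T.
Proof.
rewrite /vec (bigD1 i) //= mxE !eqxx scale1r big1 ?addr0 // => j ji.
by rewrite mxE (negbTE ji) scale0r.
Qed.

Lemma covec_delta (i : 'I_n) : covec (delta_mx i 0) = basis C ([::], [:: i]) :> T.
Proof.
rewrite /covec (bigD1 i) //= mxE !eqxx scale1r big1 ?addr0 // => j ji.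
by rewrite mxE (negbTE ji) scale0r.
Qed.

Lemma basis_prod w : basis C w =
  (\prod_(i <- w.1) vec (delta_mx i 0)) *
  (\prod_(j <- w.2) covec (delta_mx j 0)) :> T.
Proof.
case: w => [s t] /=.
under eq_bigr do rewrite vec_delta; under [X in _ * X]eq_bigr do rewrite covec_delta.
have -> : \prod_(i <- s) basis C ([:: i], [::]) = basis C (s, [::]) :> T.
  elim: s => [|i s IH]; first by rewrite big_nil basis1.
  by rewrite big_cons IH basisM.
have -> : \prod_(i <- t) basis C ([::], [:: i]) = basis C ([::], t) :> T.
  elim: t => [|i t IH]; first by rewrite big_nil basis1.
  by rewrite big_cons IH basisM.
by rewrite basisM /biword_cat /= cats0.
Qed.

Lemma gl_actE U z : gl_act U z = semilin idfun (fun w =>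
  (\prod_(i <- w.1) vec (col i U)) *
  (\prod_(j <- w.2) covec (col j (invmx U^T)))) z.
Proof. by []. Qed.

Lemma gl_act1 U : gl_act U 1 = 1 :> T.
Proof. by rewrite -[in LHS]basis1 gl_actE semilin_basis /= !big_nil mul1r. Qed.

Lemma gl_actD U x y : gl_act U (x + y) = gl_act U x + gl_act U y.
Proof. by rewrite !gl_actE semilinD. Qed.

Lemma gl_actZ U a x : gl_act U (a *: x) = a *: gl_act U x.
Proof. by rewrite !gl_actE semilinZ. Qed.

Lemma gl_actM U x y : gl_act U (x * y) = gl_act U x * gl_act U y.
Proof.
rewrite [x]basisE [y]basisE !gl_actE mulr_suml !semilin_sum mulr_suml.
apply: eq_bigr => u _; rewrite !mulr_sumr semilin_sum; apply: eq_bigr => v _.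
rewrite -scalerAl tensor_scaleAr !semilinZ /= -scalerAl tensor_scaleAr.
congr (_ *: (_ *: _)); rewrite basisM !semilin_basis /= !big_cat /=.
rewrite -!mulrA; congr (_ * _); rewrite !mulrA; congr (_ * _).
apply: commr_prod => i _; apply/commr_sym/commr_prod => j _.
exact/esym/vec_covecC.
Qed.

Lemma gl_act_vec U (s : 'cV[C]_n) : gl_act U (vec s) = vec (U *m s).
Proof.
rewrite gl_actE /vec semilin_sum.
under eq_bigr => i _ do
  rewrite semilinZ semilin_basis /= big_seq1 big_nil mulr1 scaler_sumr.
rewrite exchange_big; apply: eq_bigr => k _; rewrite mxE scaler_suml.
by apply: eq_bigr => i _; rewrite mxE scalerA mulrC.
Qed.

Lemma gl_act_covec U (s : 'cV[C]_n) : gl_act U (covec s) = covec (invmx U^T *m s).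
Proof.
rewrite gl_actE /covec semilin_sum.
under eq_bigr => i _ do
  rewrite semilinZ semilin_basis /= big_seq1 big_nil mul1r scaler_sumr.
rewrite exchange_big; apply: eq_bigr => k _; rewrite mxE scaler_suml.
by apply: eq_bigr => i _; rewrite mxE scalerA mulrC.
Qed.

Lemma gl_act_unique U (f : T -> T) :
  f 1 = 1 -> {morph f : x y / x * y} -> {morph f : x y / x + y} ->
  (forall a x, f (a *: x) = a *: f x) ->
  (forall s, f (vec s) = vec (U *m s)) ->
  (forall s, f (covec s) = covec (invmx U^T *m s)) ->
  f =1 gl_act U.
Proof.
move=> f1 fM fD fZ fv fc z.
have f0 : f 0 = 0 by rewrite -[X in f X](scale0r (0 : T)) fZ scale0r.
rewrite {1}[z]basisE (big_morph f fD f0) /gl_act; apply: eq_bigr => w _.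
rewrite fZ basis_prod fM !(big_morph f fM f1); congr (_ *: (_ * _)).
  by apply: eq_bigr => i _; rewrite fv colE.
by apply: eq_bigr => i _; rewrite fc colE.
Qed.

Lemma starE z : star z = semilin Num.conj (fun w => basis C (rev w.2, rev w.1)) z.
Proof. by []. Qed.

Lemma starD x y : star (x + y) = star x + star y.
Proof. by rewrite !starE semilinD. Qed.

Lemma starZ a x : star (a *: x) = a^* *: star x.
Proof. by rewrite !starE semilinZ. Qed.

Lemma star_basis w : star (basis C w) = basis C (rev w.2, rev w.1) :> T.
Proof. by rewrite starE semilin_basis. Qed.

Lemma starK : involutive (star : T -> T).
Proof.
move=> z; rewrite [in RHS](basisE z) [X in star X]/star starE semilin_sum.
apply: eq_bigr => w _; rewrite semilinZ semilin_basis /= !revK conjCK.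
by case: w.
Qed.

Lemma starM x y : star (x * y) = star y * star x.
Proof.
rewrite [x]basisE [y]basisE !starE mulr_suml !semilin_sum mulr_sumr.
apply: eq_bigr => u _; rewrite mulr_sumr mulr_suml semilin_sum; apply: eq_bigr => v _.
rewrite -scalerAl tensor_scaleAr !semilinZ /= -scalerAl tensor_scaleAr.
rewrite basisM !semilin_basis basisM /biword_cat /= !rev_cat !scalerA.
by rewrite [X in X *: _]mulrC.
Qed.

Lemma star_vec (s : 'cV[C]_n) : star (vec s) = covec (map_mx Num.conj s).
Proof.
rewrite starE /vec semilin_sum; apply: eq_bigr => i _.
by rewrite semilinZ semilin_basis mxE.
Qed.

End Checks.

(* Main.v *)
Require Import Defs.
From HB Require Import structures.
From mathcomp Require Import all_boot all_order all_algebra finmap.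
From mathcomp Require Import all_classical all_reals.
From mathcomp Require Import complex.
From mathcomp Require Import -(notations) mpoly monalg.

Set Implicit Arguments.
Unset Strict Implicit.
Unset Printing Implicit Defensive.

Import Order.TTheory GRing.Theory Num.Theory.

Local Open Scope classical_set_scope.
Local Open Scope ring_scope.

(** T^G is an algebra of the required kind: it is stable under the star because G
  is, closed under contractions because V^* carries the contragredient action,
  and nondegenerate because it contains the identity tensor, the sum of the
  e_i (x) e_i^*. Conversely the stabilizer of a star-stable A is a linear
  algebraic *-subgroup. What has to be proved is that T^H determines H
  ([invariants_separate]) and that A is the algebra of invariants of its
  stabilizer ([invariants_stabilizer]). Groups form a lattice under
  intersection, and the order-reversing bijection transports the lattice
  operations to algebras.

  [invariants_separate] is a double commutant argument. For bounded k the
  matrices g^(x)k with g in H span a space that is stable under multiplication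
  by H, and H is closed under adjoints, so that the orthogonal projection onto
  this space commutes with H: its blocks are H-invariant tensors. If U fixes all
  of T^H, then U commutes with the projection, the powers of U lie in the span
  as well, and every polynomial that vanishes on H vanishes at U.

  [invariants_stabilizer] is a Tannaka-Krein argument, in which integration over
  the group that is sought is available before the group is.
  - The orthogonal projection of the identity tensor is a unit e of the matrix
    *-algebra A_(1,1). By positivity e acts trivially on each factor of each
    element of A, so A lies in T(W) (x) T(W^* ) for the image W of e, and e = 1
    by nondegeneracy ([id_tensor_closed]). Contracting with the identity tensor
    then permutes the factors of the elements of A.
  - Let p be the orthogonal projection of T onto A, and consider polynomials in
    the entries of two matrices X and Y, which act on V and on V^*. Sending the
    monomial X_(u, v) Y_(u', v') to the matrix coefficient of p at these words
    is well defined, as p commutes with permutations, and gives the Haar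
    functional h. Since p is a morphism of A-modules ([pr_tcomp]), h vanishes on
    the ideal generated by the coefficients of (X, Y) a - a for a in A
    ([haar_defect]).
  - h is positive, h (f^* f) >= 0 ([haar_pos]): this is a statement on the
    projection onto a finite-dimensional *-algebra of matrices, whose proof
    computes the square of a Casimir operator ([projection_psd]). By the
    Cauchy-Schwarz inequality h (f) = 0 as soon as a power of f belongs to the
    largest ideal J on which h vanishes ([haar_nilpotent]).
  - The zeros of J are pairs (X, (X^T)^-1) with X in the stabilizer of A. If z is
    fixed by the stabilizer, then the coefficients f of (X, Y) z - z vanish at
    these zeros. By the Nullstellensatz ([zero_of_ideal]) a power of f belongs
    to J, so that 0 = h (f), which is a coefficient of p z - z. So z = p z is in
    A.

  The Nullstellensatz is proved for an uncountable field, one variable at a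
  time: over such a field a space of countable dimension does not contain the
  independent family of all 1 / (x - a). *)

Local Notation basis := Defs.basis.
Local Notation contract := Defs.contract.
Local Notation nondegenerate := Defs.nondegenerate.

(** * Words and coefficients of tensors *)

Section Words.
Context {n : nat}.

Fixpoint words (k : nat) : seq (seq 'I_n) :=
  if k is k'.+1 then [seq c :: s | c <- enum 'I_n, s <- words k'] else [:: [::]].

Lemma mem_words k s : (s \in words k) = (size s == k).
Proof.
elim: k s => [|k IH] s; first by rewrite inE; case: s.
case: s => [|c s] /=; first by apply/negbTE/negP => /allpairsP[[? ?] []].
rewrite eqSS -IH; apply/allpairsP/idP => [[[d t] /= [_ h [_ ->]]] //|h].
by exists (c, s); rewrite mem_enum.
Qed.

Lemma words_uniq k : uniq (words k).
Proof.
elim: k => //= k IH; apply: allpairs_uniq => //; first exact: enum_uniq.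
by move=> [c s] [d t] _ _ /= [-> ->].
Qed.

Arguments words : simpl never.

Definition biwords (k l : nat) : seq (biword n) :=
  [seq (s, t) | s <- words k, t <- words l].

Lemma mem_biwords k l (w : biword n) :
  (w \in biwords k l) = (size w.1 == k) && (size w.2 == l).
Proof.
case: w => s t /=; rewrite -!mem_words; apply/allpairsP/andP.
  by move=> [[s' t'] /= [hs ht [-> ->]]].
by move=> [hs ht]; exists (s, t).
Qed.

Lemma biwords_uniq k l : uniq (biwords k l).
Proof.
apply: allpairs_uniq; try exact: words_uniq.
by move=> [c s] [d t] _ _ /= [-> ->].
Qed.

Section Sums.
Context {Z : nmodType}.

Lemma big_words0 (F : seq 'I_n -> Z) : \sum_(s <- words 0) F s = F [::].
Proof. by rewrite big_seq1. Qed.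

Lemma big_wordsS k (F : seq 'I_n -> Z) :
  \sum_(s <- words k.+1) F s = \sum_(c < n) \sum_(s <- words k) F (c :: s).
Proof. by rewrite big_allpairs_dep /= big_enum. Qed.

Lemma big_biwords k l (F : biword n -> Z) :
  \sum_(w <- biwords k l) F w =
  \sum_(s <- words k) \sum_(t <- words l) F (s, t).
Proof. by rewrite big_allpairs_dep. Qed.

Lemma big_words_cat k l (F : seq 'I_n -> Z) :
  \sum_(s <- words (k + l)) F s =
  \sum_(s <- words k) \sum_(t <- words l) F (s ++ t).
Proof.
elim: k F => [|k IH] F; first by rewrite big_words0.
rewrite addSn !big_wordsS; apply: eq_bigr => c _.
by rewrite (IH (fun s => F (c :: s))).
Qed.

Lemma big_words_rev k (F : seq 'I_n -> Z) :
  \sum_(s <- words k) F s = \sum_(s <- words k) F (rev s).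
Proof.
rewrite -(big_map rev xpredT F); apply: perm_big; apply: uniq_perm.
- exact: words_uniq.
- by rewrite map_inj_uniq ?words_uniq//; exact: (can_inj revK).
move=> s; rewrite mem_words; apply/idP/mapP => [h|[t]].
  by exists (rev s); rewrite ?revK // mem_words size_rev.
by rewrite mem_words => /eqP <- ->; rewrite size_rev.
Qed.

Lemma big_biwords_cat k l k' l' (F : biword n -> Z) :
  \sum_(w <- biwords (k + k') (l + l')) F w =
  \sum_(u <- biwords k l) \sum_(v <- biwords k' l') F (biword_cat u v).
Proof.
rewrite !big_biwords big_words_cat; apply: eq_bigr => s _.
under eq_bigr do rewrite big_words_cat.
rewrite exchange_big; apply: eq_bigr => t _ /=.
by rewrite big_biwords.
Qed.

Definition insert (i : nat) (c : 'I_n) (s : seq 'I_n) : seq 'I_n :=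
  take i s ++ c :: drop i s.

Lemma insert_cat (s t : seq 'I_n) c : insert (size s) c (s ++ t) = s ++ c :: t.
Proof. by rewrite /insert take_size_cat // drop_size_cat. Qed.

Lemma size_insert i c s : size (insert i c s) = (size s).+1.
Proof. by rewrite /insert size_cat /= addnS -size_cat cat_take_drop. Qed.

Lemma big_words_insert i k (F : seq 'I_n -> Z) : (i <= k)%N ->
  \sum_(s <- words k.+1) F s = \sum_(c < n) \sum_(s <- words k) F (insert i c s).
Proof.
move=> ik; rewrite -{2}(subnKC ik).
under [RHS]eq_bigr do rewrite big_words_cat.
have -> : k.+1 = (i + (k - i).+1)%N by rewrite addnS subnKC.
rewrite big_words_cat [RHS]exchange_big /=.
apply: eq_big_seq => s; rewrite mem_words => /eqP si.
rewrite big_wordsS; apply: eq_bigr => c _; apply: eq_bigr => t _.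
by rewrite -si insert_cat.
Qed.

Lemma eq_big_supp (I : eqType) (D1 D2 : seq I) (G : I -> Z) :
  uniq D1 -> uniq D2 ->
  (forall w, w \in D1 -> w \notin D2 -> G w = 0) ->
  (forall w, w \in D2 -> w \notin D1 -> G w = 0) ->
  \sum_(w <- D1) G w = \sum_(w <- D2) G w.
Proof.
move=> u1 u2 h1 h2.
rewrite (bigID (mem D2)) /= [X in _ + X]big1_seq ?addr0; last first.
  by move=> w /andP[n1 i1]; exact: h1.
rewrite [RHS](bigID (mem D1)) /= [X in _ = _ + X]big1_seq ?addr0; last first.
  by move=> w /andP[n1 i1]; exact: h2.
rewrite -big_filter -[RHS]big_filter; apply: perm_big; apply: uniq_perm.
- exact: filter_uniq.
- exact: filter_uniq.
by move=> w; rewrite !mem_filter andbC.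
Qed.

End Sums.

Lemma big_seq_delta (Z : pzSemiRingType) (I : eqType) (D : seq I) (F : I -> Z) v :
  uniq D -> \sum_(u <- D) F u * (u == v)%:R = if v \in D then F v else 0.
Proof.
move=> uD; case: ifPn => vD.
  rewrite (bigD1_seq v) //= eqxx mulr1 big1 ?addr0 // => u /negbTE ->.
  by rewrite mulr0.
rewrite big1_seq // => u /andP[_ uD']; case: eqP => [E|]; last by rewrite mulr0.
by rewrite -E uD' in vD.
Qed.

End Words.

Section Coef.
Context {C : numClosedFieldType} {n : nat}.
Local Notation T := (tensors C n).
Local Notation bw := (biword n).
Implicit Types (x y z : T) (u v w : bw) (a : C).

Definition coef w z : C := monalg.mcoeff w z.

Lemma coefD w x y : coef w (x + y) = coef w x + coef w y.
Proof. by rewrite /coef tensorsDE monalg.mcoeffD. Qed.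

Lemma coefZ w a x : coef w (a *: x) = a * coef w x.
Proof. by rewrite /coef tensorsZE monalg.mcoeffZ. Qed.

Lemma coef0 w : coef w 0 = 0.
Proof. by rewrite -(scale0r (0 : T)) coefZ mul0r. Qed.

Lemma coefN w x : coef w (- x) = - coef w x.
Proof. by rewrite -scaleN1r coefZ mulN1r. Qed.

Lemma coefB w x y : coef w (x - y) = coef w x - coef w y.
Proof. by rewrite coefD coefN. Qed.

Lemma coef_sum w I (r : seq I) P (F : I -> T) :
  coef w (\sum_(i <- r | P i) F i) = \sum_(i <- r | P i) coef w (F i).
Proof. exact: (big_morph _ (coefD w) (coef0 w)). Qed.

Lemma coef_basis w u : coef w (basis C u) = (u == w)%:R.
Proof. by rewrite /coef basis.unlock monalg.mcoeffU. Qed.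

Lemma tensorP x y : (forall w, coef w x = coef w y) -> x = y.
Proof. by move=> h; apply/monalg.malgP. Qed.

Lemma coef_out w z : w \notin monalg.msupp z -> coef w z = 0.
Proof. exact: monalg.mcoeff_outdom. Qed.

Lemma mem_supp w z : (w \in monalg.msupp z) = (coef w z != 0).
Proof. by rewrite monalg.mcoeff_neq0. Qed.

Lemma homogP k l z : homog k l z <->
  forall w, (size w.1, size w.2) != (k, l) -> coef w z = 0.
Proof.
split=> [h w|h w].
  apply: contraNeq => nz; rewrite -mem_supp in nz.
  by have [-> ->] := h _ nz.
rewrite mem_supp => nz; suff /eqP[-> ->] : (size w.1, size w.2) == (k, l) by [].
by apply: contra_neqT nz; exact: h.
Qed.

Lemma big_supp_biwords k l z (F : bw -> C) :
  (forall w, (size w.1, size w.2) != (k, l) -> F w = 0) ->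
  \sum_(w <- monalg.msupp z) coef w z * F w =
  \sum_(w <- biwords k l) coef w z * F w.
Proof.
move=> hF; apply: eq_big_supp => [||w _|w _].
- exact: fset_uniq.
- exact: biwords_uniq.
- by rewrite mem_biwords -xpair_eqE => /hF ->; rewrite mulr0.
- by move/coef_out ->; rewrite mul0r.
Qed.

Lemma tensorE z : z = \sum_(w <- monalg.msupp z) coef w z *: basis C w.
Proof. exact: basisE. Qed.

Definition of_coefs (D : seq bw) (f : bw -> C) : T := \sum_(w <- D) f w *: basis C w.

Lemma coef_of_coefs D f w : uniq D -> coef w (of_coefs D f) = if w \in D then f w else 0.
Proof.
move=> uD; rewrite coef_sum -big_seq_delta //.
by apply: eq_bigr => u _; rewrite coefZ coef_basis.
Qed.

Lemma homog_of_coefs k l f : homog k l (of_coefs (biwords k l) f).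
Proof.
apply/homogP => w; rewrite coef_of_coefs ?biwords_uniq // mem_biwords -xpair_eqE.
by move/negbTE ->.
Qed.
Arguments homog_of_coefs : clear implicits.

Lemma coef_of_coefs_biwords k l f w : size w.1 = k -> size w.2 = l ->
  coef w (of_coefs (biwords k l) f) = f w.
Proof.
by move=> <- <-; rewrite coef_of_coefs ?biwords_uniq // mem_biwords !eqxx.
Qed.

Lemma homog_coef_eq k l x y : homog k l x -> homog k l y ->
  (forall w, size w.1 = k -> size w.2 = l -> coef w x = coef w y) -> x = y.
Proof.
move=> /homogP hx /homogP hy h; apply: tensorP => w.
have [[e1 e2]|ne] := eqVneq (size w.1, size w.2) (k, l); first exact: h.
by rewrite hx ?hy.
Qed.

Lemma homogE k l z : homog k l z -> z = of_coefs (biwords k l) (coef^~ z).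
Proof.
move=> hz; apply: (homog_coef_eq hz); first exact: homog_of_coefs.
by move=> w e1 e2; rewrite coef_of_coefs_biwords.
Qed.

Lemma homog_lin k l a x y : homog k l x -> homog k l y -> homog k l (a *: x + y).
Proof.
move=> /homogP hx /homogP hy; apply/homogP => w hw.
by rewrite coefD coefZ hx ?hy // mulr0 addr0.
Qed.

Lemma homog0 k l : homog k l (0 : T).
Proof. by apply/homogP => w _; rewrite coef0. Qed.
Arguments homog0 : clear implicits.

Lemma homog_basis w : homog (size w.1) (size w.2) (basis C w : T).
Proof.
apply/homogP => v; rewrite coef_basis; case: (w =P v) => [->|//].
by rewrite eqxx.
Qed.
Arguments homog_basis : clear implicits.

Lemma homogM k l k' l' x y : homog k l x -> homog k' l' y ->
  homog (k + k') (l + l') (x * y).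
Proof.
move=> hx hy; rewrite (homogE hx) (homogE hy) /of_coefs; apply/homogP => w hw.
rewrite mulr_suml coef_sum big1_seq // => u /andP[_].
rewrite mem_biwords => /andP[/eqP u1 /eqP u2].
rewrite mulr_sumr coef_sum big1_seq // => v /andP[_].
rewrite mem_biwords => /andP[/eqP v1 /eqP v2].
rewrite -scalerAl tensor_scaleAr basisM !coefZ coef_basis.
case: eqP => [E|]; last by rewrite !mulr0.
by move: hw; rewrite -E /= !size_cat u1 u2 v1 v2 eqxx.
Qed.

Lemma biword_cat_inj u v u' v' : size u.1 = size u'.1 -> size u.2 = size u'.2 ->
  (biword_cat u v == biword_cat u' v') = (u == u') && (v == v').
Proof.
case: u v u' v' => [s t] [p q] [s' t'] [p' q'] /= e1 e2.
by rewrite /biword_cat /= !xpair_eqE !eqseq_cat // andbACA.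
Qed.

(** The bidegree of x tells where the word of a product is cut. *)
Lemma coefM k l u v x y : homog k l x -> size u.1 = k -> size u.2 = l ->
  coef (biword_cat u v) (x * y) = coef u x * coef v y.
Proof.
move=> hx u1 u2; rewrite {1}(homogE hx) [y in LHS]tensorE /of_coefs mulr_suml coef_sum.
transitivity (\sum_(u' <- biwords k l) coef u' x * (u' == u)%:R * coef v y).
  apply: eq_big_seq => u'; rewrite mem_biwords => /andP[/eqP e1 /eqP e2].
  rewrite mulr_sumr coef_sum [in RHS](tensorE y) coef_sum mulr_sumr.
  apply: eq_bigr => v' _; rewrite -scalerAl tensor_scaleAr basisM !coefZ.
  rewrite !coef_basis biword_cat_inj ?e1 ?e2 // -mulrA; congr (_ * _).
  by rewrite mulrCA -natrM mulnb.
rewrite -mulr_suml big_seq_delta ?biwords_uniq // mem_biwords u1 u2 !eqxx //.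
Qed.

Lemma coef1 w : coef w 1 = (w == ([::], [::]))%:R.
Proof. by rewrite -basis1 coef_basis eq_sym. Qed.

(** The index of the star of a basis element. *)
Definition wstar w : bw := (rev w.2, rev w.1).

Lemma wstarK : involutive wstar.
Proof. by case=> s t; rewrite /wstar /= !revK. Qed.

Lemma wstar_cat u v : wstar (biword_cat u v) = biword_cat (wstar v) (wstar u).
Proof. by rewrite /wstar /biword_cat /= !rev_cat. Qed.

Lemma size_wstar1 w : size (wstar w).1 = size w.2.
Proof. exact: size_rev. Qed.

Lemma size_wstar2 w : size (wstar w).2 = size w.1.
Proof. exact: size_rev. Qed.

Lemma coef_star w z : coef w (star z) = (coef (wstar w) z)^*.
Proof.
rewrite starE /semilin coef_sum.
transitivity (\sum_(u <- monalg.msupp z) (coef u z)^* * (u == wstar w)%:R).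
  apply: eq_bigr => u _; rewrite coefZ coef_basis -/(wstar u).
  by rewrite (can2_eq wstarK wstarK).
rewrite big_seq_delta ?fset_uniq //; case: ifPn => // /coef_out ->.
by rewrite conjC0.
Qed.

Lemma homog_star k l z : homog k l z -> homog l k (star z).
Proof.
move=> /homogP h; apply/homogP => w hw; rewrite coef_star h ?conjC0 //.
by rewrite size_wstar1 size_wstar2; move: hw; rewrite !xpair_eqE andbC.
Qed.

Lemma big_biwords_star (Z : nmodType) k l (F : bw -> Z) :
  \sum_(w <- biwords k l) F w = \sum_(w <- biwords l k) F (wstar w).
Proof.
rewrite !big_biwords big_words_rev exchange_big big_words_rev.
by [].
Qed.

End Coef.

(** * Endomorphisms of T *)

Section Mono.
Context {n : nat} {R : comNzRingType}.
Implicit Types (X Y : 'M[R]_n) (a u : seq 'I_n).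

(** The coefficient of the basis element a in the image of the basis element u
    under the tensor power of X. *)
Definition mono X a u : R := \prod_(p <- zip a u) X p.1 p.2.

Lemma mono_nil X : mono X [::] [::] = 1.
Proof. by rewrite /mono big_nil. Qed.

Lemma mono_cons X i j a u : mono X (i :: a) (j :: u) = X i j * mono X a u.
Proof. by rewrite /mono /= big_cons. Qed.

Lemma mono_cat X a u a' u' : size a = size u ->
  mono X (a ++ a') (u ++ u') = mono X a u * mono X a' u'.
Proof. by move=> e; rewrite /mono zip_cat // big_cat. Qed.

Lemma mono_rev X a u : size a = size u -> mono X (rev a) (rev u) = mono X a u.
Proof.
move=> e; rewrite /mono -rev_zip //; apply: perm_big.
by rewrite perm_rev.
Qed.

Lemma mono_tr X a u : mono X^T a u = mono X u a.
Proof.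
rewrite /mono; elim: a u => [|i a IH] [|j u] /=; rewrite ?big_nil ?big_cons //.
by rewrite IH mxE.
Qed.

Lemma mono1 a u : size a = size u -> mono 1%:M a u = (a == u)%:R.
Proof.
elim: a u => [|i a IH] [|j u] //=; first by rewrite mono_nil.
move=> [e]; rewrite mono_cons IH // mxE -natrM mulnb eqseq_cons.
by [].
Qed.

Lemma mono_mul X Y a w : size a = size w ->
  \sum_(u <- words (size a)) mono X a u * mono Y u w = mono (X *m Y) a w.
Proof.
elim: a w => [|i a IH] [|j w] //=; first by rewrite big_words0 !mono_nil mulr1.
move=> [e]; rewrite big_wordsS mono_cons -IH // mxE mulr_suml.
apply: eq_bigr => c _; rewrite mulr_sumr; apply: eq_bigr => u _.
by rewrite !mono_cons mulrACA.
Qed.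

Lemma mono_insert X i c d s t : size s = size t ->
  mono X (insert i c s) (insert i d t) = X c d * mono X s t.
Proof.
move=> e; rewrite /insert mono_cat ?size_take ?e // mono_cons mulrCA.
rewrite -mono_cat ?size_take ?e //.
by rewrite !cat_take_drop.
Qed.

End Mono.

Lemma mono_map n (R S : comNzRingType) (f : {rmorphism R -> S}) (X : 'M[R]_n) a u :
  f (mono X a u) = mono (map_mx f X) a u.
Proof. by rewrite /mono rmorph_prod; apply: eq_bigr => p _; rewrite mxE. Qed.

Section Act.
Context {C : numClosedFieldType} {n : nat}.
Local Notation T := (tensors C n).
Local Notation bw := (biword n).
Implicit Types (x y z : T) (u v w : bw) (X Y U : 'M[C]_n).

Lemma coef_vec (s : 'cV[C]_n) w : coef w (vec s : T) =
  \sum_i s i 0 * (([:: i], [::]) == w)%:R.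
Proof.
by rewrite /vec coef_sum; apply: eq_bigr => i _; rewrite coefZ coef_basis.
Qed.

Lemma coef_covec (s : 'cV[C]_n) w : coef w (covec s : T) =
  \sum_i s i 0 * (([::], [:: i]) == w)%:R.
Proof.
by rewrite /covec coef_sum; apply: eq_bigr => i _; rewrite coefZ coef_basis.
Qed.

Lemma coef_vec1 (s : 'cV[C]_n) i : coef ([:: i], [::]) (vec s : T) = s i 0.
Proof.
rewrite coef_vec (bigD1 i) //= eqxx mulr1 big1 ?addr0 // => j ji.
by rewrite xpair_eqE eqseq_cons (negbTE ji) mulr0.
Qed.

Lemma coef_covec1 (s : 'cV[C]_n) i : coef ([::], [:: i]) (covec s : T) = s i 0.
Proof.
rewrite coef_covec (bigD1 i) //= eqxx mulr1 big1 ?addr0 // => j ji.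
by rewrite xpair_eqE eqseq_cons (negbTE ji) mulr0.
Qed.

Lemma homog_vec (s : 'cV[C]_n) : homog 1 0 (vec s : T).
Proof.
apply/homogP => w; rewrite coef_vec => hw; apply: big1 => i _.
case: (_ =P w) => [E|]; last by rewrite mulr0.
by rewrite -E eqxx in hw.
Qed.
Arguments homog_vec : clear implicits.

Lemma homog_covec (s : 'cV[C]_n) : homog 0 1 (covec s : T).
Proof.
apply/homogP => w; rewrite coef_covec => hw; apply: big1 => i _.
case: (_ =P w) => [E|]; last by rewrite mulr0.
by rewrite -E eqxx in hw.
Qed.
Arguments homog_covec : clear implicits.

Lemma homog1 : homog 0 0 (1 : T).
Proof. by rewrite -basis1; exact: homog_basis. Qed.

Lemma homog_prod_vec (xs : seq 'cV[C]_n) :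
  homog (size xs) 0 (\prod_(x <- xs) vec x : T).
Proof.
elim: xs => [|x xs IH]; first by rewrite big_nil; exact: homog1.
by have := homogM (homog_vec x) IH; rewrite add1n addn0 big_cons.
Qed.
Arguments homog_prod_vec : clear implicits.

Lemma homog_prod_covec (xs : seq 'cV[C]_n) :
  homog 0 (size xs) (\prod_(x <- xs) covec x : T).
Proof.
elim: xs => [|x xs IH]; first by rewrite big_nil; exact: homog1.
by have := homogM (homog_covec x) IH; rewrite add1n addn0 big_cons.
Qed.
Arguments homog_prod_covec : clear implicits.

Lemma coef_prod_vec (xs : seq 'cV[C]_n) (a : seq 'I_n) : size a = size xs ->
  coef (a, [::]) (\prod_(x <- xs) vec x : T) =
  \prod_(p <- zip xs a) p.1 p.2 0.
Proof.
elim: xs a => [|x xs IH] [|i a] //=; first by rewrite !big_nil coef1 eqxx.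
move=> [e]; rewrite !big_cons.
have -> : (i :: a, [::]) = biword_cat ([:: i], [::]) (a, [::]) by [].
by rewrite (coefM _ _ (homog_vec x)) //= coef_vec1 IH.
Qed.

Lemma coef_prod_covec (xs : seq 'cV[C]_n) (a : seq 'I_n) : size a = size xs ->
  coef ([::], a) (\prod_(x <- xs) covec x : T) =
  \prod_(p <- zip xs a) p.1 p.2 0.
Proof.
elim: xs a => [|x xs IH] [|i a] //=; first by rewrite !big_nil coef1 eqxx.
move=> [e]; rewrite !big_cons.
have -> : ([::], i :: a) = biword_cat ([::], [:: i]) ([::], a) by [].
by rewrite (coefM _ _ (homog_covec x)) //= coef_covec1 IH.
Qed.

Lemma homog_prods (xs ys : seq 'cV[C]_n) : homog (size xs) (size ys)
  ((\prod_(x <- xs) vec x) * (\prod_(y <- ys) covec y) : T).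
Proof.
have := homogM (homog_prod_vec xs) (homog_prod_covec ys).
by rewrite addn0 add0n.
Qed.
Arguments homog_prods : clear implicits.

Lemma coef_prods (xs ys : seq 'cV[C]_n) (a b : seq 'I_n) :
  coef (a, b) ((\prod_(x <- xs) vec x) * (\prod_(y <- ys) covec y) : T) =
  if (size a == size xs) && (size b == size ys) then
    (\prod_(p <- zip xs a) p.1 p.2 0) * (\prod_(p <- zip ys b) p.1 p.2 0)
  else 0.
Proof.
case: ifPn => [/andP[/eqP ea /eqP eb]|ne]; last first.
  by have /homogP -> := homog_prods xs ys.
have -> : (a, b) = biword_cat (a, [::]) ([::], b) by rewrite /biword_cat /= cats0.
rewrite (coefM _ _ (homog_prod_vec xs)) //=.
by rewrite coef_prod_vec // coef_prod_covec.
Qed.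

(** The algebra endomorphism with e_i |-> X e_i and e_j^* |-> Y e_j^*. X and Y are
    unrelated, so that the two kinds of factors can be treated one at a time. *)
Definition act X Y z : T :=
  \sum_(w <- monalg.msupp z) coef w z *:
    ((\prod_(i <- w.1) vec (col i X)) * (\prod_(j <- w.2) covec (col j Y))).

Lemma gl_act_act U z : gl_act U z = act U (invmx U^T) z.
Proof. by []. Qed.

Lemma zip_map_col X (a u : seq 'I_n) :
  \prod_(p <- zip [seq col i X | i <- u] a) p.1 p.2 0 = mono X a u.
Proof.
rewrite /mono; elim: u a => [|j u IH] [|i a] //=; rewrite ?big_nil ?big_cons //.
by rewrite IH mxE.
Qed.

Lemma coef_act a b X Y z : coef (a, b) (act X Y z) =
  \sum_(w <- biwords (size a) (size b))
     coef w z * (mono X a w.1 * mono Y b w.2).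
Proof.
rewrite /act coef_sum.
pose F w := if (size a == size w.1) && (size b == size w.2) then
  mono X a w.1 * mono Y b w.2 else 0.
transitivity (\sum_(w <- monalg.msupp z) coef w z * F w).
  apply: eq_bigr => w _; rewrite coefZ; congr (_ * _).
  rewrite -(big_map (fun i => col i X) xpredT vec).
  rewrite -(big_map (fun i => col i Y) xpredT covec).
  by rewrite coef_prods !size_map !zip_map_col.
rewrite (@big_supp_biwords _ _ (size a) (size b)); last first.
  move=> w hw; rewrite /F ifF //; apply: contraNF hw.
  by move=> /andP[/eqP -> /eqP ->].
apply: eq_big_seq => w; rewrite mem_biwords /F eq_sym.
by rewrite [size w.2 == _]eq_sym => ->.
Qed.

Lemma coef_actE a b X Y z : coef (a, b) (act X Y z) =
  \sum_(s <- words (size a)) \sum_(t <- words (size b))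
     mono X a s * mono Y b t * coef (s, t) z.
Proof.
rewrite coef_act big_biwords; apply: eq_bigr => s _; apply: eq_bigr => t _.
by rewrite mulrC.
Qed.

Lemma coef_actl a b X z : coef (a, b) (act X 1%:M z) =
  \sum_(s <- words (size a)) mono X a s * coef (s, b) z.
Proof.
rewrite coef_actE; apply: eq_bigr => s _.
transitivity (\sum_(t <- words (size b)) mono X a s * coef (s, t) z * (t == b)%:R).
  apply: eq_big_seq => t; rewrite mem_words => /eqP et.
  by rewrite mono1 // eq_sym mulrAC.
by rewrite big_seq_delta ?words_uniq // mem_words eqxx.
Qed.

Lemma coef_actr a b X z : coef (a, b) (act 1%:M X z) =
  \sum_(t <- words (size b)) mono X b t * coef (a, t) z.
Proof.
rewrite coef_actE exchange_big; apply: eq_bigr => t _ /=.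
transitivity (\sum_(s <- words (size a)) mono X b t * coef (s, t) z * (s == a)%:R).
  apply: eq_big_seq => s; rewrite mem_words => /eqP es.
  by rewrite mono1 // eq_sym -mulrA mulrC.
by rewrite big_seq_delta ?words_uniq // mem_words eqxx.
Qed.

Lemma homog_act k l X Y z : homog k l z -> homog k l (act X Y z).
Proof.
move=> /homogP hz; apply/homogP => -[a b] hw; rewrite coef_act big1_seq //.
move=> w /andP[_]; rewrite mem_biwords => /andP[/eqP e1 /eqP e2].
by rewrite hz ?mul0r // e1 e2.
Qed.

Lemma actD X Y x y : act X Y (x + y) = act X Y x + act X Y y.
Proof.
apply: tensorP => -[a b]; rewrite coefD !coef_act -big_split /=.
by apply: eq_bigr => w _; rewrite coefD mulrDl.
Qed.

Lemma actZ X Y c x : act X Y (c *: x) = c *: act X Y x.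
Proof.
apply: tensorP => -[a b]; rewrite coefZ !coef_act mulr_sumr.
by apply: eq_bigr => w _; rewrite coefZ mulrA.
Qed.

Lemma act0 X Y : act X Y 0 = 0 :> T.
Proof. by rewrite -[X in act _ _ X](scale0r (0 : T)) actZ scale0r. Qed.

Lemma act_sum X Y I (r : seq I) (F : I -> T) :
  act X Y (\sum_(i <- r) F i) = \sum_(i <- r) act X Y (F i).
Proof. exact: (big_morph _ (actD X Y) (act0 X Y)). Qed.

Lemma act_comp X Y X' Y' z : act X Y (act X' Y' z) = act (X *m X') (Y *m Y') z.
Proof.
apply: tensorP => -[a b]; rewrite !coef_actE.
transitivity (\sum_(s' <- words (size a)) \sum_(t' <- words (size b))
  \sum_(s <- words (size a)) \sum_(t <- words (size b))
  mono X a s * mono Y b t * (mono X' s s' * mono Y' t t' * coef (s', t') z)).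
  under [RHS]eq_bigr do rewrite exchange_big.
  rewrite [RHS]exchange_big; apply: eq_big_seq => s; rewrite mem_words => /eqP es.
  under [RHS]eq_bigr do rewrite exchange_big.
  rewrite [RHS]exchange_big; apply: eq_big_seq => t; rewrite mem_words => /eqP et.
  rewrite coef_actE es et mulr_sumr; apply: eq_bigr => s' _.
  by rewrite mulr_sumr.
apply: eq_big_seq => s'; rewrite mem_words => /eqP es'.
apply: eq_big_seq => t'; rewrite mem_words => /eqP et'.
rewrite -mono_mul // -(mono_mul Y) // mulr_suml mulr_suml.
apply: eq_bigr => s _; rewrite mulr_sumr mulr_suml; apply: eq_bigr => t _.
by rewrite !mulrA; congr (_ * _); rewrite -!mulrA; congr (_ * _); exact: mulrCA.
Qed.

Lemma act1 z : act 1%:M 1%:M z = z.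
Proof.
apply: tensorP => -[a b]; rewrite coef_act.
transitivity (\sum_(w <- biwords (size a) (size b)) coef w z * (w == (a, b))%:R).
  apply: eq_big_seq => -[s t]; rewrite mem_biwords /= => /andP[/eqP es /eqP et].
  by rewrite !mono1 // -natrM mulnb xpair_eqE ![a == _]eq_sym ![b == _]eq_sym.
by rewrite big_seq_delta ?biwords_uniq // mem_biwords !eqxx.
Qed.

Lemma act_star X Y z :
  act X Y (star z) = star (act (map_mx Num.conj Y) (map_mx Num.conj X) z).
Proof.
apply: tensorP => -[a b]; rewrite coef_star !coef_act rmorph_sum /=.
rewrite !size_rev big_biwords_star; apply: eq_big_seq => -[s t].
rewrite mem_biwords /= => /andP[/eqP es /eqP et].
rewrite coef_star /= wstarK !rmorphM /= -!mono_map /= !conjCK.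
rewrite -{1}(revK a) mono_rev ?size_rev // -{1}(revK b) mono_rev ?size_rev //.
by congr (_ * _); rewrite mulrC.
Qed.

(** The right-hand side is polynomial in the entries of U. *)
Lemma unitmx_actK U z : U \in unitmx -> gl_act U z = z <->
  act U 1%:M z = act 1%:M U^T z.
Proof.
move=> uU; have uUT : U^T \in unitmx by rewrite unitmx_tr.
rewrite gl_act_act; split=> [h|h].
  by rewrite -[in RHS]h act_comp mul1mx mulmxV.
transitivity (act 1%:M (invmx U^T) (act U 1%:M z)).
  by rewrite act_comp mul1mx mulmx1.
by rewrite h act_comp mul1mx mulVmx // act1.
Qed.

Lemma gl_act_comp U U' z : U \in unitmx -> U' \in unitmx ->
  gl_act U (gl_act U' z) = gl_act (U *m U') z.
Proof.
move=> uU uU'; rewrite !gl_act_act act_comp trmx_mul; congr (act _ _ _).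
have u1 : U^T \in unitmx by rewrite unitmx_tr.
have u2 : U'^T \in unitmx by rewrite unitmx_tr.
have e : U'^T *m U^T *m (invmx U^T *m invmx U'^T) = 1%:M.
  by rewrite mulmxA mulmxK // mulmxV.
have u3 : U'^T *m U^T \in unitmx by rewrite unitmx_mul u1 u2.
by apply: (can_inj (mulKmx u3)); rewrite e mulmxV.
Qed.

Lemma gl_act_id z : gl_act 1%:M z = z.
Proof. by rewrite gl_act_act trmx1 invmx1 act1. Qed.

End Act.

(** * Contractions, the identity tensor, homogeneous components *)

Section InsertRemove.
Context {n : nat}.
Implicit Types (s : seq 'I_n).

Lemma insert_remove s i c : onth s i = Some c ->
  (i <= size (remove_nth i s))%N /\ s = insert i c (remove_nth i s).
Proof.
move=> h; have ilt : (i < size s)%N by rewrite -onthTE h.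
have ts : size (take i s) = i by rewrite size_take ilt.
rewrite /remove_nth; split; first by rewrite size_cat ts leq_addr.
rewrite -[X in insert X](ts) insert_cat.
rewrite -{1}(cat_take_drop i s); congr (_ ++ _).
by rewrite (drop_nth c ilt) (onth_nth c _ _ _ h).
Qed.

Lemma onth_insert s i c : (i <= size s)%N -> onth (insert i c s) i = Some c.
Proof.
move=> h; have ts : size (take i s) = i by rewrite size_takel.
by rewrite /insert onth_cat ts ltnn subnn.
Qed.

Lemma remove_insert s i c : (i <= size s)%N -> remove_nth i (insert i c s) = s.
Proof.
move=> h; have ts : size (take i s) = i by rewrite size_takel.
rewrite /remove_nth /insert take_cat ts ltnn subnn take0 cats0.
rewrite drop_cat ts ltnNge leqnSn /= subSn // subnn /= drop0.
exact: cat_take_drop.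
Qed.

Lemma insert_inj s i c d : insert i c s = insert i d s -> c = d.
Proof. by rewrite /insert => /eqP; rewrite eqseq_cat // => /andP[_ /eqP[]]. Qed.

End InsertRemove.

Section Contract.
Context {C : numClosedFieldType} {n : nat}.
Local Notation T := (tensors C n).
Local Notation bw := (biword n).
Implicit Types (x y z : T) (u v w : bw) (X Y U : 'M[C]_n) (s t : seq 'I_n).

(** A word survives a contraction exactly when it is obtained by inserting the
    same letter c in both words of w. *)
Lemma contract_word i j u w :
  ((i < size u.1)%N && (onth u.1 i == onth u.2 j) &&
    ((remove_nth i u.1, remove_nth j u.2) == w))%:R =
  (if (i <= size w.1)%N && (j <= size w.2)%N then
   \sum_c (u == (insert i c w.1, insert j c w.2))%:R else 0) :> C.
Proof.
case: (boolP (_ && _)) => [/andP[/andP[iu /eqP e] /eqP <-]|h] /=.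
  case E : (onth u.1 i) => [c|]; last by move: iu; rewrite -onthTE E.
  rewrite E in e; have [i1 e1] := insert_remove E.
  have [i2 e2] := insert_remove (esym e).
  rewrite i1 i2 /= (bigD1 c) //= -e1 -e2 -surjective_pairing eqxx big1 ?addr0 //.
  move=> d dc; case: eqP => // Eu; case/eqP: dc; apply: (@insert_inj _ (remove_nth i u.1) i).
  by rewrite -e1 [in RHS]Eu.
case: ifP => // /andP[i1 i2]; rewrite big1 // => c _.
case: eqP => // E; case/negP: h; rewrite E /= !onth_insert // !remove_insert //.
by rewrite size_insert ltnS i1 -surjective_pairing !eqxx.
Qed.

Lemma coef_contract i j w z : coef w (contract i j z) =
  if (i <= size w.1)%N && (j <= size w.2)%N then
    \sum_c coef (insert i c w.1, insert j c w.2) z else 0.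
Proof.
rewrite /contract coef_sum big_mkcond /=.
transitivity (\sum_(u <- monalg.msupp z) coef u z *
  (if (i <= size w.1)%N && (j <= size w.2)%N then
   \sum_c (u == (insert i c w.1, insert j c w.2))%:R else 0)).
  apply: eq_bigr => u _; rewrite -contract_word.
  by case: ifP => _; rewrite ?mulr0 // coefZ coef_basis.
case: ifP => _; last by rewrite big1 // => u _; rewrite mulr0.
under [LHS]eq_bigr do rewrite mulr_sumr.
rewrite exchange_big; apply: eq_bigr => c _ /=.
rewrite (big_seq_delta (coef^~ z)) ?fset_uniq //.
by case: ifPn => // /coef_out ->.
Qed.

Lemma homog_contract k l i j z : homog k.+1 l.+1 z -> homog k l (contract i j z).
Proof.
move=> /homogP hz; apply/homogP => w hw; rewrite coef_contract.
case: ifP => // _; rewrite big1 // => c _; apply: hz => /=.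
by rewrite !size_insert; move: hw; rewrite !xpair_eqE !eqSS.
Qed.

(** The pairing of V with V^* is preserved, which is the condition X^T Y = 1. *)
Lemma contract_act X Y i j z : X^T *m Y = 1%:M ->
  contract i j (act X Y z) = act X Y (contract i j z).
Proof.
move=> XY; apply: tensorP => -[a b]; rewrite coef_contract /= coef_actE.
have [/andP[ia jb]|h] := boolP (_ && _); last first.
  rewrite big1_seq // => s /andP[_]; rewrite mem_words => /eqP es.
  rewrite big1_seq // => t /andP[_]; rewrite mem_words => /eqP et.
  by rewrite coef_contract /= es et (negbTE h) mulr0.
transitivity (\sum_(s <- words (size a)) \sum_(t <- words (size b))
  \sum_d \sum_d' (X^T *m Y) d d' * (mono X a s * mono Y b t *
     coef (insert i d s, insert j d' t) z)).
  under eq_bigr do rewrite coef_actE !size_insert (big_words_insert _ ia).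
  rewrite exchange_big /=; under eq_bigr do rewrite exchange_big /=.
  rewrite exchange_big /=; apply: eq_big_seq => s; rewrite mem_words => /eqP es.
  transitivity (\sum_d \sum_c \sum_d' \sum_(t <- words (size b))
     mono X (insert i c a) (insert i d s) * mono Y (insert j c b) (insert j d' t) *
     coef (insert i d s, insert j d' t) z).
    by apply: eq_bigr => d _; apply: eq_bigr => c _; rewrite (big_words_insert _ jb).
  rewrite [RHS]exchange_big; apply: eq_bigr => d _ /=.
  rewrite exchange_big [RHS]exchange_big; apply: eq_bigr => d' _ /=.
  rewrite exchange_big; apply: eq_big_seq => t; rewrite mem_words => /eqP et.
  rewrite mxE mulr_suml; apply: eq_bigr => c _; rewrite !mono_insert // mxE.
  by rewrite !mulrA; congr (_ * _); rewrite -!mulrA; congr (_ * _); exact: mulrCA.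
apply: eq_big_seq => s; rewrite mem_words => /eqP es.
apply: eq_big_seq => t; rewrite mem_words => /eqP et.
rewrite XY coef_contract /= es et ia jb mulr_sumr; apply: eq_bigr => d _.
rewrite (bigD1 d) //= big1 ?addr0 => [|d' dd']; rewrite mxE ?eqxx ?mul1r //.
by rewrite eq_sym (negbTE dd') mul0r.
Qed.

Definition id_tensor : T := \sum_i basis C ([:: i], [:: i]).

Lemma homog_id_tensor : homog 1 1 id_tensor.
Proof.
apply/homogP => w hw; rewrite coef_sum big1 // => i _; rewrite coef_basis.
by case: (_ =P w) => // E; rewrite -E eqxx in hw.
Qed.

Lemma coef_id_tensor i j : coef ([:: i], [:: j]) id_tensor = (i == j)%:R.
Proof.
rewrite coef_sum (bigD1 i) //= coef_basis xpair_eqE !eqseq_cons !eqxx !andbT /=.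
rewrite big1 ?addr0 // => k ki; rewrite coef_basis xpair_eqE !eqseq_cons.
by rewrite (negbTE ki).
Qed.

Lemma act_id_tensor X Y : X *m Y^T = 1%:M -> act X Y id_tensor = id_tensor.
Proof.
move=> XY; apply: (homog_coef_eq (homog_act homog_id_tensor) homog_id_tensor).
move=> [[|i [|? ?]] [|j [|? ?]]] //= _ _.
rewrite coef_actE [size _]/= coef_id_tensor. rewrite !big_wordsS.
transitivity ((X *m Y^T) i j); last by rewrite XY mxE.
rewrite mxE; apply: eq_bigr => c _; rewrite big_words0 big_wordsS mxE.
rewrite (bigD1 c) //= big_words0 coef_id_tensor eqxx !mono_cons !mono_nil !mulr1.
rewrite big1 ?addr0 // => d dc; rewrite big_words0 coef_id_tensor eq_sym.
by rewrite (negbTE dc) mulr0.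
Qed.

Definition hcomp k l z : T := of_coefs (biwords k l) (coef^~ z).

Lemma homog_hcomp k l z : homog k l (hcomp k l z).
Proof. exact: homog_of_coefs. Qed.

Lemma coef_hcomp k l z w :
  coef w (hcomp k l z) = if (size w.1, size w.2) == (k, l) then coef w z else 0.
Proof. by rewrite coef_of_coefs ?biwords_uniq // mem_biwords xpair_eqE. Qed.

Lemma hcomp_act X Y k l z : hcomp k l (act X Y z) = act X Y (hcomp k l z).
Proof.
apply: tensorP => -[a b]; rewrite coef_hcomp !coef_act.
case: ifPn => [|hw] /=.
  move=> /eqP[e1 e2]; apply: eq_big_seq => w; rewrite mem_biwords.
  by move=> /andP[/eqP ew1 /eqP ew2]; rewrite coef_hcomp ew1 ew2 e1 e2 eqxx.
rewrite big1_seq // => w /andP[_]; rewrite mem_biwords.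
by move=> /andP[/eqP ew1 /eqP ew2]; rewrite coef_hcomp ew1 ew2 (negbTE hw) mul0r.
Qed.

Lemma sum_hcomp z : exists N, z = \sum_(k < N) \sum_(l < N) hcomp k l z.
Proof.
pose N := (\max_(w <- monalg.msupp z) maxn (size w.1) (size w.2)).+1.
exists N; apply: tensorP => w; rewrite coef_sum.
have hin : coef w z != 0 -> (size w.1 < N)%N && (size w.2 < N)%N.
  rewrite -mem_supp => win; rewrite !ltnS -geq_max.
  exact: (@leq_bigmax_seq _ _ _ (fun w : biword n => maxn (size w.1) (size w.2))).
have [nz|nz] := eqVneq (coef w z) 0.
  rewrite nz big1 // => k _; rewrite coef_sum big1 // => l _.
  by rewrite coef_hcomp; case: ifP.
have /andP[h1 h2] := hin nz.
rewrite (bigD1 (Ordinal h1)) //= coef_sum (bigD1 (Ordinal h2)) //=.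
rewrite coef_hcomp eqxx big1 => [|l hl].
  rewrite big1 ?addr0 // => k hk; rewrite coef_sum big1 // => l _.
  rewrite coef_hcomp ifF //; apply: contraNF hk => /eqP[e _].
  by apply/eqP/val_inj.
rewrite coef_hcomp ifF //; apply: contraNF hl => /eqP[e].
by apply/eqP/val_inj.
Qed.

End Contract.
Arguments id_tensor {C n}.

(** * Invariants form an algebra, stabilizers are algebraic groups *)

Section Invariants.
Context {C : numClosedFieldType} {n : nat}.
Local Notation T := (tensors C n).
Local Notation bw := (biword n).
Implicit Types (x y z : T) (u v w : bw) (X Y U : 'M[C]_n) (G : set 'M[C]_n).

Lemma invariants_subalgebra G : subalgebra (invariants G : set T).
Proof.
split=> [U _|a x y hx hy U gU|x y hx hy U gU]; first exact: gl_act1.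
  by rewrite gl_actD gl_actZ hx ?hy.
by rewrite gl_actM hx ?hy.
Qed.

Lemma invariants_hcomp G k l z : invariants G z -> invariants G (hcomp k l z).
Proof. by move=> hz U gU; rewrite gl_act_act -hcomp_act -gl_act_act hz. Qed.

Lemma invariants_graded G : graded (invariants G : set T).
Proof.
move=> z hz; have [N e] := sum_hcomp z.
exists N, (fun k l => hcomp k l z); split=> // k l.
by split; [exact: invariants_hcomp | exact: homog_hcomp].
Qed.

Lemma trmxC_inv U : U \in unitmx ->
  invmx (invmx (map_mx Num.conj U^T))^T = map_mx Num.conj U.
Proof.
by move=> uU; rewrite trmx_inv invmxK map_trmx trmxK.
Qed.

Lemma gl_act_star U z : U \in unitmx ->
  star (gl_act U z) = gl_act (invmx (map_mx Num.conj U^T)) (star z).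
Proof.
move=> uU; rewrite [RHS]gl_act_act trmxC_inv // act_star; congr (star (act _ _ _)).
  by apply/matrixP => i j; rewrite !mxE conjCK.
by rewrite map_invmx; congr invmx; apply/matrixP => i j; rewrite !mxE /= conjCK.
Qed.

Lemma star_invariantP G U : star_invariant G -> G U ->
  G (map_mx Num.conj U^T).
Proof. by move=> sG gU; rewrite -sG; exists U. Qed.

Lemma conj_trmxK U : map_mx Num.conj (map_mx Num.conj U^T)^T = U.
Proof. by apply/matrixP => i j; rewrite !mxE conjCK. Qed.

Lemma star_stableP (A : set T) : (forall z, A z -> A (star z)) <-> star_stable A.
Proof.
split=> [h|sA z hz]; last by rewrite -sA; exists z.
apply/seteqP; split=> [z [y hy <-]|z hz]; first exact: h.
by exists (star z); [exact: h | exact: starK].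
Qed.

Lemma invariants_star G : GL_subgroup G -> star_invariant G ->
  star_stable (invariants G : set T).
Proof.
move=> [gu _ _ gi] gs; apply/star_stableP => z hz U gU.
have gU' := gi _ (star_invariantP gs gU).
have uU' := gu _ gU'.
rewrite -[in RHS](hz _ gU') gl_act_star //; congr (gl_act _ _).
by rewrite trmx_inv map_invmx invmxK conj_trmxK.
Qed.

Lemma invariants_contract G : GL_subgroup G ->
  contraction_closed (invariants G : set T).
Proof.
move=> [gu _ _ _] k l i j ik jl z [hz _] U gU.
have uU : U^T \in unitmx by rewrite unitmx_tr; exact: gu.
by rewrite gl_act_act -contract_act ?mulmxV // -gl_act_act hz.
Qed.

Lemma id_tensor_invariant G : GL_subgroup G -> invariants G (id_tensor : T).
Proof.
move=> [gu _ _ _] U gU; rewrite gl_act_act act_id_tensor //.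
by rewrite -trmx_inv trmxK mulmxV //; exact: gu.
Qed.

(** Applied to the identity tensor, this gives all basis vectors. *)
Lemma tensors_over_slot (W : {vspace 'cV[C]_n}) z j : tensors_over W z ->
  (\col_i coef ([:: i], [:: j]) z) \in W.
Proof.
move=> [s [hs ->]].
have -> : \col_i coef ([:: i], [:: j]) (\sum_(t <- s) t.1 *:
    ((\prod_(x <- t.2.1) vec x) * (\prod_(y <- t.2.2) star (vec y)))) =
  \sum_(t <- s) t.1 *: \col_i coef ([:: i], [:: j])
    ((\prod_(x <- t.2.1) vec x) * (\prod_(y <- t.2.2) star (vec y))).
  apply/matrixP => i k; rewrite mxE coef_sum summxE.
  by apply: eq_bigr => t _; rewrite coefZ !mxE.
rewrite big_seq; apply: rpred_sum => t ts; apply: rpredZ.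
have [h1 _] := hs _ ts; case: t {ts hs} h1 => a [xs ys] /= h1.
have -> : \prod_(y <- ys) star (vec y) =
    \prod_(y <- [seq map_mx Num.conj c | c : 'cV[C]_n <- ys]) covec y :> T.
  by rewrite big_map; apply: eq_bigr => c _; exact: star_vec.
case: xs h1 => [|x [|x' xs]] h1.
- have -> : (\col_i coef ([:: i], [:: j]) (\prod_(x <- [::]) vec x *
    \prod_(y <- [seq map_mx Num.conj c | c : 'cV[C]_n <- ys]) covec y : T)) = 0.
    by apply/matrixP => i k; rewrite !mxE coef_prods.
  exact: mem0v.
- have hx : x \in W by apply: h1; rewrite inE.
  case: ys => [|y [|y' ys]].
  + have -> : (\col_i coef ([:: i], [:: j]) (\prod_(x <- [:: x]) vec x *
      \prod_(y <- [seq map_mx Num.conj c | c : 'cV[C]_n <- [::]]) covec y : T)) = 0.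
      by apply/matrixP => i k; rewrite !mxE coef_prods.
    exact: mem0v.
  + have -> : (\col_i coef ([:: i], [:: j]) (\prod_(x <- [:: x]) vec x *
      \prod_(y <- [seq map_mx Num.conj c | c : 'cV[C]_n <- [:: y]]) covec y : T)) =
        (y j 0)^* *: x.
      apply/matrixP => i k; rewrite !mxE coef_prods /= !big_seq1 /= mxE mulrC.
      by rewrite [k]ord1.
    exact: rpredZ.
  have -> : (\col_i coef ([:: i], [:: j]) (\prod_(x <- [:: x]) vec x *
    \prod_(y <- [seq map_mx Num.conj c | c : 'cV[C]_n <- [:: y, y' & ys]]) covec y : T)) = 0.
    by apply/matrixP => i k; rewrite !mxE coef_prods.
  exact: mem0v.
have -> : (\col_i coef ([:: i], [:: j]) (\prod_(x <- [:: x, x' & xs]) vec x *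
  \prod_(y <- [seq map_mx Num.conj c | c : 'cV[C]_n <- ys]) covec y : T)) = 0.
  by apply/matrixP => i k; rewrite !mxE coef_prods.
exact: mem0v.
Qed.

Lemma nondegenerate_id (A : set T) : A id_tensor -> nondegenerate A.
Proof.
move=> hI [W [nW sub]]; case/negP: nW; rewrite eqEsubv subvf; apply/subvP => x _.
have -> : x = \sum_j x j 0 *: \col_i coef ([:: i], [:: j]) id_tensor.
  apply/matrixP => i k; rewrite [k]ord1 summxE (bigD1 i) //= !mxE.
  rewrite coef_id_tensor eqxx mulr1 big1 ?addr0 // => j ji.
  by rewrite !mxE coef_id_tensor eq_sym (negbTE ji) mulr0.
by apply: rpred_sum => j _; apply/rpredZ/tensors_over_slot/sub.
Qed.

Lemma invariants_in G : GL_subgroup G -> star_invariant G ->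
  tensor_subalgebras (invariants G : set T).
Proof.
move=> hG sG; split.
- exact: invariants_subalgebra.
- exact: invariants_graded.
- exact: invariants_star.
- exact: invariants_contract.
exact/nondegenerate_id/id_tensor_invariant.
Qed.

Definition stabilizer (A : set T) : set 'M[C]_n :=
  [set U | U \in unitmx /\ forall z, A z -> gl_act U z = z].

Lemma stabilizer_subgroup A : GL_subgroup (stabilizer A).
Proof.
split=> [U []//||U U' [u h] [u' h']|U [u h]].
- by split=> [|z _]; [exact: unitmx1 | exact: gl_act_id].
- split=> [|z hz]; first by rewrite unitmx_mul u u'.
  by rewrite -gl_act_comp // h' ?h.
split=> [|z hz]; first by rewrite unitmx_inv.
by rewrite -[in LHS](h _ hz) gl_act_comp ?unitmx_inv // mulVmx // gl_act_id.
Qed.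

Lemma stabilizer_star A : star_stable A -> star_invariant (stabilizer A).
Proof.
move=> /star_stableP sA.
have main U : stabilizer A U -> stabilizer A (map_mx Num.conj U^T).
  move=> [u h].
  have u' : map_mx Num.conj U^T \in unitmx by rewrite map_unitmx unitmx_tr.
  suff : stabilizer A (invmx (map_mx Num.conj U^T)).
    have [_ _ _ hi] := stabilizer_subgroup A.
    by move=> /hi; rewrite invmxK.
  split=> [|z hz]; first by rewrite unitmx_inv.
  by rewrite -[z]starK -gl_act_star // h //; exact: sA.
apply/seteqP; split=> [_ [U hU <-]|U hU]; first exact: main.
by exists (map_mx Num.conj U^T); [exact: main | exact: conj_trmxK].
Qed.

(** The polynomial whose value at U is the coefficient of the word w in
    (U (x) 1) z - (1 (x) U^T) z. *)
Definition stab_poly w z : mpoly (n * n) C :=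
  let X := \matrix_(i, j) mpolyX C (mpoly.mnm1 (mxvec_index i j)) in
  \sum_(s <- words (size w.1)) mpolyC (n * n) (coef (s, w.2) z) * mono X w.1 s -
  \sum_(t <- words (size w.2)) mpolyC (n * n) (coef (w.1, t) z) * mono X^T w.2 t.

Lemma meval_stab_poly U w z :
  meval (fun k => mxvec U 0 k) (stab_poly w z) =
  coef w (act U 1%:M z) - coef w (act 1%:M U^T z).
Proof.
have eX : map_mx (meval (fun k => mxvec U 0 k))
    (\matrix_(i, j) mpolyX C (mpoly.mnm1 (mxvec_index i j))) = U.
  by apply/matrixP => i j; rewrite !mxE mevalXU mxvecE.
rewrite /stab_poly mevalB !rmorph_sum /= (surjective_pairing w) coef_actl coef_actr.
congr (_ - _); apply: eq_bigr => s _; rewrite mevalM mevalC mono_map mulrC.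
  by rewrite eX.
by rewrite -map_trmx eX.
Qed.

Lemma stabilizer_closed A : zariski_closed (stabilizer A).
Proof.
exists [set p | exists w z, A z /\ p = stab_poly w z].
apply/seteqP; split=> U [u h]; split=> //.
  move=> _ [w [z [hz ->]]]; rewrite meval_stab_poly.
  by have /(unitmx_actK z u) -> := h _ hz; rewrite subrr.
move=> z hz; apply/unitmx_actK => //; apply: tensorP => w.
have /h : exists w' z', A z' /\ stab_poly w z = stab_poly w' z' by exists w, z.
by rewrite meval_stab_poly => /subr0_eq.
Qed.

Lemma stabilizer_in A : star_stable A -> algebraic_star_subgroups (stabilizer A).
Proof.
move=> sA; split; first exact: stabilizer_subgroup.
  exact: stabilizer_closed.
exact: stabilizer_star.
Qed.

End Invariants.

(** * Orthogonal projections and iterated contractions *)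

Section Projection.
Context {C : numClosedFieldType} {n : nat}.
Local Notation T := (tensors C n).
Local Notation bw := (biword n).
Implicit Types (x y z b p : T) (u v w : bw) (D : seq bw) (a : C).

Definition dot D x y : C := \sum_(w <- D) coef w x * (coef w y)^*.

Lemma dotDl D x y z : dot D (x + y) z = dot D x z + dot D y z.
Proof.
by rewrite /dot -big_split; apply: eq_bigr => w _; rewrite coefD mulrDl.
Qed.

Lemma dotZl D a x z : dot D (a *: x) z = a * dot D x z.
Proof.
by rewrite /dot mulr_sumr; apply: eq_bigr => w _; rewrite coefZ mulrA.
Qed.

Lemma dotBl D x y z : dot D (x - y) z = dot D x z - dot D y z.
Proof. by rewrite dotDl -scaleN1r dotZl mulN1r. Qed.

Lemma dotC D x y : dot D x y = (dot D y x)^*.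
Proof.
rewrite /dot rmorph_sum; apply: eq_bigr => w _.
by rewrite rmorphM /= conjCK mulrC.
Qed.

Lemma dotDr D x y z : dot D z (x + y) = dot D z x + dot D z y.
Proof. by rewrite dotC dotDl rmorphD /= -!dotC. Qed.

Lemma dotZr D a x z : dot D z (a *: x) = a^* * dot D z x.
Proof. by rewrite dotC dotZl rmorphM /= -dotC. Qed.

Lemma dotBr D x y z : dot D z (x - y) = dot D z x - dot D z y.
Proof. by rewrite dotC dotBl rmorphB /= -!dotC. Qed.

Lemma dot_eq0 D x : dot D x x = 0 -> {in D, forall w, coef w x = 0}.
Proof.
move=> h w wD; have : \sum_(u <- D) coef u x * (coef u x)^* == 0 by rewrite [X in X == _]h.
rewrite psumr_eq0 => [/allP/(_ w wD)|u _]; last exact: mul_conjC_ge0.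
by rewrite /= mul_conjC_eq0 => /eqP.
Qed.

Lemma dot_cons D w x y : dot (w :: D) x y = coef w x * (coef w y)^* + dot D x y.
Proof. by rewrite /dot big_cons. Qed.

(** By induction on the coordinates D: the elements of S that vanish at the
    coordinate w have codimension at most one in S, and an element of S orthogonal
    to all of them provides the missing component. *)
Lemma projection_exists D (S : T -> Prop) :
  S 0 -> (forall a x y, S x -> S y -> S (a *: x + y)) ->
  forall z, exists p, S p /\ forall b, S b -> dot D (z - p) b = 0.
Proof.
elim: D S => [|w D IH] S S0 SL z.
  by exists 0; split=> // b _; rewrite /dot big_nil.
pose S' x := S x /\ coef w x = 0.
have S'0 : S' 0 by split; rewrite ?coef0.
have S'L a x y : S' x -> S' y -> S' (a *: x + y).
  by move=> [sx wx] [sy wy]; split; [exact: SL | rewrite coefD coefZ wx wy mulr0 addr0].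
have dotw x b : coef w b = 0 -> dot (w :: D) x b = dot D x b.
  by move=> wb; rewrite dot_cons wb conjC0 mulr0 add0r.
have [p [[Sp wp] hp]] := IH S' S'0 S'L z.
have [h|] := pselect (forall x, S x -> coef w x = 0).
  by exists p; split=> // b Sb; rewrite dotw ?h // hp //; split=> //; exact: h.
move=> /existsNP[s /not_implyP[Ss /eqP ws]].
have [q [[Sq wq] hq]] := IH S' S'0 S'L s.
have SB x y : S x -> S y -> S (x - y).
  by move=> sx sy; rewrite -scaleN1r addrC; exact: SL.
pose s' := s - q; have Ss' : S s' by exact: SB.
have ws' : coef w s' = coef w s by rewrite coefB wq subr0.
have hs' b : S' b -> dot (w :: D) s' b = 0 by move=> [Sb wb]; rewrite dotw // hq.
have nz : dot (w :: D) s' s' != 0.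
  apply: contraNneq ws => /dot_eq0/(_ w); rewrite inE eqxx => /(_ isT).
  by rewrite ws' => ->.
(* The component of z along s', to be added to the projection p onto S'. *)
pose k := dot (w :: D) (z - p) s' / dot (w :: D) s' s'.
exists (k *: s' + p); split=> [|b Sb]; first exact: SL.
pose m := coef w b / coef w s'.
have -> : b = m *: s' + (b - m *: s') by rewrite addrCA subrr addr0.
have S'b : S' (b - m *: s').
  split; first by rewrite -scaleNr addrC; exact: SL.
  by rewrite coefB coefZ divfK ?subrr // ws'.
have e x : z - (k *: s' + p) = z - p - k *: s' by rewrite opprD addrA addrAC.
rewrite dotDr dotZr !e // ![dot _ (_ - _ - _) _]dotBl !dotZl (hs' _ S'b).
rewrite mulr0 subr0 /k divfK // subrr mulr0 add0r.
by case: (S'b) => Sb' wb'; rewrite dotw // hp.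
Qed.

End Projection.

Section MultiContract.
Context {C : numClosedFieldType} {n : nat}.
Local Notation T := (tensors C n).
Local Notation bw := (biword n).
Implicit Types (x y z b c : T) (u v w : bw).
Variable A : set T.
Hypothesis Asub : subalgebra A.
Hypothesis Astar : star_stable A.
Hypothesis Acontr : contraction_closed A.

(** The homogeneous part A_(k, l). *)
Definition Ah k l : set T := A `&` homog k l.

Lemma Ah_lin k l (a : C) x y : Ah k l x -> Ah k l y -> Ah k l (a *: x + y).
Proof.
by move=> [ax hx] [ay hy]; split; [case: Asub => _ + _; exact | exact: homog_lin].
Qed.

Lemma subalgebra0 : A 0.
Proof.
case: Asub => A1 /(_ (-1) 1 1 A1 A1) h _.
by rewrite scaleN1r addNr in h.
Qed.

Lemma Ah0 k l : Ah k l 0.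
Proof. by split; [exact: subalgebra0 | exact: homog0]. Qed.

Lemma AhM k l k' l' x y : Ah k l x -> Ah k' l' y -> Ah (k + k') (l + l') (x * y).
Proof.
by move=> [ax hx] [ay hy]; split; [case: Asub => _ _; exact | exact: homogM].
Qed.

Lemma Ah_star k l x : Ah k l x -> Ah l k (star x).
Proof.
move=> [ax hx]; split; last exact: homog_star.
by move: ax; apply/(iffRL (star_stableP A)).
Qed.

(** Contracting m adjacent V-factors with m adjacent V^*-factors, nested as in
    the pairing of a word with its star. *)
Lemma multi_contract k l k' l' m z : Ah (k + (m + k')) (l + (m + l')) z ->
  exists z', Ah (k + k') (l + l') z' /\
  forall s s' t t', size s = k -> size s' = k' -> size t = l -> size t' = l' ->
  coef (s ++ s', t ++ t') z' =
  \sum_(r <- words m) coef (s ++ r ++ s', t ++ rev r ++ t') z.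
Proof.
elim: m z => [|m IH] z.
  by move=> hz; exists z; split=> // s s' t t' *; rewrite big_words0.
move=> [Az hz].
have hz1 : Ah (k + (m + k')) (l + (m + l')) (contract k (l + m) z).
  have e1 : (k + (m.+1 + k') = (k + (m + k')).+1)%N by rewrite addSn addnS.
  have e2 : (l + (m.+1 + l') = (l + (m + l')).+1)%N by rewrite addSn addnS.
  split; last by apply: homog_contract; rewrite -e1 -e2.
  apply: (Acontr _ _ (conj Az hz)).
    by rewrite e1 ltnS leq_addr.
  by rewrite e2 ltnS addnA leq_addr.
have [z' [Az' h]] := IH _ hz1; exists z'; split=> // s s' t t' ss ss' st st'.
rewrite h // big_wordsS exchange_big; apply: eq_big_seq => r.
rewrite mem_words => /eqP sr; rewrite coef_contract /= !size_cat ss st size_rev sr.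
rewrite leq_addr addnA leq_addr /=; apply: eq_bigr => c _.
rewrite -{1}ss insert_cat catA.
have -> : (l + m)%N = size (t ++ rev r) by rewrite size_cat size_rev st sr.
by rewrite insert_cat rev_cons cat_rcons -!catA.
Qed.

End MultiContract.

(** * Composition of tensors, and the projection onto A *)

Section Composition.
Context {C : numClosedFieldType} {n : nat}.
Local Notation T := (tensors C n).
Local Notation bw := (biword n).
Implicit Types (x y z b c : T) (u v w : bw).

(** An element of bidegree (l + k', k + l') maps the tensors with index of shape
    (k, l) to those with index of shape (k', l'). This is the composition of two
    such maps, along indices s of shape (k, l); for (k, l) = (0, 0) it is the
    product of b and c. *)
Definition tcomp k1 l1 k l k2 l2 b c : T :=
  of_coefs (biwords (k1 + k2) (l1 + l2)) (fun w => \sum_(s <- biwords k l)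
    coef (biword_cat (take k1 w.1, take l1 w.2) s) b *
    coef (biword_cat (wstar s) (drop k1 w.1, drop l1 w.2)) c).

Lemma homog_tcomp k1 l1 k l k2 l2 b c :
  homog (k1 + k2) (l1 + l2) (tcomp k1 l1 k l k2 l2 b c).
Proof. exact: homog_of_coefs. Qed.
Arguments homog_tcomp : clear implicits.

Lemma coef_tcomp k1 l1 k l k2 l2 b c u v :
  size u.1 = k1 -> size u.2 = l1 -> size v.1 = k2 -> size v.2 = l2 ->
  coef (biword_cat u v) (tcomp k1 l1 k l k2 l2 b c) =
  \sum_(s <- biwords k l) coef (biword_cat u s) b * coef (biword_cat (wstar s) v) c.
Proof.
case: u v => [u1 u2] [v1 v2] /= e1 e2 e3 e4.
rewrite coef_of_coefs_biwords /= ?size_cat ?e1 ?e2 ?e3 ?e4 //.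
by rewrite -e1 -e2 !take_size_cat // !drop_size_cat.
Qed.

Lemma homog_cat_eq k1 l1 k2 l2 x y :
  homog (k1 + k2) (l1 + l2) x -> homog (k1 + k2) (l1 + l2) y ->
  (forall u v, size u.1 = k1 -> size u.2 = l1 -> size v.1 = k2 -> size v.2 = l2 ->
    coef (biword_cat u v) x = coef (biword_cat u v) y) -> x = y.
Proof.
move=> hx hy h; apply: (homog_coef_eq hx hy) => -[w1 w2] /= e1 e2.
have -> : (w1, w2) = biword_cat (take k1 w1, take l1 w2) (drop k1 w1, drop l1 w2).
  by rewrite /biword_cat /= !cat_take_drop.
by apply: h => /=; rewrite ?size_takel ?size_drop ?e1 ?e2 ?leq_addr // addKn.
Qed.

(** Composition with b and composition with the star of b are adjoint. *)
Lemma dot_tcomp k1 l1 k l k2 l2 b x z :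
  dot (biwords (k1 + k2) (l1 + l2)) (tcomp k1 l1 k l k2 l2 b x) z =
  dot (biwords (l + k2) (k + l2)) x (tcomp l k l1 k1 k2 l2 (star b) z).
Proof.
rewrite /dot !big_biwords_cat.
transitivity (\sum_(u <- biwords k1 l1) \sum_(v <- biwords k2 l2)
  \sum_(s <- biwords k l) coef (biword_cat u s) b *
    coef (biword_cat (wstar s) v) x * (coef (biword_cat u v) z)^*).
  apply: eq_big_seq => u; rewrite mem_biwords => /andP[/eqP e1 /eqP e2].
  apply: eq_big_seq => v; rewrite mem_biwords => /andP[/eqP e3 /eqP e4].
  by rewrite coef_tcomp // mulr_suml.
transitivity (\sum_(s <- biwords k l) \sum_(v <- biwords k2 l2)
  \sum_(u <- biwords k1 l1) coef (biword_cat u s) b *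
    coef (biword_cat (wstar s) v) x * (coef (biword_cat u v) z)^*).
  rewrite exchange_big [RHS]exchange_big; apply: eq_bigr => v _ /=.
  by rewrite exchange_big.
rewrite big_biwords_star; apply: eq_big_seq => t.
rewrite mem_biwords => /andP[/eqP e1 /eqP e2].
apply: eq_big_seq => v; rewrite mem_biwords => /andP[/eqP e3 /eqP e4].
rewrite coef_tcomp // rmorph_sum mulr_sumr big_biwords_star.
apply: eq_bigr => r _.
rewrite rmorphM /= coef_star conjCK wstarK wstar_cat mulrA; congr (_ * _).
by rewrite mulrC.
Qed.

End Composition.
Arguments homog_tcomp : clear implicits.

Section Projector.
Context {C : numClosedFieldType} {n : nat}.
Local Notation T := (tensors C n).
Local Notation bw := (biword n).
Implicit Types (x y z b c : T) (u v w : bw).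
Context {A : set T} (Asub : subalgebra A) (Astar : star_stable A)
  (Acontr : contraction_closed A).
Local Notation Ah := (Ah A).

(** A composition is a product followed by contractions. *)
Lemma tcomp_closed k1 l1 k l k2 l2 b c :
  Ah (k1 + k) (l1 + l) b -> Ah (l + k2) (k + l2) c ->
  Ah (k1 + k2) (l1 + l2) (tcomp k1 l1 k l k2 l2 b c).
Proof.
move=> hb hc; have := AhM Asub hb hc; rewrite -[(k1 + k + _)%N]addnA.
move=> /(multi_contract Acontr)[z1 []]; rewrite -[(l1 + l + _)%N]addnA.
move=> /(multi_contract Acontr)[z2 [hz2 h2]] h1.
suff -> : tcomp k1 l1 k l k2 l2 b c = z2 by [].
apply: homog_cat_eq; [exact: homog_tcomp|by case: hz2|].
move=> [u1 u2] [v1 v2] /= e1 e2 e3 e4.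
rewrite coef_tcomp // h2 // big_biwords exchange_big /= big_words_rev.
apply: eq_big_seq => r; rewrite mem_words => /eqP sr.
rewrite [u2 ++ _]catA h1 ?size_cat ?size_rev ?sr ?e2 ?e3 //.
apply: eq_big_seq => q; rewrite mem_words => /eqP sq.
have -> : (u1 ++ q ++ r ++ v1, (u2 ++ rev r) ++ rev q ++ v2) =
    biword_cat (biword_cat (u1, u2) (q, rev r)) (biword_cat (wstar (q, rev r)) (v1, v2)).
  by rewrite /biword_cat /wstar /= revK catA.
case: hb => _ hb; rewrite (coefM _ _ hb) //=.
  by rewrite size_cat e1 sq.
by rewrite size_cat size_rev e2 sr.
Qed.

(** The orthogonal projection of T onto A_(k, l). *)
Definition pr k l z : T := sval (cid (projection_exists (biwords k l)
  (Ah0 Asub k l) (Ah_lin Asub (k:=k) (l:=l)) z)).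

Lemma pr_Ah k l z : Ah k l (pr k l z).
Proof. by rewrite /pr; case: cid => p []. Qed.

Lemma homog_pr k l z : homog k l (pr k l z).
Proof. by case: (pr_Ah k l z). Qed.
Arguments homog_pr : clear implicits.

Lemma pr_orth k l z b : Ah k l b -> dot (biwords k l) (z - pr k l z) b = 0.
Proof. by rewrite /pr; case: cid => p [/= _ h] /h. Qed.

Lemma homog_dot_eq0 k l x : homog k l x -> dot (biwords k l) x x = 0 -> x = 0.
Proof.
move=> hx /dot_eq0 h; apply: (homog_coef_eq hx (homog0 k l)) => w e1 e2.
by rewrite coef0 h // mem_biwords e1 e2 !eqxx.
Qed.

Lemma pr_unique k l z p : Ah k l p ->
  (forall b, Ah k l b -> dot (biwords k l) (z - p) b = 0) -> pr k l z = p.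
Proof.
move=> hp h; apply/subr0_eq; set d := _ - _.
have hd : Ah k l d.
  by rewrite /d -scaleN1r addrC; apply: (Ah_lin Asub) => //; exact: pr_Ah.
apply: (@homog_dot_eq0 k l); first by case: hd.
have {1}-> : d = (z - p) - (z - pr k l z) by rewrite opprB addrC subrKA.
by rewrite dotBl h // pr_orth // subr0.
Qed.

Lemma pr_id k l z : Ah k l z -> pr k l z = z.
Proof.
by move=> hz; apply: pr_unique => // b _; rewrite subrr -(scale0r z) dotZl mul0r.
Qed.

Lemma pr_lin k l a x y : pr k l (a *: x + y) = a *: pr k l x + pr k l y.
Proof.
apply: pr_unique => [|b hb]; first by apply: (Ah_lin Asub); exact: pr_Ah.
have -> : a *: x + y - (a *: pr k l x + pr k l y) =
    a *: (x - pr k l x) + (y - pr k l y) by rewrite opprD addrACA -scalerBr.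
by rewrite dotDl dotZl !pr_orth // mulr0 addr0.
Qed.

Lemma pr0 k l : pr k l 0 = 0.
Proof. exact: (pr_id (Ah0 Asub k l)). Qed.

Lemma prD k l x y : pr k l (x + y) = pr k l x + pr k l y.
Proof. by rewrite -{1}[x]scale1r pr_lin scale1r. Qed.

Lemma prZ k l a x : pr k l (a *: x) = a *: pr k l x.
Proof. by rewrite -[a *: x]addr0 pr_lin pr0 addr0. Qed.

Lemma pr_sum k l I (r : seq I) (F : I -> T) :
  pr k l (\sum_(i <- r) F i) = \sum_(i <- r) pr k l (F i).
Proof. exact: (big_morph _ (prD k l) (pr0 k l)). Qed.

Lemma dot_pr k l x y :
  dot (biwords k l) (pr k l x) (pr k l y) = dot (biwords k l) (pr k l x) y.
Proof.
apply/esym/subr0_eq; rewrite -dotBr dotC pr_orth ?conjC0 //; exact: pr_Ah.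
Qed.

Lemma dot_basis k l z w : size w.1 = k -> size w.2 = l ->
  dot (biwords k l) z (basis C w) = coef w z.
Proof.
move=> e1 e2; rewrite /dot.
transitivity (\sum_(u <- biwords k l) coef u z * (u == w)%:R).
  by apply: eq_bigr => u _; rewrite coef_basis eq_sym conjC_nat.
by rewrite big_seq_delta ?biwords_uniq // mem_biwords e1 e2 !eqxx.
Qed.

Lemma pr_star k l z : pr l k (star z) = star (pr k l z).
Proof.
apply: pr_unique => [|b hb]; first by apply: (Ah_star Astar); exact: pr_Ah.
rewrite -[b]starK; have hb' := Ah_star Astar hb.
rewrite -(conjC0 C) -(pr_orth z hb') /dot rmorph_sum /= big_biwords_star.
apply: eq_bigr => w _; rewrite rmorphM /= !coefB !coef_star !wstarK.
by rewrite rmorphB /= !conjCK.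
Qed.

(** Composition with an element of A preserves A, and so does its adjoint. *)
Lemma pr_tcomp k1 l1 k l k2 l2 b x : Ah (k1 + k) (l1 + l) b ->
  pr (k1 + k2) (l1 + l2) (tcomp k1 l1 k l k2 l2 b x) =
  tcomp k1 l1 k l k2 l2 b (pr (l + k2) (k + l2) x).
Proof.
move=> hb; apply: pr_unique => [|a ha].
  by apply: tcomp_closed => //; exact: pr_Ah.
rewrite dotBl !dot_tcomp -dotBl pr_orth //.
apply: tcomp_closed => //.
rewrite [(l + l1)%N]addnC [(k + k1)%N]addnC; exact: (Ah_star Astar).
Qed.

(** The component in A_(1, 1) of the identity tensor, as a matrix. *)
Definition unit_mx : 'M[C]_n := \matrix_(i, j) coef ([:: i], [:: j]) (pr 1 1 id_tensor).

Definition tensor_mx z : 'M[C]_n := \matrix_(i, j) coef ([:: i], [:: j]) z.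

(** The projection is A-linear, and b is the composition of b with the identity
    tensor. *)
Lemma unit_mx_mul b : Ah 1 1 b -> unit_mx *m tensor_mx b = tensor_mx b.
Proof.
move=> hb; have h := @pr_tcomp 0 1 1 0 1 0 b id_tensor hb.
have e x i j : coef ([:: i], [:: j]) (tcomp 0 1 1 0 1 0 b x) =
    \sum_c coef ([:: i], [:: c]) x * coef ([:: c], [:: j]) b.
  have -> : ([:: i], [:: j]) = biword_cat ([::], [:: j]) ([:: i], [::]) by [].
  rewrite coef_tcomp // big_biwords big_wordsS; apply: eq_bigr => c _.
  by rewrite !big_words0 mulrC.
have ei : tcomp 0 1 1 0 1 0 b id_tensor = b.
  case: hb => _ hb; apply: (@homog_coef_eq _ _ 1 1); [exact: (homog_tcomp _ _ 0 1 1 0 1 0)|exact: hb|].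
  move=> [[|i [|? ?]] [|j [|? ?]]] //= _ _; rewrite e (bigD1 i) //=.
  rewrite coef_id_tensor eqxx mul1r big1 ?addr0 // => c ci.
  by rewrite coef_id_tensor eq_sym (negbTE ci) mul0r.
rewrite ei [pr _ _ _](pr_id hb) in h.
apply/matrixP => i j; rewrite !mxE [in RHS]h e.
by apply: eq_bigr => c _; rewrite !mxE.
Qed.

End Projector.

(** * The identity tensor belongs to A *)

Section FixedVectors.
Context {C : numClosedFieldType} {n : nat}.

(** With F = 1 - E, the sum of the positive matrices (F y)(F y)^* is zero, hence
    each of them is. *)
Lemma fixed_vectors (I : eqType) (D : seq I) (y : I -> 'cV[C]_n) (E : 'M[C]_n) :
  E *m \sum_(d <- D) y d *m (map_mx Num.conj (y d)^T) =
    \sum_(d <- D) y d *m (map_mx Num.conj (y d)^T) ->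
  {in D, forall d, E *m y d = y d}.
Proof.
move=> EB d dD; pose F := 1%:M - E; pose z d := F *m y d.
suff /eqP : z d = 0 by rewrite /z /F mulmxBl mul1mx subr_eq0 => /eqP.
apply/matrixP => i j; rewrite [j]ord1 [RHS]mxE.
have : \sum_(d <- D) z d i 0 * (z d i 0)^* == 0.
  have : (\sum_(d <- D) z d *m map_mx Num.conj (z d)^T) i i = 0.
    have -> : \sum_(d <- D) z d *m map_mx Num.conj (z d)^T =
        F *m (\sum_(d <- D) y d *m (map_mx Num.conj (y d)^T)) *m map_mx Num.conj F^T.
      rewrite mulmx_sumr mulmx_suml; apply: eq_bigr => d' _.
      by rewrite /z trmx_mul map_mxM !mulmxA.
    by rewrite {1}/F mulmxBl mul1mx EB subrr mul0mx mxE.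
  rewrite summxE => e; rewrite -[X in _ == X]e; apply/eqP; apply: eq_bigr => d' _.
  by rewrite !mxE big_ord1 !mxE.
rewrite psumr_eq0 => [/allP/(_ d dD)|d' _]; last exact: mul_conjC_ge0.
by rewrite /= mul_conjC_eq0 => /eqP.
Qed.

Lemma mono_fixed (E : 'M[C]_n) (F : seq 'I_n -> C) :
  (forall u i u', \sum_c E i c * F (u ++ c :: u') = F (u ++ i :: u')) ->
  forall u s, \sum_(s' <- words (size s)) mono E s s' * F (u ++ s') = F (u ++ s).
Proof.
move=> h u s; elim: s u => [|i s IH] u; first by rewrite big_words0 mono_nil mul1r.
rewrite big_wordsS -h; apply: eq_bigr => c _.
rewrite -cat_rcons -IH mulr_sumr; apply: eq_bigr => s' _.
by rewrite mono_cons mulrA cat_rcons.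
Qed.

End FixedVectors.

Section Unit.
Context {C : numClosedFieldType} {n : nat}.
Local Notation T := (tensors C n).
Local Notation bw := (biword n).
Implicit Types (x y z b : T) (w : bw).
Context {A : set T} (Asub : subalgebra A) (Astar : star_stable A)
  (Acontr : contraction_closed A) (Agraded : graded A) (And : nondegenerate A).
Local Notation Ah := (Ah A).

(** The contraction of z with its star along all factors but one V-factor is
    the matrix Y Y^*, where Y is the flattening of z along that factor. *)
Lemma flatten_closed k k' l z : Ah (k + (1 + k')) l z -> exists b, Ah 1 1 b /\
  forall i j, coef ([:: i], [:: j]) b =
    \sum_(v <- words l) \sum_(u' <- words k') \sum_(u <- words k)
      coef (u ++ i :: u', v) z * (coef (u ++ j :: u', v) z)^*.
Proof.
move=> hz; have [_ homz] := hz.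
have hzz : Ah (0 + (k + (1 + (k' + l)))) ((l + (k' + 1)) + (k + 0)) (z * star z).
  have := AhM Asub hz (Ah_star Astar hz).
  have -> : (k + (1 + k') + l = 0 + (k + (1 + (k' + l))))%N by rewrite add0n !addnA.
  have -> : (l + (k + (1 + k')) = l + (k' + 1) + (k + 0))%N.
    by rewrite addn0 -addnA [(k + _)%N]addnC [(1 + k')%N]addnC.
  by [].
(* The blocks u, u' and v of z are contracted with their counterparts in star z, in this order. *)
have [z1 [hz1 h1]] := multi_contract Acontr hzz.
rewrite add0n addn0 in hz1.
have [z2 [hz2 h2]] := multi_contract Acontr hz1.
have hz2' : Ah (1 + (l + 0)) (0 + (l + 1)) z2 by rewrite addn0 add0n.
have [z3 [hz3 h3]] := multi_contract Acontr hz2'.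
exists z3; split=> [//|i j].
have -> : ([:: i], [:: j]) = ([:: i] ++ [::], [::] ++ [:: j]) by [].
rewrite h3 // [RHS]big_words_rev.
apply: eq_big_seq => r; rewrite mem_words => /eqP sr.
rewrite cats0 cat0s h2 ?size_rev //.
apply: eq_big_seq => u'; rewrite mem_words => /eqP su'.
rewrite -[LHS]/(coef ([::] ++ [:: i] ++ u' ++ r, _) z1).
rewrite -[rev r ++ _]cats0 h1 ?size_cat ?size_rev ?sr ?su' //.
apply: eq_big_seq => u; rewrite mem_words => /eqP su.
have -> : ([::] ++ u ++ [:: i] ++ u' ++ r,
   (rev r ++ rev u' ++ [:: j]) ++ rev u ++ [::]) =
   biword_cat (u ++ i :: u', rev r) (wstar (u ++ j :: u', rev r)).
  rewrite /biword_cat /wstar /= revK rev_cat rev_cons cats0 -!catA.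
  by rewrite cat_rcons.
rewrite (coefM _ _ homz) /= ?size_cat /= ?size_rev ?su ?su' ?sr //.
by rewrite coef_star wstarK.
Qed.

(** The unit fixes the matrix Y Y^* of [flatten_closed], hence the columns of Y. *)
Lemma unit_slot k l z i (u u' v : seq 'I_n) : Ah k l z ->
  \sum_c unit_mx Asub i c * coef (u ++ c :: u', v) z = coef (u ++ i :: u', v) z.
Proof.
move=> hz; have [/eqP [e1 e2]|ne] := boolP ((size u + (1 + size u'), size v)%N == (k, l));
  last first.
  have /homogP hz' : homog k l z by case: hz.
  rewrite hz' /= ?size_cat //= big1 // => c _.
  by rewrite hz' ?mulr0 //= size_cat.
rewrite -e1 -e2 in hz; have [b [hb eb]] := flatten_closed hz.
pose D : seq (seq 'I_n * (seq 'I_n * seq 'I_n)) := [seq (r, st) | r <- words (size v), st <-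
  [seq (s, t) | s <- words (size u'), t <- words (size u)]].
pose y (d : seq 'I_n * (seq 'I_n * seq 'I_n)) : 'cV[C]_n :=
  \col_i coef (d.2.2 ++ i :: d.2.1, d.1) z.
have Eb : tensor_mx b = \sum_(d <- D) y d *m (map_mx Num.conj (y d)^T).
  apply/matrixP => p q; rewrite mxE eb summxE big_allpairs_dep /=.
  apply: eq_bigr => v' _; rewrite big_allpairs_dep /=; apply: eq_bigr => u1 _.
  apply: eq_bigr => u2 _.
  by rewrite !mxE big_ord1 !mxE.
have := unit_mx_mul Asub Astar Acontr hb; rewrite Eb => /fixed_vectors.
move=> /(_ (v, (u', u))) h.
have hD : (v, (u', u)) \in D.
  apply/allpairsP; exists (v, (u', u)) => /=; split=> //; first by rewrite mem_words.
  by apply/allpairsP; exists (u', u); rewrite /= !mem_words.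
move: (h hD) => /matrixP/(_ i 0); rewrite !mxE /= => <-.
by apply: eq_bigr => c _; rewrite !mxE.
Qed.

Lemma unit_slot_star k l z i (u u' v : seq 'I_n) : Ah k l z ->
  \sum_c (unit_mx Asub i c)^* * coef (v, u ++ c :: u') z = coef (v, u ++ i :: u') z.
Proof.
move=> /(Ah_star Astar) hz.
have e c : coef (v, u ++ c :: u') z = (coef (rev u' ++ c :: rev u, rev v) (star z))^*.
  by rewrite coef_star conjCK /wstar /= revK rev_cat rev_cons !revK cat_rcons.
rewrite e -(unit_slot i _ _ _ hz) rmorph_sum; apply: eq_bigr => c _.
by rewrite e rmorphM.
Qed.

Lemma unit_act z : A z -> act (unit_mx Asub) (map_mx Num.conj (unit_mx Asub)) z = z.
Proof.
move=> /Agraded[N [f [hf ->]]]; rewrite act_sum; apply: eq_bigr => k _.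
rewrite act_sum; apply: eq_bigr => l _; have hz := hf k l.
apply: tensorP => -[s t]; rewrite coef_actE.
rewrite -[s in RHS]cat0s -(@mono_fixed _ _ (unit_mx Asub) (fun s => coef (s, t) (f k l))); last first.
  by move=> u i u'; exact: (unit_slot _ _ _ _ hz).
apply: eq_bigr => s' _; rewrite /= -[t in RHS]cat0s.
rewrite -(@mono_fixed _ _ (map_mx Num.conj (unit_mx Asub)) (fun t => coef (s', t) (f k l))); last first.
  move=> u i u'; rewrite -(unit_slot_star i u u' s' hz).
  by apply: eq_bigr => c _; rewrite mxE.
by rewrite mulr_sumr; apply: eq_bigr => t' _; rewrite mulrA.
Qed.

Definition unit_range : {vspace 'cV[C]_n} :=
  <<[tuple col i (unit_mx Asub) | i < n]>>%VS.

Lemma unit_over : A `<=` tensors_over unit_range.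
Proof.
move=> z Az; pose W := unit_mx Asub.
have hcol i : col i W \in unit_range.
  by apply: memv_span; apply/mapP; exists i => //; rewrite mem_enum.
exists [seq (coef w z, ([seq col i W | i <- w.1], [seq col i W | i <- w.2]))
  | w <- monalg.msupp z]; split.
  move=> _ /mapP[w _ ->] /=; split=> x /mapP[i _ ->]; exact: hcol.
rewrite -[LHS](unit_act Az) /act big_map; apply: eq_bigr => w _ /=.
rewrite !big_map; congr (_ *: (_ * _)); apply: eq_bigr => i _.
by rewrite star_vec; congr covec; apply/matrixP => p q; rewrite !mxE.
Qed.

(** A lies over the range of the unit, which is the whole space by
    nondegeneracy; an idempotent of full range is the identity. *)
Lemma unit_mx1 : unit_mx Asub = 1%:M.
Proof.
have full : unit_range = fullv.
  apply/eqP/negPn/negP => ne; apply: And; exists unit_range; split=> //.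
  exact: unit_over.
have idem : unit_mx Asub *m unit_mx Asub = unit_mx Asub.
  exact: (unit_mx_mul Asub Astar Acontr (pr_Ah _ _ _ _)).
have fixW (x : 'cV[C]_n) : x \in unit_range -> unit_mx Asub *m x = x.
  move=> /coord_span ->; rewrite mulmx_sumr; apply: eq_bigr => i _.
  rewrite -scalemxAr; congr (_ *: _).
  by rewrite -tnth_nth tnth_mktuple colE mulmxA idem.
apply/matrixP => i j.
have := fixW (delta_mx j 0); rewrite full memvf => /(_ isT).
rewrite -colE => /matrixP/(_ i 0); rewrite !mxE andbT => ->.
by [].
Qed.

Lemma id_tensor_closed : Ah 1 1 id_tensor.
Proof.
suff -> : id_tensor = pr Asub 1 1 id_tensor by exact: pr_Ah.
apply: (@homog_coef_eq _ _ 1 1); [exact: homog_id_tensor|exact: homog_pr|].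
move=> [[|i [|? ?]] [|j [|? ?]]] //= _ _.
have := congr1 (fun M : 'M[C]_n => M i j) unit_mx1; rewrite /unit_mx !mxE => ->.
exact: coef_id_tensor.
Qed.

End Unit.

(** * The projection onto A commutes with permutations of the factors *)

Section Kernel.
Context {C : numClosedFieldType} {n : nat}.
Local Notation T := (tensors C n).
Local Notation bw := (biword n).
Implicit Types (x y z b : T) (u v w : bw).
Context {A : set T} (Asub : subalgebra A) (Astar : star_stable A)
  (Acontr : contraction_closed A) (Aid : Ah A 1 1 id_tensor).
Local Notation Ah := (Ah A).
Local Notation pr := (pr Asub).

(** The matrix of the orthogonal projection onto A. *)
Definition pr_mx u v : C := coef u (pr (size v.1) (size v.2) (basis C v)).

Lemma pr_mx_star u v : pr_mx (wstar u) (wstar v) = (pr_mx u v)^*.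
Proof.
by rewrite /pr_mx size_wstar1 size_wstar2 -star_basis pr_star // coef_star wstarK.
Qed.

(** The letter i of the word is contracted with the V^*-factor of the identity
    tensor and reappears as the V-factor of that tensor, at the end. *)
Lemma move_end k l i z : Ah k.+1 l z -> (i <= k)%N ->
  exists z', Ah k.+1 l z' /\ forall s t c, size s = k -> size t = l ->
    coef (rcons s c, t) z' = coef (insert i c s, t) z.
Proof.
move=> hz ik; have [_ homz] := hz.
have := AhM Asub hz Aid; rewrite addn1 addn1 => -[Azz hzz].
exists (contract i l (z * id_tensor)); split.
  by split; [apply: (Acontr _ _ (conj Azz hzz)); rewrite // ltnS leqW | exact: homog_contract].
move=> s t c ss st; rewrite coef_contract /= size_rcons ss leqW // st leqnn /=.
transitivity (\sum_d coef (insert i d s, t) z * (d == c)%:R).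
  apply: eq_bigr => d _; have -> : (@insert n i d (rcons s c), insert l d t) =
      biword_cat (insert i d s, t) ([:: c], [:: d]).
    rewrite /biword_cat /= -st -[X in insert (size t) _ X]cats0 insert_cat.
    congr pair; rewrite /insert -cats1 take_cat drop_cat.
    have [lt|ge] := ltnP i (size s); first by rewrite -catA.
    have -> : i = size s by apply/eqP; rewrite eqn_leq ge ss ik.
    by rewrite subnn take0 drop0 cats0 take_size drop_size -catA.
  rewrite (coefM _ _ homz) ?size_insert ?ss // coef_id_tensor eq_sym.
  by [].
rewrite (bigD1 c) //= eqxx mulr1 big1 ?addr0 // => d dc.
by rewrite (negbTE dc) mulr0.
Qed.

(** The exchange of two blocks is an iteration of [move_end]. Such exchanges are
    closed under inverses, unlike the moves themselves. *)
Lemma rotate_closed k l i j z : Ah (i + (k + j)) l z -> exists z', Ah (i + (k + j)) l z' /\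
  forall s1 s2 s3 t, size s1 = i -> size s2 = k -> size s3 = j -> size t = l ->
    coef (s1 ++ s2 ++ s3, t) z' = coef (s1 ++ s3 ++ s2, t) z.
Proof.
elim: j k => [|j IH] k hz.
  exists z; split=> // s1 s2 s3 t _ _ /size0nil -> _.
  by rewrite cats0.
have e : (i + (k + j.+1) = i + (k.+1 + j))%N by rewrite addSnnS.
rewrite e in hz *; have [z1 [hz1 h1]] := IH _ hz.
have e' : (i + (k.+1 + j) = (i + (k + j)).+1)%N by rewrite addSn addnS.
rewrite e' in hz1 *; have [z2 [hz2 h2]] := move_end hz1 (leq_addr (k + j) i).
exists z2; split=> // s1 s2 s3 t ss1 ss2 ss3 st.
case/lastP: s3 ss3 => // s3 c; rewrite size_rcons => -[ss3].
rewrite -!rcons_cat h2 ?size_cat ?ss1 ?ss2 ?ss3 //.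
rewrite -{1}ss1 insert_cat -cat_cons h1 /= ?ss2 //.
by rewrite cat_rcons.
Qed.

(** The exchange of two blocks and its inverse both preserve A and are isometries,
    so they commute with the orthogonal projection onto A. *)
Lemma pr_mx_rotate (s1 s2 s3 r1 r2 r3 t r : seq 'I_n) :
  size s1 = size r1 -> size s2 = size r2 -> size s3 = size r3 ->
  size t = size r ->
  pr_mx (s1 ++ s2 ++ s3, t) (r1 ++ r2 ++ r3, r) =
  pr_mx (s1 ++ s3 ++ s2, t) (r1 ++ r3 ++ r2, r).
Proof.
move=> e1 e2 e3 et.
pose k := (size r1 + (size r2 + size r3))%N; pose l := size r.
pose f m (s : seq 'I_n) := take (size r1) s ++ rot m (drop (size r1) s).
have fE m a1 a2 a3 : size a1 = size r1 -> size a2 = m ->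
    f m (a1 ++ a2 ++ a3) = a1 ++ a3 ++ a2.
  by move=> ea <-; rewrite /f -ea take_size_cat // drop_size_cat // rot_size_cat.
have split_word p q (s : seq 'I_n) : size s = (size r1 + (p + q))%N ->
    exists a1 a2 a3, [/\ s = a1 ++ a2 ++ a3, size a1 = size r1, size a2 = p & size a3 = q].
  move=> es; exists (take (size r1) s), (take p (drop (size r1) s)),
    (drop p (drop (size r1) s)).
  split; rewrite ?cat_take_drop //.
  - by rewrite size_takel // es leq_addr.
  - by rewrite size_takel // size_drop es addKn leq_addr.
  by rewrite !size_drop es !addKn.
have fsize m s : size (f m s) = size s.
  by rewrite /f size_cat size_rot -size_cat cat_take_drop.
have fK p q s : size s = (size r1 + (p + q))%N -> f q (f p s) = s.
  by move=> /split_word[a1 [a2 [a3 [-> ea1 ea2 ea3]]]]; rewrite fE // fE.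
pose P m z : T := of_coefs (biwords k l) (fun w => coef (f m w.1, w.2) z).
have PE m z w : size w.1 = k -> size w.2 = l -> coef w (P m z) = coef (f m w.1, w.2) z.
  by move=> e4 e5; rewrite coef_of_coefs_biwords.
have PA p q z : (size r1 + (p + q))%N = k -> Ah k l z -> Ah k l (P p z).
  move=> ek; rewrite -{1}ek => /rotate_closed[z' [hz' h]]; rewrite ek in hz'.
  suff -> : P p z = z' by [].
  apply: (@homog_coef_eq _ _ k l); [exact: homog_of_coefs|by case: hz'|].
  move=> [s a] /= es ea; rewrite PE //=.
  have [a1 [a2 [a3 [-> ea1 ea2 ea3]]]] := split_word p q s (etrans es (esym ek)).
  by rewrite fE // h.
have dotP p q x y : (size r1 + (p + q))%N = k ->
    dot (biwords k l) (P p x) y = dot (biwords k l) x (P q y).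
  move=> ek; have ek' : (size r1 + (q + p))%N = k by rewrite [(q + p)%N]addnC.
  rewrite /dot (perm_big [seq (f q w.1, w.2) | w <- biwords k l]) /=; last first.
    apply: uniq_perm; first exact: biwords_uniq.
      rewrite map_inj_in_uniq ?biwords_uniq // => -[a1 a2] [b1 b2].
      rewrite !mem_biwords /= => /andP[/eqP sa _] /andP[/eqP sb _] [eab ->].
      by rewrite -[a1](fK q p) ?sa // eab (fK q p) // sb.
    move=> [a1 a2]; rewrite mem_biwords; apply/idP/mapP => [|[[b1 b2]]] /=.
      move=> /andP[/eqP s1' s2']; exists (f p a1, a2); last by rewrite /= (fK p q) // s1'.
      by rewrite mem_biwords /= fsize s1' s2' eqxx.
    by rewrite mem_biwords => /andP[/= h1 h2] [-> ->]; rewrite fsize h1 h2.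
  rewrite big_map; apply: eq_big_seq => w; rewrite mem_biwords.
  move=> /andP[/eqP h1 /eqP h2]; rewrite !PE /= ?fsize // (fK q p) ?h1 //.
  by rewrite -surjective_pairing.
have prP p q z : (size r1 + (p + q))%N = k -> pr k l (P p z) = P p (pr k l z).
  move=> ek; apply: pr_unique => [|b hb]; first by apply: (PA p q) => //; exact: pr_Ah.
  rewrite dotBl !(dotP p q) // -dotBl pr_orth //; apply: (PA q p) => //.
  by rewrite [(q + p)%N]addnC.
have Pbasis : P (size r2) (basis C (r1 ++ r3 ++ r2, r)) = basis C (r1 ++ r2 ++ r3, r).
  apply: tensorP => -[s a]; rewrite coef_basis.
  have [/eqP[h1 h2]|ne] := boolP ((size s, size a) == (k, l)); last first.
    rewrite coef_of_coefs ?biwords_uniq // mem_biwords -xpair_eqE (negbTE ne).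
    case: (_ =P (s, a)) => // -[E1 E2].
    by rewrite -E1 -E2 !size_cat eqxx in ne.
  rewrite PE // coef_basis !xpair_eqE /=; congr (nat_of_bool (_ && _))%:R.
  have [a1 [a2 [a3 [-> ea1 ea2 ea3]]]] := split_word _ _ _ h1.
  by rewrite fE // !eqseq_cat ?ea1 ?ea2 ?ea3 //; congr andb; rewrite andbC.
rewrite /pr_mx /= !size_cat -/l -/k [(size r3 + _)%N]addnC -/k.
rewrite -Pbasis (prP _ (size r3)) // PE /= ?size_cat ?e1 ?e2 ?e3 ?et //.
by rewrite fE // e2.
Qed.

(** The entry of the projection indexed by lists of pairs: s lists the pairs of
    letters (row, column) of the V-factors, t those of the V^*-factors. *)
Definition pr_mxs (s t : seq ('I_n * 'I_n)) : C :=
  pr_mx (unzip1 s, unzip1 t) (unzip2 s, unzip2 t).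

Lemma pr_mxs_star s t : pr_mxs (rev t) (rev s) = (pr_mxs s t)^*.
Proof. by rewrite /pr_mxs -pr_mx_star /wstar /unzip1 /unzip2 /= !map_rev. Qed.

(** Any rearrangement of s is obtained by moving letters to the end, one at a
    time. *)
Lemma pr_mxs_permr s s' t : perm_eq s s' -> pr_mxs s t = pr_mxs s' t.
Proof.
suff h r : perm_eq s s' -> pr_mxs (s ++ r) t = pr_mxs (r ++ s') t.
  by move=> /(h [::]); rewrite cats0.
elim: s' s r => [|x s' IH] s r; first by move=> /perm_nilP ->; rewrite cats0.
move=> hp; have xs : x \in s by rewrite (perm_mem hp) mem_head.
case/splitPr: xs hp => s1 s2 hp.
have hp' : perm_eq (s1 ++ s2) s'.
  by move: hp; rewrite -[x :: s2]cat1s perm_catCA /= perm_cons.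
have -> : pr_mxs ((s1 ++ x :: s2) ++ r) t = pr_mxs ((s1 ++ s2) ++ rcons r x) t.
  have -> : (s1 ++ x :: s2) ++ r = s1 ++ [:: x] ++ (s2 ++ r) by rewrite -catA.
  have -> : (s1 ++ s2) ++ rcons r x = s1 ++ (s2 ++ r) ++ [:: x].
    by rewrite -cats1 !catA.
  rewrite /pr_mxs /unzip1 /unzip2 !map_cat.
  by apply: pr_mx_rotate; rewrite ?size_cat !size_map.
by rewrite IH // cat_rcons.
Qed.

Lemma pr_mxs_perm s s' t t' : perm_eq s s' -> perm_eq t t' -> pr_mxs s t = pr_mxs s' t'.
Proof.
move=> hs ht; rewrite (pr_mxs_permr _ hs).
have flip p q : pr_mxs p q = (pr_mxs (rev q) (rev p))^* by rewrite pr_mxs_star conjCK.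
rewrite flip [RHS]flip; congr (_^*); apply: pr_mxs_permr.
rewrite perm_rev; apply: perm_trans ht _; by rewrite perm_sym perm_rev.
Qed.

End Kernel.

(** * Positivity of a Casimir form *)

Section Positivity.
Context {C : numClosedFieldType}.
Local Open Scope sesquilinear_scope.

(** A nonzero eigenvalue of Q, with unit eigenvector v, is the value at v of the
    quadratic form of L. *)
Lemma hermitian_psd N (Q L : 'M[C]_N) :
  Q^t* = Q -> Q *m Q = L *m Q ->
  (forall v : 'rV_N, 0 <= (v *m L *m v^t*) 0 0) ->
  forall v : 'rV_N, 0 <= (v *m Q *m v^t*) 0 0.
Proof.
move=> hQ QQ hL v.
have nQ : Q \is normalmx by apply/normalmxP; rewrite hQ.
have /orthomx_spectralP := nQ.
set P := spectralmx Q; set d := spectral_diag Q => eQ.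
have uP : P \is unitarymx by exact: spectral_unitarymx.
rewrite invmx_unitary // in eQ.
have PP : P *m P^t* = 1%:M by apply/unitarymxP.
have PQ : P *m Q = diag_mx d *m P by rewrite {1}eQ !mulmxA PP mul1mx.
have QQ' : Q *m Q = Q *m L^t*.
  by have := congr1 (fun M => M^t*) QQ; rewrite !trmx_mul !map_mxM hQ.
have d_ge0 i : 0 <= d 0 i.
  have [->//|di] := eqVneq (d 0 i) 0.
  have rowE : row i P *m Q = d 0 i *: row i P.
    by rewrite -row_mul PQ mul_diag_mx; apply/rowP => j; rewrite !mxE.
  have rowPP : (row i P *m (row i P)^t*) 0 0 = 1.
    transitivity ((P *m P^t*) i i); last by rewrite PP mxE eqxx.
    by rewrite !mxE; apply: eq_bigr => j _; rewrite !mxE.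
  have e : row i P *m Q *m Q = row i P *m Q *m L^t* by rewrite -mulmxA QQ' mulmxA.
  rewrite rowE -!scalemxAl in e; have {e} := scalerI di e.
  rewrite rowE => e.
  have := congr1 (fun M : 'rV_N => (M *m (row i P)^t*) 0 0) e.
  rewrite -scalemxAl [LHS]mxE rowPP mulr1 => ->.
  have h := hL (row i P).
  suff -> : (row i P *m L^t* *m (row i P)^t*) 0 0 =
      ((row i P *m L *m (row i P)^t*) 0 0)^* by rewrite (geC0_conj h).
  have -> (M : 'M[C]_1) : (M 0 0)^* = M^t* 0 0 by rewrite !mxE.
  by rewrite !trmx_mul !map_mxM trmxCK mulmxA.
pose u := v *m P^t*.
have -> : v *m Q *m v^t* = u *m diag_mx d *m u^t*.
  by rewrite {1}eQ /u !trmx_mul !map_mxM trmxCK !mulmxA.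
rewrite mxE; apply: sumr_ge0 => i _; rewrite mul_mx_diag !mxE mulrAC.
by rewrite mulr_ge0 // mul_conjC_ge0.
Qed.

Lemma kernel_psd (I : finType) (Q L : I -> I -> C) :
  (forall i j, Q j i = (Q i j)^*) ->
  (forall i j, \sum_k Q i k * Q k j = \sum_k L i k * Q k j) ->
  (forall x : I -> C, 0 <= \sum_i \sum_j x i * L i j * (x j)^*) ->
  forall x : I -> C, 0 <= \sum_i \sum_j x i * Q i j * (x j)^*.
Proof.
move=> hQ QQ hL x.
pose N := #|I|; pose mx (F : I -> I -> C) : 'M[C]_N :=
  \matrix_(i, j) F (enum_val i) (enum_val j).
have formE (F : I -> I -> C) (v : 'rV[C]_N) : (v *m mx F *m v^t*) 0 0 =
    \sum_i \sum_j v 0 (enum_rank i) * F i j * (v 0 (enum_rank j))^*.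
  rewrite exchange_big mxE (reindex enum_rank) /=; last first.
    by exists enum_val => ? _; rewrite (enum_rankK, enum_valK).
  apply: eq_bigr => j _; rewrite !mxE mulr_suml (reindex enum_rank) /=; last first.
    by exists enum_val => ? _; rewrite (enum_rankK, enum_valK).
  by apply: eq_bigr => i _; rewrite !mxE !enum_rankK.
have mulE (F G : I -> I -> C) i j : (mx F *m mx G) i j =
    \sum_k F (enum_val i) k * G k (enum_val j).
  rewrite mxE (reindex enum_rank) /=; last first.
    by exists enum_val => ? _; rewrite (enum_rankK, enum_valK).
  by apply: eq_bigr => k _; rewrite !mxE !enum_rankK.
have := @hermitian_psd N (mx Q) (mx L) _ _ _ (\row_i x (enum_val i)).
rewrite formE => h.
have {}h : 0 <= \sum_i \sum_j (\row_i x (enum_val i)) 0 (enum_rank i) * Q i j *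
    ((\row_i x (enum_val i)) 0 (enum_rank j))^*.
  apply: h.
  - by apply/matrixP => i j; rewrite !mxE -hQ.
  - by apply/matrixP => i j; rewrite !mulE.
  by move=> v; rewrite formE; exact: (hL (fun i => v 0 (enum_rank i))).
apply: le_trans h _; rewrite le_eqVlt; apply/orP; left; apply/eqP.
by apply: eq_bigr => i _; apply: eq_bigr => j _; rewrite !mxE !enum_rankK.
Qed.

(** K is the matrix of a linear map pi from matrices indexed by I to themselves:
    K u u' v v' is the (u, u') entry of the image of the elementary matrix
    E_(v, v'). The hypotheses say that pi commutes with the adjoint, that it is
    an orthogonal projection, and that pi (pi (x) y) = pi (x) pi (y), as holds
    for the projection onto a *-algebra. The form in the conclusion is the
    quadratic form of the Casimir operator
    Phi (c) = sum_(v, v') pi (E_(v, v')) c E_(v', v),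
    and these identities give Phi (Phi (c)) = Phi (c) M for a positive matrix M. *)
Lemma projection_psd (I : finType) (K : I -> I -> I -> I -> C) :
  (forall u u' v v', K u' u v' v = (K u u' v v')^*) ->
  (forall u u' v v', K u u' v v' = \sum_s \sum_s' K s s' v v' * (K s s' u u')^*) ->
  (forall a b v u u' v', \sum_r K r v a b * K u u' r v' =
                         \sum_s K u s a b * K s u' v v') ->
  forall c : I -> I -> C,
  0 <= \sum_u \sum_v \sum_u' \sum_v' (c u v)^* * K u u' v v' * c u' v'.
Proof.
move=> h1 h2 h3 c.
pose Q (p q : I * I) := K p.1 q.1 p.2 q.2.
pose L (p q : I * I) := (p.1 == q.1)%:R * \sum_t K q.2 t p.2 t.
have := @kernel_psd _ Q L _ _ _ (fun p => (c p.1 p.2)^*).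
have -> : \sum_u \sum_v \sum_u' \sum_v' (c u v)^* * K u u' v v' * c u' v' =
    \sum_i \sum_j (c i.1 i.2)^* * Q i j * ((c j.1 j.2)^*)^*.
  rewrite pair_bigA; apply: eq_bigr => p _; rewrite pair_bigA.
  by apply: eq_bigr => q _; rewrite conjCK.
apply.
- by move=> [u v] [u' v']; exact: h1.
- move=> [u v] [u' v'].
  transitivity (\sum_t \sum_s K u s v t * K s u' t v').
    by rewrite exchange_big pair_bigA.
  transitivity (\sum_s \sum_r (u == s)%:R * (\sum_t K r t v t) * K s u' r v').
    under [LHS]eq_bigr do rewrite -h3.
    rewrite [RHS](bigD1 u) //= [X in _ = _ + X]big1 ?addr0 => [|u2 ne]; last first.
      by apply: big1 => r _; rewrite eq_sym (negbTE ne) !mul0r.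
    rewrite exchange_big; apply: eq_bigr => r _.
    by rewrite eqxx mul1r mulr_suml.
  by rewrite pair_bigA.
move=> x.
have -> : \sum_i \sum_j x i * L i j * (x j)^* =
    \sum_u \sum_t \sum_s \sum_s'
      (\sum_v x (u, v) * K s s' v t) * (\sum_v x (u, v) * K s s' v t)^*.
  transitivity (\sum_u \sum_v \sum_j x (u, v) * L (u, v) j * (x j)^*).
    by rewrite [RHS]pair_bigA; apply: eq_bigr => -[].
  apply: eq_bigr => u _.
  transitivity (\sum_v \sum_r x (u, v) * (\sum_t K r t v t) * (x (u, r))^*).
    apply: eq_bigr => v _.
    transitivity (\sum_u' \sum_r x (u, v) * L (u, v) (u', r) * (x (u', r))^*).
      by rewrite [RHS]pair_bigA; apply: eq_bigr => -[].
    rewrite (bigD1 u) //= [X in _ + X]big1 ?addr0 => [|u2 ne]; last first.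
      by apply: big1 => r _; rewrite /L /= eq_sym (negbTE ne) mul0r mulr0 mul0r.
    by apply: eq_bigr => r _; rewrite /L /= eqxx mul1r.
  transitivity (\sum_v \sum_r \sum_t \sum_s \sum_s'
     (x (u, v) * K s s' v t) * (x (u, r) * K s s' r t)^*).
    apply: eq_bigr => v _; apply: eq_bigr => r _.
    rewrite mulr_sumr mulr_suml; apply: eq_bigr => t _.
    rewrite h2 mulr_sumr mulr_suml; apply: eq_bigr => s _.
    rewrite mulr_sumr mulr_suml; apply: eq_bigr => s' _.
    by rewrite rmorphM /= !mulrA [RHS]mulrAC.
  under eq_bigr do rewrite exchange_big /=.
  rewrite exchange_big; apply: eq_bigr => t _ /=.
  under eq_bigr do rewrite exchange_big /=.
  rewrite exchange_big; apply: eq_bigr => s _ /=.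
  under eq_bigr do rewrite exchange_big /=.
  rewrite exchange_big; apply: eq_bigr => s' _ /=.
  rewrite rmorph_sum mulr_suml; apply: eq_bigr => v _.
  by rewrite mulr_sumr.
apply: sumr_ge0 => u _; apply: sumr_ge0 => t _; apply: sumr_ge0 => s _.
by apply: sumr_ge0 => s' _; exact: mul_conjC_ge0.
Qed.

End Positivity.

(** * A Nullstellensatz over an uncountable field *)

Section Nullstellensatz.
Context {C : numClosedFieldType} {N : nat}.
Hypothesis uncountable : ~ countable [set: C].
Local Notation P := (mpoly N C).
Implicit Types (J : set P) (p q f x y g h : P).

Definition ideal J := [/\ J 0, (forall p q, J p -> J q -> J (p + q)) &
  (forall p q, J q -> J (p * q))].

Definition power_free J f := forall k, ~ J (f ^+ k).

Definition adjoin J y : set P := [set q | exists r, J (q - r * y)].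

Lemma idealN J p : ideal J -> J p -> J (- p).
Proof. by move=> [_ _ JM] Jp; rewrite -mulN1r; exact: JM. Qed.

Lemma idealB J p q : ideal J -> J p -> J q -> J (p - q).
Proof. by move=> idJ Jp Jq; case: (idJ) => _ JD _; apply: JD => //; exact: idealN. Qed.

Lemma ideal_sum J I (r : seq I) (F : I -> P) : ideal J ->
  (forall i, J (F i)) -> J (\sum_(i <- r) F i).
Proof. by move=> [J0 JD _] h; elim/big_ind: _. Qed.

Lemma adjoin_ideal J y : ideal J -> ideal (adjoin J y).
Proof.
move=> [J0 JD JM]; split; first by exists 0; rewrite mul0r subr0.
  move=> p q [r hr] [s hs]; exists (r + s).
  by rewrite mulrDl opprD addrACA; exact: JD.
by move=> p q [r hr]; exists (p * r); rewrite -mulrA -mulrBr; exact: JM.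
Qed.

Lemma sub_adjoin J y : J `<=` adjoin J y.
Proof. by move=> p Jp; exists 0; rewrite mul0r subr0. Qed.

Lemma mem_adjoin J y : ideal J -> adjoin J y y.
Proof. by move=> [J0 _ _]; exists 1; rewrite mul1r subrr. Qed.

(** Polynomials of bounded degree form a space of finite dimension. *)
Lemma dependent_family (d r : nat) (g : 'I_r -> P) :
  (#|{: bmultinom N d}| < r)%N -> (forall i, (@mpoly.mmeasure N C (@mpoly.mdeg N) (g i) <= d)%N) ->
  exists2 c : 'I_r -> C, exists i, c i != 0 & \sum_i mpolyC N (c i) * g i = 0.
Proof.
move=> lt hd; pose D := #|{: bmultinom N d}|.
pose M : 'M[C]_(r, D) := \matrix_(i, j) mpoly.mcoeff (enum_val j : bmultinom N d) (g i).
have : kermx M != 0.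
  rewrite kermx_eq0; apply: contraTN lt; rewrite -leqNgt => /eqP <-.
  exact: rank_leq_col.
move=> /matrix0Pn[i0 [j0 nz]]; exists (fun i => kermx M i0 i); first by exists j0.
have kM : row i0 (kermx M) *m M = 0 by rewrite -row_mul mulmx_ker row0.
transitivity (\sum_i \sum_(m : bmultinom N d)
    (kermx M i0 i * mpoly.mcoeff (m : bmultinom N d) (g i)) *: mpolyX C (m : bmultinom N d)).
  apply: eq_bigr => i _; rewrite mul_mpolyC {1}(mpolywE (hd i)) scaler_sumr.
  by apply: eq_bigr => m _; rewrite scalerA.
rewrite exchange_big big1 // => m _ /=; rewrite -scaler_suml.
move/rowP: kM => /(_ (enum_rank m)); rewrite !mxE => e.
rewrite [X in X *: _](_ : _ = 0) ?scale0r // -[RHS]e.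
by apply: eq_bigr => i _; rewrite !mxE enum_rankK.
Qed.

(** An uncountable field is not a countable union of finite sets. *)
Lemma infinite_fiber (k d : C -> nat) : exists i j,
  infinite_set [set a | k a = i /\ d a = j].
Proof.
apply: contrapT => h; apply: uncountable.
have -> : [set: C] = \bigcup_(i in [set: nat]) \bigcup_(j in [set: nat])
    [set a | k a = i /\ d a = j].
  by apply/seteqP; split=> // a _; exists (k a) => //; exists (d a).
apply: bigcup_countable => // i _; apply: bigcup_countable => // j _.
apply: finite_set_countable; apply: contrapT => inf.
by apply: h; exists i, j.
Qed.

Definition at_poly x (q : {poly C}) : P := (map_poly (@mpolyC N C) q).[x].

Lemma at_polyM x (q r : {poly C}) : at_poly x (q * r) = at_poly x q * at_poly x r.
Proof. by rewrite /at_poly rmorphM hornerM. Qed.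

Lemma at_poly_sum x I (r : seq I) (F : I -> {poly C}) :
  at_poly x (\sum_(i <- r) F i) = \sum_(i <- r) at_poly x (F i).
Proof. by rewrite /at_poly rmorph_sum horner_sum. Qed.

Lemma at_poly_prod x I (r : seq I) (Q : pred I) (F : I -> {poly C}) :
  at_poly x (\prod_(i <- r | Q i) F i) = \prod_(i <- r | Q i) at_poly x (F i).
Proof. by rewrite /at_poly rmorph_prod horner_prod. Qed.

Lemma at_polyC x c : at_poly x c%:P = mpolyC N c.
Proof. by rewrite /at_poly map_polyC hornerC. Qed.

Lemma at_polyXsubC x c : at_poly x ('X - c%:P) = x - mpolyC N c.
Proof. by rewrite /at_poly rmorphB /= map_polyX map_polyC hornerXsubC. Qed.

(** Otherwise each x - a has an inverse modulo J, up to a power of f. Infinitely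
    many of these inverses have the same degree and are linearly dependent;
    clearing denominators gives a nonzero polynomial q with q (x) f^i in J. It
    splits into factors x - b, which are again invertible up to powers of f, so
    that a power of f belongs to J. *)
Lemma adjoin_root J f x : ideal J -> power_free J f ->
  exists a, power_free (adjoin J (x - mpolyC N a)) f.
Proof.
move=> idJ free; apply: contrapT => none.
have hyp a : exists kg : nat * P, J (f ^+ kg.1 - kg.2 * (x - mpolyC N a)).
  apply: contrapT => nh; apply: none; exists a => k [r hr].
  by apply: nh; exists (k, r).
have [kg hkg] := choice hyp.
pose k a := (kg a).1; pose g a := (kg a).2.
have [i [d inf]] := infinite_fiber k (fun a => @mpoly.mmeasure N C (@mpoly.mdeg N) (g a)).
have [B sub card] := infinite_set_fset (#|{: bmultinom N d}|).+1 inf.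
pose r := #|` B|; pose s : seq C := enum_fset B.
have us : uniq s by exact: fset_uniq.
pose a (t : 'I_r) : C := nth 0 s t.
have aB t : a t \in B by rewrite /a; apply: mem_nth.
have [ka da] : (forall t, k (a t) = i) /\ (forall t, @mpoly.mmeasure N C (@mpoly.mdeg N) (g (a t)) = d).
  by split=> t; have [] := sub _ (aB t).
have ainj : injective a.
  by move=> t t' /eqP; rewrite nth_uniq // => /eqP; exact: val_inj.
have [c [t0 ct0] dep] := @dependent_family d r (fun t => g (a t)) card
  (fun t => eq_leq (da t)).
pose pi t : {poly C} := \prod_(t' | t' != t) ('X - (a t')%:P).
pose q : {poly C} := \sum_t (c t)%:P * pi t.
have q0 : q != 0.
  apply: contraNneq ct0 => e.
  have : q.[a t0] = c t0 * (pi t0).[a t0].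
    rewrite /q horner_sum (bigD1 t0) //= hornerM hornerC big1 ?addr0 // => t tt0.
    rewrite hornerM /pi (bigD1 t0) 1?eq_sym //= hornerM hornerXsubC subrr.
    by rewrite mul0r mulr0.
  rewrite e horner0 => /esym/eqP; rewrite mulf_eq0 => /orP[//|].
  rewrite /pi horner_prod prodf_seq_eq0 => /hasP[t _ /andP[tt0]].
  by rewrite hornerXsubC subr_eq0 => /eqP/ainj e'; rewrite e' eqxx in tt0.
have Jq : J (f ^+ i * at_poly x q).
  have e : f ^+ i * at_poly x q = \sum_t mpolyC N (c t) * at_poly x (pi t) *
      (f ^+ k (a t) - g (a t) * (x - mpolyC N (a t))).
    have e0 : \sum_t mpolyC N (c t) * at_poly x (pi t) * (g (a t) * (x - mpolyC N (a t))) = 0.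
      (* Each summand is c_t g_t times the same product of all x - a_t. *)
      pose full := \prod_t (x - mpolyC N (a t)).
      transitivity ((\sum_t mpolyC N (c t) * g (a t)) * full).
        rewrite mulr_suml; apply: eq_bigr => t _.
        rewrite /full (bigD1 t) //= /pi at_poly_prod mulrACA; congr (_ * _).
        by rewrite mulrC; congr (_ * _); apply: eq_bigr => t' _; rewrite at_polyXsubC.
      by rewrite dep mul0r.
    under [RHS]eq_bigr do rewrite mulrBr.
    rewrite sumrB e0 subr0 at_poly_sum mulr_sumr; apply: eq_bigr => t _.
    by rewrite at_polyM at_polyC ka mulrC.
  rewrite e; apply: ideal_sum => // t; case: idJ => _ _; apply.
  exact: hkg.
have split_pow (rs : seq C) : exists m h,
    J (f ^+ m - h * \prod_(b <- rs) (x - mpolyC N b)).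
  elim: rs => [|b rs [m [h hm]]].
    by exists 0%N, 1; rewrite big_nil mulr1 expr0 subrr; case: idJ.
  (* The inverses of x - b and of the product over rs are multiplied. *)
  exists (k b + m)%N, (g b * h); rewrite big_cons.
  set w := \prod_(_ <- _) _ in hm *.
  have -> : f ^+ (k b + m) - g b * h * ((x - mpolyC N b) * w) =
      f ^+ k b * (f ^+ m - h * w) + h * w * (f ^+ k b - g b * (x - mpolyC N b)).
    rewrite exprD !mulrBr -!addrA; congr (_ + _).
    rewrite [f ^+ k b * (h * w)]mulrC addKr; congr (- _).
    rewrite -!mulrBr [in RHS]mulrACA [h * g b]mulrC -!mulrA; congr (_ * (_ * _)).
    by rewrite mulrC.
  case: (idJ) => _ JD JM; apply: JD; apply: JM => //; exact: hkg.
have [rs eq] := closed_field_poly_normal q.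
have [m [h hm]] := split_pow rs.
apply: (free (i + m)%N); rewrite exprD.
have l0 : lead_coef q != 0 by rewrite lead_coef_eq0.
set w := \prod_(b <- rs) _ in hm.
have Jw : J (f ^+ i * w).
  have -> : f ^+ i * w = mpolyC N (lead_coef q)^-1 * (f ^+ i * at_poly x q).
    have -> : at_poly x q = mpolyC N (lead_coef q) * w.
      rewrite {1}eq -mul_polyC at_polyM at_polyC at_poly_prod; congr (_ * _).
      by apply: eq_bigr => b _; rewrite at_polyXsubC.
    rewrite mulrCA; congr (_ * _).
    by rewrite mulrA -mpoly.mpolyCM mulVf // mpolyC1 mul1r.
  by case: idJ => _ _; apply.
have -> : f ^+ i * f ^+ m = f ^+ i * (f ^+ m - h * w) + h * (f ^+ i * w).
  by rewrite mulrBr [h * (_ * _)]mulrCA subrK.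
by case: (idJ) => _ JD JM; apply: JD; apply: JM.
Qed.

Definition var (i : 'I_N) : P := mpolyX C (mpoly.mnm1 i).

Lemma adjoin_roots J f (L : seq 'I_N) : ideal J -> power_free J f ->
  exists J', [/\ ideal J', power_free J' f, J `<=` J' &
    {in L, forall i, exists a, J' (var i - mpolyC N a)}].
Proof.
move=> idJ free; elim: L => [|i L [J' [id' free' sub h]]]; first by exists J; split.
have [a ha] := adjoin_root (var i) id' free'.
exists (adjoin J' (var i - mpolyC N a)); split=> //.
- exact: adjoin_ideal.
- by move=> p /sub; exact: sub_adjoin.
move=> j; rewrite inE => /predU1P[->|/h [b hb]].
  by exists a; exact: mem_adjoin.
by exists b; exact: sub_adjoin.
Qed.

(** Adjoining one var i - a_i after the other leads to an ideal modulo which every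
    polynomial is its value at a. *)
Lemma zero_of_ideal J f : ideal J -> power_free J f ->
  exists v : 'I_N -> C, (forall q, J q -> meval v q = 0) /\ meval v f != 0.
Proof.
move=> idJ free; have [J' [id' free' sub h]] := adjoin_roots (enum 'I_N) idJ free.
have /choice[v hv] i : exists a, J' (var i - mpolyC N a).
  by apply: h; rewrite mem_enum.
have [J0 JD JM] := id'.
have hM p q a b : J' (p - mpolyC N a) -> J' (q - mpolyC N b) ->
    J' (p * q - mpolyC N (a * b)).
  move=> ha hb.
  have -> : p * q - mpolyC N (a * b) =
      q * (p - mpolyC N a) + mpolyC N a * (q - mpolyC N b).
    by rewrite mpoly.mpolyCM !mulrBr [q * p]mulrC [q * _]mulrC addrA subrK.
  by apply: JD; apply: JM.
have hX m : J' (mpolyX C m - mpolyC N (meval v (mpolyX C m))).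
  rewrite mevalX mpolyXE_id.
  elim/big_rec2: _ => [|i a p _ hp]; first by rewrite mpolyC1 subrr.
  apply: (hM) => //; elim: (m i) => [|k IH]; first by rewrite !expr0 mpolyC1 subrr.
  by rewrite !exprS; apply: (hM); [exact: hv|exact: IH].
have hq q : J' (q - mpolyC N (meval v q)).
  rewrite [in meval _ _](mpolyE q) [X in X - _](mpolyE q) (rmorph_sum (meval v)) (rmorph_sum (@mpolyC N C)) -sumrB /=.
  apply: ideal_sum => // m.
  by rewrite mevalZ mpoly.mpolyCM -mul_mpolyC -mulrBr; exact: JM.
have const c : J' (mpolyC N c) -> c = 0.
  move=> hc; apply: contrapT => /eqP c0; apply: (free' 0%N).
  have -> : f ^+ 0 = mpolyC N c^-1 * mpolyC N c.
    by rewrite -mpoly.mpolyCM mulVf // mpolyC1.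
  exact: JM.
exists v; split=> [q Jq|].
  apply: const; have := idealB id' (sub _ Jq) (hq q).
  by rewrite opprB addrCA subrr addr0.
apply/eqP => f0; apply: (free' 1%N).
by have := hq f; rewrite f0 mpolyC0 subr0 expr1.
Qed.

End Nullstellensatz.

(** * Polynomials in two matrices *)

Section LinearForm.
Context {C : numClosedFieldType} {N : nat}.
Local Notation P := (mpoly N C).
Implicit Types (p q : P) (m : multinom N).

(** The linear form with the values c on the monomials. *)
Definition lform (c : multinom N -> C) q : C :=
  \sum_(m <- mpoly.msupp q) mpoly.mcoeff m q * c m.

Lemma lformEw c q D : uniq D -> {subset mpoly.msupp q <= D} ->
  lform c q = \sum_(m <- D) mpoly.mcoeff m q * c m.
Proof.
move=> uD sub; apply: eq_big_supp => // m mD; first by rewrite sub.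
by move/memN_msupp_eq0 ->; rewrite mul0r.
Qed.

Lemma lform_lin c (a : C) p q : lform c (a *: p + q) = a * lform c p + lform c q.
Proof.
pose D := undup (mpoly.msupp p ++ mpoly.msupp q ++ mpoly.msupp (a *: p + q)).
have uD : uniq D by exact: undup_uniq.
have sub x r : r \in mpoly.msupp x -> (mpoly.msupp x = mpoly.msupp p) \/
   (mpoly.msupp x = mpoly.msupp q) \/ (mpoly.msupp x = mpoly.msupp (a *: p + q)) -> r \in D.
  by move=> rx [e|[e|e]]; rewrite mem_undup !mem_cat -e rx ?orbT.
rewrite !(@lformEw _ _ D) //; try by move=> r /sub; apply; tauto.
rewrite mulr_sumr -big_split; apply: eq_bigr => m _ /=.
by rewrite mpoly.mcoeffD mpoly.mcoeffZ mulrDl mulrA.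
Qed.

Lemma lform0 c : lform c 0 = 0.
Proof. by rewrite /lform mpoly.msupp0 big_nil. Qed.

Lemma lformD c p q : lform c (p + q) = lform c p + lform c q.
Proof. by rewrite -{1}[p]scale1r lform_lin mul1r. Qed.

Lemma lformZ c (a : C) p : lform c (a *: p) = a * lform c p.
Proof. by rewrite -[a *: p]addr0 lform_lin lform0 addr0. Qed.

Lemma lformB c p q : lform c (p - q) = lform c p - lform c q.
Proof. by rewrite addrC -scaleN1r lform_lin mulN1r addrC. Qed.

Lemma lformCM c (a : C) p : lform c (mpolyC N a * p) = a * lform c p.
Proof. by rewrite mul_mpolyC lformZ. Qed.

Lemma lform_sum c I (r : seq I) (F : I -> P) :
  lform c (\sum_(i <- r) F i) = \sum_(i <- r) lform c (F i).
Proof. exact: (big_morph _ (lformD c) (lform0 c)). Qed.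

Lemma lformX c m : lform c (mpolyX C m) = c m.
Proof. by rewrite /lform mpoly.msuppX big_seq1 mpoly.mcoeffX eqxx mul1r. Qed.

End LinearForm.

Section Letters.
Context {C : numClosedFieldType} {n : nat}.
Local Notation bw := (biword n).

(** The entries (i, j) of two matrices X and Y; the tag true stands for Y. *)
Definition letter : finType := (bool * ('I_n * 'I_n))%type.
Local Notation N := #|{: letter}|.
Local Notation P := (mpoly N C).
Implicit Types (s t : seq letter) (u v w : bw) (p q : P).

Definition lvar (a : letter) : P := mpolyX C (mpoly.mnm1 (enum_rank a)).
Definition mon s : P := \prod_(a <- s) lvar a.

Lemma mon_cat s t : mon (s ++ t) = mon s * mon t.
Proof. exact: big_cat. Qed.

Lemma mon_perm s t : perm_eq s t -> mon s = mon t.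
Proof. exact: perm_big. Qed.

Definition exponents s : multinom N := Multinom [tuple count_mem (enum_val i) s | i < N].

Lemma exponentsE s i : exponents s i = count_mem (enum_val i) s.
Proof. by rewrite multinomE tnth_mktuple. Qed.

Lemma mon_exponents s : mon s = mpolyX C (exponents s).
Proof.
elim: s => [|a s IH]; rewrite /mon.
  have -> : exponents [::] = mpoly.mnm0 by apply/mpoly.mnmP => i; rewrite exponentsE ?mpoly.mnm0E.
  by rewrite big_nil mpolyX0.
rewrite big_cons -/(mon s) IH -mpoly.mpolyXD; congr mpolyX.
apply/mpoly.mnmP => i; rewrite mnmDE mnm1E !exponentsE /=; congr (nat_of_bool _ + _)%N.
by apply/eqP/eqP => [<-|->]; rewrite ?enum_rankK ?enum_valK.
Qed.

Definition word (m : multinom N) : seq letter :=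
  flatten [seq nseq (m (enum_rank a)) a | a <- enum letter].

Lemma count_word m a : count_mem a (word m) = m (enum_rank a).
Proof.
rewrite /word count_flatten -map_comp sumnE big_map big_enum /= (bigD1 a) //=.
rewrite count_nseq /= eqxx mul1n big1 ?addn0 // => b ba.
by rewrite count_nseq /= (negbTE ba).
Qed.

Lemma exponents_word m : exponents (word m) = m.
Proof. by apply/mpoly.mnmP => i; rewrite exponentsE count_word enum_valK. Qed.

Lemma word_exponents s : perm_eq (word (exponents s)) s.
Proof.
by apply/allP => a _; rewrite /= count_word exponentsE enum_rankK.
Qed.

Lemma mpolyX_mon m : mpolyX C m = mon (word m).
Proof. by rewrite mon_exponents exponents_word. Qed.

Lemma poly_mon q : q = \sum_(m <- mpoly.msupp q) mpolyC N (mpoly.mcoeff m q) * mon (word m).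
Proof.
by rewrite {1}(mpolyE q); apply: eq_bigr => m _; rewrite mul_mpolyC mpolyX_mon.
Qed.

(** The index pairs of the letters from one of the two matrices. *)
Definition half (b : bool) s : seq ('I_n * 'I_n) := [seq a.2 | a <- s & a.1 == b].
Definition rows s : bw := (unzip1 (half false s), unzip1 (half true s)).
Definition cols s : bw := (unzip2 (half false s), unzip2 (half true s)).

Lemma half_cat b s t : half b (s ++ t) = half b s ++ half b t.
Proof. by rewrite /half filter_cat map_cat. Qed.

Lemma half_perm b s t : perm_eq s t -> perm_eq (half b s) (half b t).
Proof. by move=> h; apply: perm_map; exact: perm_filter. Qed.

Lemma rows_cat s t : rows (s ++ t) = biword_cat (rows s) (rows t).
Proof. by rewrite /rows !half_cat /unzip1 !map_cat. Qed.

Lemma cols_cat s t : cols (s ++ t) = biword_cat (cols s) (cols t).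
Proof. by rewrite /cols !half_cat /unzip2 !map_cat. Qed.

Lemma size_rows_cols s :
  (size (rows s).1 = size (cols s).1) * (size (rows s).2 = size (cols s).2).
Proof. by rewrite /= !size_map. Qed.

Definition flip (a : letter) : letter := (~~ a.1, a.2).

Lemma half_flip b s : half b (map flip s) = half (~~ b) s.
Proof.
rewrite /half filter_map -map_comp; congr map.
by apply: eq_filter => -[[] ?]; case: b.
Qed.

Lemma half_rev b s : half b (rev s) = rev (half b s).
Proof. by rewrite /half filter_rev map_rev. Qed.

Lemma rows_star s : rows (rev (map flip s)) = wstar (rows s).
Proof. by rewrite /rows !half_rev !half_flip /unzip1 !map_rev. Qed.

Lemma cols_star s : cols (rev (map flip s)) = wstar (cols s).
Proof. by rewrite /cols !half_rev !half_flip /unzip2 !map_rev. Qed.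

(** The letters of the entry (u, v) of the action of (X, Y) on T. *)
Definition pairs u v : seq letter :=
  [seq (false, ij) | ij <- zip u.1 v.1] ++ [seq (true, ij) | ij <- zip u.2 v.2].

Lemma half_tag b c (l : seq ('I_n * 'I_n)) :
  half b [seq (c, ij) | ij <- l] = if c == b then l else [::].
Proof.
rewrite /half; case: ifP => cb; elim: l => //= x l IH; rewrite cb //=.
by rewrite IH.
Qed.

Lemma half_pairs b u v : half b (pairs u v) = if b then zip u.2 v.2 else zip u.1 v.1.
Proof. by rewrite half_cat !half_tag; case: b; rewrite ?cats0. Qed.

Lemma rows_pairs u v : size u.1 = size v.1 -> size u.2 = size v.2 ->
  rows (pairs u v) = u.
Proof.
move=> e1 e2; rewrite /rows !half_pairs !unzip1_zip ?e1 ?e2 //.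
by case: u {e1 e2}.
Qed.

Lemma cols_pairs u v : size u.1 = size v.1 -> size u.2 = size v.2 ->
  cols (pairs u v) = v.
Proof.
move=> e1 e2; rewrite /cols !half_pairs !unzip2_zip ?e1 ?e2 //.
by case: v {e1 e2}.
Qed.

Definition point_mx (b : bool) (x : 'I_N -> C) : 'M[C]_n :=
  \matrix_(i, j) x (enum_rank ((b, (i, j)) : letter)).

Lemma meval_pairs x u v : meval x (mon (pairs u v)) =
  mono (point_mx false x) u.1 v.1 * mono (point_mx true x) u.2 v.2.
Proof.
rewrite mon_cat mevalM /mon !(rmorph_prod (meval x)) !big_map.
congr (_ * _); apply: eq_bigr => p _; rewrite !mxE /= /lvar mevalXU;
  by rewrite -surjective_pairing.
Qed.

(** The polynomial whose value at (X, Y) is the coefficient of u in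
    act X Y z - z. *)
Definition defect u (z : tensors C n) : P :=
  \sum_(v <- biwords (size u.1) (size u.2)) mpolyC N (coef v z) * mon (pairs u v)
  - mpolyC N (coef u z).

Lemma meval_defect x u z : meval x (defect u z) =
  coef u (act (point_mx false x) (point_mx true x) z) - coef u z.
Proof.
case: u => a b; rewrite coef_act /defect mevalB mevalC (rmorph_sum (meval x)) /=.
congr (_ - _); apply: eq_bigr => w _.
by rewrite mevalM mevalC meval_pairs.
Qed.

(** The antilinear involution X_(i, j) <-> Y_(i, j). At the points of the unitary
    group, where Y is the conjugate of X, it is complex conjugation. *)
Definition adj q : P := mpoly.mmap (@mpolyC N C \o Num.conj)
  (fun i => lvar (flip (enum_val i))) q.

Lemma adjM p q : adj (p * q) = adj p * adj q.
Proof. exact: rmorphM. Qed.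

Lemma adj_sum I (r : seq I) (F : I -> P) :
  adj (\sum_(i <- r) F i) = \sum_(i <- r) adj (F i).
Proof. exact: rmorph_sum. Qed.

Lemma adjC c : adj (mpolyC N c) = mpolyC N (c^*).
Proof. by rewrite /adj mpoly.mmapC. Qed.

Lemma adjD p q : adj (p + q) = adj p + adj q.
Proof. exact: rmorphD. Qed.

Lemma adj_mon s : adj (mon s) = mon (map flip s).
Proof.
rewrite /mon big_map; elim: s => [|a s IH]; first by rewrite !big_nil -mpolyC1 adjC rmorph1.
rewrite !big_cons adjM IH; congr (_ * _).
by rewrite /adj /lvar mpoly.mmapX mpoly.mmap1U enum_rankK.
Qed.

Lemma flipK : involutive flip.
Proof. by case=> b p; rewrite /flip negbK. Qed.

Lemma adjK : involutive adj.
Proof.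
move=> q; have -> : adj q = \sum_(m <- mpoly.msupp q)
    mpolyC N ((mpoly.mcoeff m q)^*) * mon (map flip (word m)).
  rewrite {1}(poly_mon q) adj_sum; apply: eq_bigr => m _.
  by rewrite adjM adjC adj_mon.
rewrite adj_sum [RHS]poly_mon; apply: eq_bigr => m _.
by rewrite adjM adjC adj_mon conjCK mapK //; exact: flipK.
Qed.

End Letters.

(** * The Haar functional of A *)

Section Haar.
Context {C : numClosedFieldType} {n : nat}.
Local Notation T := (tensors C n).
Local Notation bw := (biword n).
Local Notation letter := (@letter n).
Local Notation N := #|{: letter}|.
Local Notation P := (mpoly N C).
Implicit Types (x y z b : T) (u v w : bw) (p q : P) (s t : seq letter).
Context {A : set T} (Asub : subalgebra A) (Astar : star_stable A)
  (Acontr : contraction_closed A) (Aid : Ah A 1 1 id_tensor).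
Local Notation Ah := (Ah A).
Local Notation pr := (pr Asub).
Local Notation pr_mx := (pr_mx Asub).

(** The analogue of integration over the stabilizer of A: the average of a
    representation of a group is the orthogonal projection onto the invariants. *)
Definition haar : P -> C :=
  lform (fun m => pr_mx (rows (word m)) (cols (word m))).

Lemma pr_mx_perm s t : perm_eq s t -> pr_mx (rows s) (cols s) = pr_mx (rows t) (cols t).
Proof.
move=> h.
exact: (pr_mxs_perm Asub Astar Acontr Aid (half_perm false h) (half_perm true h)).
Qed.

Lemma haar_mon s : haar (mon s) = pr_mx (rows s) (cols s).
Proof.
rewrite mon_exponents /haar lformX; apply: pr_mx_perm; exact: word_exponents.
Qed.

Lemma haar1 : haar 1 = 1.
Proof.
have -> : 1 = mon [::] :> P by rewrite /mon big_nil.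
rewrite haar_mon /pr_mx /= pr_id; first by rewrite coef_basis.
by rewrite basis1; split; [case: Asub | exact: homog1].
Qed.

Lemma pr_mul k l k' l' b x : Ah k l b -> homog k' l' x ->
  pr (k + k') (l + l') (b * x) = b * pr k' l' x.
Proof.
move=> hb hx; have [_ homb] := hb.
have e y : homog k' l' y -> b * y = tcomp k l 0 0 k' l' b y.
  move=> hy; apply: (@homog_cat_eq _ _ k l k' l'); [exact: homogM homb hy|exact: homog_tcomp|].
  move=> u v e1 e2 e3 e4; rewrite coef_tcomp // big_biwords !big_words0.
  by rewrite (coefM _ _ homb) // biword_catw0 [wstar _]/= biword_cat0w.
rewrite !e //; last exact: homog_pr.
have hb' : Ah (k + 0) (l + 0) b by rewrite !addn0.
exact: (@pr_tcomp _ _ _ Asub Astar Acontr k l 0 0 k' l' b x hb').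
Qed.

Lemma haar_sum I (r : seq I) (F : I -> P) :
  haar (\sum_(i <- r) F i) = \sum_(i <- r) haar (F i).
Proof. exact: lform_sum. Qed.

Lemma haarD p q : haar (p + q) = haar p + haar q.
Proof. exact: lformD. Qed.

Lemma haarB p q : haar (p - q) = haar p - haar q.
Proof. exact: lformB. Qed.

Lemma haarCM c p : haar (mpolyC N c * p) = c * haar p.
Proof. exact: lformCM. Qed.

(** Translation invariance: this is the A-linearity of the projection. *)
Lemma haar_defect k l z u q : Ah k l z -> size u.1 = k -> size u.2 = l ->
  haar (q * defect u z) = 0.
Proof.
move=> hz e1 e2; rewrite (poly_mon q) mulr_suml haar_sum big1 // => m _.
rewrite -mulrA haarCM; set t := word m; suff -> : haar (mon t * defect u z) = 0.
  by rewrite mulr0.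
have [_ homz] := hz.
have -> : mon t * defect u z = \sum_(v <- biwords k l)
    mpolyC N (coef v z) * mon (pairs u v ++ t) - mpolyC N (coef u z) * mon t.
  rewrite /defect e1 e2 mulrBr [mon t * mpolyC _ _]mulrC; congr (_ - _).
  by rewrite mulr_sumr; apply: eq_bigr => v _; rewrite mon_cat mulrA mulrC.
rewrite haarB haar_sum haarCM haar_mon.
have := congr1 (coef (biword_cat u (rows t))) (pr_mul hz (@homog_basis C n (cols t))).
rewrite (coefM _ _ homz) // -/(pr_mx (rows t) (cols t)) => <-.
rewrite [X in pr _ _ (X * _)](homogE homz) mulr_suml pr_sum coef_sum -sumrB.
apply: big1_seq => v /andP[_]; rewrite mem_biwords => /andP[/eqP f1 /eqP f2].
rewrite haarCM haar_mon -scalerAl prZ coefZ basisM rows_cat cols_cat.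
rewrite rows_pairs ?cols_pairs ?e1 ?e2 ?f1 ?f2 //.
by rewrite /pr_mx /= !size_cat f1 f2 subrr.
Qed.

Lemma haar_defect_pr k l z u : homog k l z -> size u.1 = k -> size u.2 = l ->
  haar (defect u z) = coef u (pr k l z) - coef u z.
Proof.
move=> hz e1 e2; rewrite /defect haarB haar_sum.
rewrite -[mpolyC N (coef u z)]mulr1 haarCM haar1 mulr1; congr (_ - _).
rewrite [in RHS](homogE hz) pr_sum coef_sum e1 e2; apply: eq_big_seq => v.
rewrite mem_biwords => /andP[/eqP f1 /eqP f2].
rewrite haarCM haar_mon prZ coefZ rows_pairs ?cols_pairs ?e1 ?e2 ?f1 ?f2 //.
by rewrite /pr_mx f1 f2.
Qed.

Definition shape w := (size w.1, size w.2).

(** The projection of [projection_psd]: the matrices indexed by words are tensors,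
    the entry (v, v') being the coefficient of (wstar v) v', and those coming from
    A form a *-algebra. The test on shapes separates entries (v, v') that have
    the same coefficient but differ in the shapes of v and v'. *)
Definition kernel u u' v v' : C :=
  if (shape u == shape v) && (shape u' == shape v')
  then pr_mx (biword_cat (wstar u) u') (biword_cat (wstar v) v') else 0.

Lemma kernel_star u u' v v' : kernel u' u v' v = (kernel u u' v v')^*.
Proof.
rewrite /kernel andbC; case: ifP => _; last by rewrite conjC0.
by rewrite -(pr_mx_star Asub Astar) !wstar_cat !wstarK.
Qed.

Lemma pr_mx_dot u v : shape u = shape v ->
  pr_mx u v = \sum_(w <- biwords (size v.1) (size v.2)) pr_mx w v * (pr_mx w u)^*.
Proof.
move=> [e1 e2]; rewrite {1}/pr_mx -(dot_basis _ e1 e2) -dot_pr /dot.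
by rewrite /pr_mx e1 e2.
Qed.

Lemma shape_star u v : shape u = shape v -> shape (wstar u) = shape (wstar v).
Proof. by case=> e1 e2; rewrite /shape /= !size_rev e1 e2. Qed.

Lemma shape_cat u u' v v' : shape u = shape v -> shape u' = shape v' ->
  shape (biword_cat u u') = shape (biword_cat v v').
Proof. by case=> e1 e2 [e3 e4]; rewrite /shape /= !size_cat e1 e2 e3 e4. Qed.

Lemma mem_biwords_shape u v : (u \in biwords (size v.1) (size v.2)) = (shape u == shape v).
Proof. by rewrite mem_biwords /shape xpair_eqE. Qed.

Section Bounded.
Variable d : nat.
Local Notation I := ({bseq d of 'I_n} * {bseq d of 'I_n})%type.
Implicit Types (i j r : I).

Definition bword i : bw := (i.1 : seq 'I_n, i.2 : seq 'I_n).

Lemma big_bword v (F : bw -> C) : (size v.1 <= d)%N -> (size v.2 <= d)%N ->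
  \sum_i (if shape (bword i) == shape v then F (bword i) else 0) =
  \sum_(w <- biwords (size v.1) (size v.2)) F w.
Proof.
move=> kd ld; rewrite -big_mkcond /=.
rewrite -(big_map bword (fun w => shape w == shape v) F).
rewrite -big_filter; apply: perm_big; apply: uniq_perm.
- apply: filter_uniq; rewrite map_inj_uniq ?index_enum_uniq //.
  by move=> [i1 i2] [j1 j2] [/val_inj -> /val_inj ->].
- exact: biwords_uniq.
move=> w; rewrite mem_filter mem_biwords_shape.
apply: andb_idr => /eqP[e1 e2].
apply/mapP; case: w e1 e2 => w1 w2 /= e1 e2.
have hs : (size w1 <= d)%N by rewrite e1.
have ht : (size w2 <= d)%N by rewrite e2.
by exists (Bseq hs, Bseq ht) => //; exact: mem_index_enum.
Qed.

Lemma size_bword1 i : (size (bword i).1 <= d)%N.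
Proof. exact: size_bseq. Qed.

Lemma size_bword2 i : (size (bword i).2 <= d)%N.
Proof. exact: size_bseq. Qed.

Lemma kernel_dot i i' j j' : kernel (bword i) (bword i') (bword j) (bword j') =
  \sum_r \sum_(r' : I) kernel (bword r) (bword r') (bword j) (bword j') *
    (kernel (bword r) (bword r') (bword i) (bword i'))^*.
Proof.
rewrite {1}/kernel; have [/andP[/eqP e /eqP e']|ne] := boolP (_ && _); last first.
  rewrite big1 // => r _; rewrite big1 // => r' _; rewrite /kernel.
  case: ifP => [/andP[/eqP -> /eqP ->]|_]; last by rewrite mul0r.
  by rewrite ![shape (bword j) == _]eq_sym ![shape (bword j') == _]eq_sym (negbTE ne) conjC0 mulr0.
pose G (u v : bw) := pr_mx (biword_cat (wstar u) v) (biword_cat (wstar (bword j)) (bword j')) *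
  (pr_mx (biword_cat (wstar u) v) (biword_cat (wstar (bword i)) (bword i')))^*.
transitivity (\sum_r (if shape (bword r) == shape (bword j) then
    \sum_(v <- biwords (size (bword j').1) (size (bword j').2)) G (bword r) v else 0)).
  rewrite (big_bword (fun u => \sum_(v <- biwords (size (bword j').1) (size (bword j').2))
    G u v)) ?size_bword1 ?size_bword2 //.
  rewrite pr_mx_dot; last by apply: shape_cat => //; exact: shape_star.
  rewrite /= !size_cat !size_rev big_biwords_cat big_biwords_star.
  by [].
apply: eq_bigr => r _; case: ifP => er; last first.
  by rewrite big1 // => r' _; rewrite /kernel er mul0r.
rewrite -big_bword ?size_bword1 ?size_bword2 //; apply: eq_bigr => r' _.
by rewrite /kernel e e' er /=; case: ifP => //; rewrite mul0r.
Qed.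

(** This is [pr_tcomp] for the composition of an element of A with a basis
    element. *)
Lemma kernel_mul i i' j j' h h' :
  \sum_r kernel (bword r) (bword h) (bword i) (bword i') *
         kernel (bword j) (bword j') (bword r) (bword h') =
  \sum_(r' : I) kernel (bword j) (bword r') (bword i) (bword i') *
         kernel (bword r') (bword j') (bword h) (bword h').
Proof.
have [/and3P[/eqP e1 /eqP e2 /eqP e3]|ne] := boolP [&& shape (bword j) == shape (bword i),
    shape (bword h) == shape (bword i') & shape (bword j') == shape (bword h')]; last first.
  rewrite [LHS]big1 => [|r _]; [rewrite [RHS]big1 // => r _|]; rewrite /kernel.
    case: ifP => [/andP[/eqP e1 /eqP e2]|_]; last by rewrite mul0r.
    case: ifP => [/andP[/eqP e3 /eqP e4]|_]; last by rewrite mulr0.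
    by case/negP: ne; rewrite e1 -e3 e2 e4 !eqxx.
  case: ifP => [/andP[/eqP e1 /eqP e2]|_]; last by rewrite mul0r.
  case: ifP => [/andP[/eqP e3 /eqP e4]|_]; last by rewrite mulr0.
  by case/negP: ne; rewrite e3 e1 e2 e4 !eqxx.
pose a := biword_cat (wstar (bword i)) (bword i').
(* The element of A that corresponds to the image of the elementary matrix (i, i'). *)
pose b0 := pr (size a.1) (size a.2) (basis C a).
pose k1 := size (bword i).2; pose l1 := size (bword i).1.
pose k := size (bword i').1; pose l := size (bword i').2.
pose k2 := size (bword h').1; pose l2 := size (bword h').2.
pose x : T := basis C (biword_cat (wstar (bword h)) (bword h')).
have hb0 : Ah (k1 + k) (l1 + l) b0.
  have := pr_Ah Asub (size a.1) (size a.2) (basis C a).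
  by rewrite /b0 /a /= !size_cat !size_rev.
have [ej1 ej2] := e1; have [eh1 eh2] := e2; have [ek1 ek2] := e3.
have := congr1 (coef (biword_cat (wstar (bword j)) (bword j')))
  (@pr_tcomp _ _ _ Asub Astar Acontr k1 l1 k l k2 l2 b0 x hb0).
rewrite [RHS]coef_tcomp ?size_wstar1 ?size_wstar2 // => eq.
transitivity (coef (biword_cat (wstar (bword j)) (bword j'))
  (pr (k1 + k2) (l1 + l2) (tcomp k1 l1 k l k2 l2 b0 x))); last first.
  rewrite eq -big_bword ?size_bword1 ?size_bword2 //; apply: eq_bigr => r _.
  rewrite /kernel e1 eqxx /=; case: ifP => er; last by rewrite mul0r.
  have -> : shape (bword r) == shape (bword h) by rewrite (eqP er) e2.
  rewrite e3 eqxx /=; congr (_ * _); rewrite /pr_mx /= !size_cat !size_rev.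
  by rewrite eh1 eh2.
(* Composing b0 with a basis element selects one column of b0. *)
have -> : tcomp k1 l1 k l k2 l2 b0 x = \sum_(w <- biwords l1 k1)
    coef (biword_cat (wstar w) (bword h)) b0 *: basis C (biword_cat (wstar w) (bword h')).
  apply: (@homog_cat_eq _ _ k1 l1 k2 l2); [exact: homog_tcomp| |].
    apply/homogP => w hw; rewrite coef_sum big1_seq // => u /andP[_].
    rewrite mem_biwords => /andP[/eqP f1 /eqP f2]; rewrite coefZ coef_basis.
    case: (_ =P w) => [E|]; last by rewrite mulr0.
    by rewrite -E /= !size_cat !size_rev f1 f2 eqxx in hw.
  move=> u v f1 f2 f3 f4; rewrite coef_tcomp // coef_sum.
  transitivity (coef (biword_cat u (bword h)) b0 * (bword h' == v)%:R).
    transitivity (\sum_(s <- biwords k l) coef (biword_cat u s) b0 *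
        (bword h' == v)%:R * (s == bword h)%:R).
      apply: eq_big_seq => s; rewrite mem_biwords => /andP[/eqP g1 /eqP g2].
      rewrite coef_basis biword_cat_inj ?size_wstar1 ?size_wstar2 ?g1 ?g2 ?eh1 ?eh2 //.
      rewrite (inj_eq (can_inj wstarK)) [s == _]eq_sym -mulrA -natrM mulnb andbC.
      by [].
    by rewrite big_seq_delta ?biwords_uniq // mem_biwords eh1 eh2 !eqxx.
  transitivity (\sum_(w <- biwords l1 k1) coef (biword_cat (wstar w) (bword h)) b0 *
      (bword h' == v)%:R * (w == wstar u)%:R).
    rewrite big_seq_delta ?biwords_uniq // mem_biwords size_wstar1 size_wstar2.
    by rewrite f1 f2 !eqxx wstarK.
  apply: eq_big_seq => w; rewrite mem_biwords => /andP[/eqP g1 /eqP g2].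
  rewrite coefZ coef_basis biword_cat_inj ?size_wstar1 ?size_wstar2 ?g1 ?g2 ?f1 ?f2 //.
  by rewrite (can2_eq wstarK wstarK) -mulrA -natrM mulnb andbC.
rewrite pr_sum coef_sum -big_bword ?size_bword1 ?size_bword2 //; apply: eq_bigr => r _.
rewrite /kernel e2 eqxx andbT; case: ifP => er; last by rewrite mul0r.
rewrite e1 e3 (eqP er) !eqxx /= prZ coefZ; congr (_ * _).
have [er1 er2] := eqP er.
by rewrite /pr_mx /= !size_cat !size_rev er1 er2.
Qed.

End Bounded.

Lemma size_rows s : (size (rows s).1 <= size s)%N /\ (size (rows s).2 <= size s)%N.
Proof. by rewrite /= !size_map !size_filter !count_size. Qed.

(** Reversing the first list of letters does not change the monomial, and turns
    its words into their stars. *)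
Lemma haar_adj s t : haar (adj (mon s) * mon t) =
  kernel (rows s) (rows t) (cols s) (cols t).
Proof.
rewrite adj_mon (@mon_perm _ _ _ (rev (map flip s))); last by rewrite perm_sym perm_rev.
rewrite -mon_cat haar_mon rows_cat cols_cat rows_star cols_star /kernel.
have e r : shape (rows r) = shape (cols r) by rewrite /shape !size_rows_cols.
by rewrite !e !eqxx.
Qed.

Lemma big_delta2 (I J : finType) M (D : seq M) (a : M -> C) (f : M -> I) (g : M -> J)
    (F : I -> J -> C) :
  \sum_i \sum_j (\sum_(m <- D) a m * ((i == f m)%:R * (j == g m)%:R)) * F i j =
  \sum_(m <- D) a m * F (f m) (g m).
Proof.
under eq_bigr do under eq_bigr do rewrite mulr_suml.
under eq_bigr do rewrite exchange_big.
rewrite exchange_big; apply: eq_bigr => m _ /=.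
rewrite (bigD1 (f m)) //= (bigD1 (g m)) //= !eqxx !mulr1 big1 => [|j /negbTE ->].
  rewrite addr0 big1 ?addr0 // => i /negbTE ->; rewrite big1 // => j _.
  by rewrite mul0r mulr0 mul0r.
by rewrite !mulr0 mul0r.
Qed.

Lemma haar_pos q : 0 <= haar (adj q * q).
Proof.
pose D := mpoly.msupp q; pose d := (\max_(m <- D) size (word m))%N.
pose I := ({bseq d of 'I_n} * {bseq d of 'I_n})%type.
pose iu m : I := (insub_bseq d (rows (word m)).1, insub_bseq d (rows (word m)).2).
pose iv m : I := (insub_bseq d (cols (word m)).1, insub_bseq d (cols (word m)).2).
have hd m : m \in D -> (size (word m) <= d)%N.
  by move=> mD; exact: (@leq_bigmax_seq _ _ _ (fun m => size (word m))).
have insubE (s : seq 'I_n) : (size s <= d)%N -> (insub_bseq d s : seq 'I_n) = s.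
  by move=> h; rewrite insubdK.
have iuE m : m \in D -> bword (iu m) = rows (word m).
  move=> /hd h; have [h1 h2] := size_rows (word m).
  by rewrite /bword /iu /= !insubE ?(leq_trans h1) ?(leq_trans h2) //; case: (rows _).
have ivE m : m \in D -> bword (iv m) = cols (word m).
  move=> /hd h; have [h1 h2] := size_rows (word m); rewrite !size_rows_cols in h1 h2.
  by rewrite /bword /iv /= !insubE ?(leq_trans h1) ?(leq_trans h2) //; case: (cols _).
pose c (i j : I) : C := \sum_(m <- D) mpoly.mcoeff m q * ((i == iu m)%:R * (j == iv m)%:R).
have := @projection_psd C I (fun i i' j j' => kernel (bword i) (bword i') (bword j) (bword j')).
move=> /(_ (fun i i' j j' => kernel_star _ _ _ _)).
move=> /(_ (fun i i' j j' => kernel_dot _ _ _ _)).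
move=> /(_ (fun _ _ _ _ _ _ => kernel_mul _ _ _ _ _ _) c).
suff <- : haar (adj q * q) = \sum_i \sum_j \sum_i' \sum_j' (c i j)^* *
  kernel (bword i) (bword i') (bword j) (bword j') * c i' j' by [].
pose Y (i j : I) : C := \sum_(m <- D) mpoly.mcoeff m q *
  kernel (bword i) (bword (iu m)) (bword j) (bword (iv m)).
transitivity (\sum_i \sum_j (c i j)^* * Y i j); last first.
  apply: eq_bigr => i _; apply: eq_bigr => j _.
  rewrite /Y -(big_delta2 _ _ iu iv (fun i' j' => kernel (bword i) (bword i') (bword j) (bword j'))).
  rewrite mulr_sumr; apply: eq_bigr => i' _; rewrite mulr_sumr; apply: eq_bigr => j' _.
  by rewrite -/(c i' j') -mulrA; congr (_ * _); rewrite mulrC.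
transitivity (\sum_(m <- D) (mpoly.mcoeff m q)^* * Y (iu m) (iv m)); last first.
  rewrite -(big_delta2 _ _ iu iv Y); apply: eq_bigr => i _; apply: eq_bigr => j _.
  congr (_ * _); rewrite /c rmorph_sum; apply: eq_bigr => m _.
  by rewrite !rmorphM /= !conjC_nat.
rewrite {1 2}(poly_mon q) adj_sum mulr_suml haar_sum; apply: eq_big_seq => m mD.
rewrite adjM adjC -mulrA haarCM; congr (_ * _).
rewrite mulr_sumr haar_sum; apply: eq_big_seq => m' mD'.
rewrite mulrCA haarCM haar_adj; congr (_ * _).
by rewrite !iuE // !ivE.
Qed.

End Haar.

(** * A is the algebra of invariants of its stabilizer *)

Section Duality.
Context {C : numClosedFieldType} {n : nat}.
Local Notation T := (tensors C n).
Local Notation bw := (biword n).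
Local Notation letter := (@letter n).
Local Notation N := #|{: letter}|.
Local Notation P := (mpoly N C).
Implicit Types (x y z b : T) (u w : bw) (p q f g : P) (s t : seq letter).
Context {A : set T} (Asub : subalgebra A) (Astar : star_stable A)
  (Acontr : contraction_closed A) (Aid : Ah A 1 1 id_tensor).
Local Notation Ah := (Ah A).
Local Notation pr := (pr Asub).
Local Notation haar := (haar Asub).

Lemma haar_adj_conj q : haar (adj q) = (haar q)^*.
Proof.
rewrite (poly_mon q) adj_sum !haar_sum rmorph_sum; apply: eq_bigr => m _.
rewrite adjM adjC !haarCM rmorphM; congr (_ * _) => /=.
rewrite adj_mon (@mon_perm _ _ _ (rev (map flip (word m)))); last first.
  by rewrite perm_sym perm_rev.
by rewrite !(haar_mon Asub Astar Acontr Aid) rows_star cols_star pr_mx_star.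
Qed.

(** Positivity at q - h (q). *)
Lemma haar_schwarz q : haar q * (haar q)^* <= haar (adj q * q).
Proof.
have := haar_pos Asub Astar Acontr Aid (q - mpolyC N (haar q)).
have -> : adj (q - mpolyC N (haar q)) = adj q - mpolyC N (haar q)^*.
  by rewrite -mulN1r -(rmorphN1 (@mpolyC N C)) adjD adjM !adjC rmorphN1 !rmorphN1 mulN1r.
have -> : (adj q - mpolyC N (haar q)^*) * (q - mpolyC N (haar q)) =
    adj q * q - mpolyC N (haar q) * adj q
    - (mpolyC N (haar q)^* * q - mpolyC N (haar q)^* * (mpolyC N (haar q) * 1)).
  by rewrite mulr1 mulrBl !mulrBr [adj q * mpolyC _ _]mulrC.
rewrite !haarB !haarCM (haar1 Asub Astar Acontr Aid) haar_adj_conj mulr1.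
by rewrite [(haar q)^* * _]mulrC subrr subr0 subr_ge0.
Qed.

(** The largest ideal on which the Haar functional vanishes. *)
Definition null : set P := [set q | forall p, haar (p * q) = 0].

Lemma null_ideal : ideal null.
Proof.
split=> [p|p q hp hq r|p q hq r]; last by rewrite mulrA.
  by rewrite mulr0 -(subrr p) haarB subrr.
by rewrite mulrDr haarD hp hq addr0.
Qed.

Lemma adjX f k : adj (f ^+ k) = adj f ^+ k.
Proof.
elim: k => [|k IH]; last by rewrite !exprS adjM IH.
by rewrite !expr0 -mpolyC1 adjC rmorph1.
Qed.

(** For g = f^* f the Cauchy-Schwarz inequality bounds h (g^(2^j))^2 by
    h (g^(2^(j+1))), which is zero for large j. *)
Lemma haar_nilpotent f k : null (f ^+ k) -> haar f = 0.
Proof.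
move=> hf; pose g := adj f * f.
have schwarz0 q : haar (adj q * q) = 0 -> haar q = 0.
  move=> h; have := haar_schwarz q; rewrite h => le0.
  apply/eqP; rewrite -mul_conjC_eq0 eq_le le0 /=; exact: mul_conjC_ge0.
have adjg j : adj (g ^+ j) = g ^+ j by rewrite adjX /g adjM adjK mulrC.
apply: (schwarz0); rewrite -/g -[g]expr1 -[1%N](expn0 2).
have : haar (g ^+ (2 ^ k)) = 0.
  have e : f ^+ (2 ^ k) = f ^+ (2 ^ k - k) * f ^+ k.
    by rewrite -exprD subnK // ltnW // ltn_expl.
  by rewrite /g exprMn e mulrA; exact: hf.
elim: k {hf} => // k IH; rewrite expnS mul2n -addnn exprD -{1}adjg.
by move=> /schwarz0.
Qed.

Lemma subalgebra_sum I (r : seq I) (F : I -> T) : (forall i, A (F i)) -> A (\sum_(i <- r) F i).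
Proof.
move=> h; elim/big_ind: _ => //; first exact: subalgebra0.
by move=> x y hx hy; rewrite -[x]scale1r; case: Asub => _ + _; apply.
Qed.

Hypothesis Agraded : graded A.
Hypothesis uncountable : ~ countable [set: C].

(** The identity tensor belongs to A, and being fixed by (X, Y) it forces
    X Y^T = 1. *)
Lemma zero_stabilizer (v : 'I_N -> C) : (forall q, null q -> meval v q = 0) ->
  stabilizer A (point_mx false v) /\
  point_mx true v = invmx (point_mx false v)^T.
Proof.
set X := point_mx false v; set Y := point_mx true v => hv.
have fixh k l z : Ah k l z -> act X Y z = z.
  move=> hz; have [_ homz] := hz.
  apply: (homog_coef_eq (homog_act homz) homz) => u e1 e2.
  apply/subr0_eq; rewrite -meval_defect; apply: hv => p.
  exact: (haar_defect Asub Astar Acontr Aid p hz e1 e2).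
have fixA z : A z -> act X Y z = z.
  move=> /Agraded[M [F [hF ->]]]; rewrite act_sum; apply: eq_bigr => i _.
  by rewrite act_sum; apply: eq_bigr => j _; exact: fixh (hF i j).
have XY : X *m Y^T = 1%:M.
  apply/matrixP => i j; rewrite !mxE -coef_id_tensor -(fixh _ _ _ Aid).
  rewrite coef_actE [size _]/= !big_wordsS; apply: eq_bigr => c _.
  rewrite big_words0 big_wordsS (bigD1 c) //= big_words0 coef_id_tensor eqxx mulr1.
  rewrite !mono_cons !mono_nil !mulr1 mxE [Y^T _ _]mxE big1 ?addr0 // => d dc.
  by rewrite big_words0 coef_id_tensor eq_sym (negbTE dc) mulr0.
have [uX _] := mulmx1_unit XY.
have eY : Y = invmx X^T.
  apply: (can_inj trmxK); rewrite trmx_inv trmxK.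
  by rewrite -[LHS](mulKmx uX) XY mulmx1.
split=> //; split=> // z Az.
by rewrite gl_act_act -eY fixA.
Qed.

Lemma invariants_stabilizer : invariants (stabilizer A) = A.
Proof.
apply/seteqP; split=> [z hz|z Az U [_]]; last by apply.
suff main k l x : invariants (stabilizer A) x -> homog k l x -> A x.
  have [M ->] := sum_hcomp z; apply: subalgebra_sum => i; apply: subalgebra_sum => j.
  by apply: main; [exact: invariants_hcomp | exact: homog_hcomp].
move=> hx homx; suff <- : pr k l x = x by case: (pr_Ah Asub k l x).
apply: (@homog_coef_eq _ _ k l); [exact: homog_pr|exact: homx|] => u e1 e2.
apply/subr0_eq; rewrite -(haar_defect_pr Asub Astar Acontr Aid homx e1 e2).
apply: contrapT => /eqP nz.
have free : power_free null (defect u x).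
  by move=> k0 /haar_nilpotent h; rewrite h eqxx in nz.
have [v [hv]] := zero_of_ideal uncountable null_ideal free.
have [hX eY] := zero_stabilizer hv.
by rewrite meval_defect eY -gl_act_act hx // subrr eqxx.
Qed.

End Duality.

(** * The invariants determine the group *)

Section Separation.
Context {C : numClosedFieldType} {n : nat}.
Local Notation T := (tensors C n).
Local Notation bw := (biword n).
Implicit Types (x y z : T) (X U g : 'M[C]_n) (a b s t : seq 'I_n).

Lemma actl_basis X a b : act X 1%:M (basis C (a, b)) =
  \sum_(t <- words (size a)) mono X t a *: basis C (t, b).
Proof.
apply: tensorP => -[c d]; rewrite coef_actl coef_sum.
under [RHS]eq_bigr do rewrite coefZ coef_basis xpair_eqE -mulnb natrM mulrA mulrAC.
under [LHS]eq_bigr do rewrite coef_basis xpair_eqE -mulnb natrM mulrA mulrAC [a == _]eq_sym.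
rewrite !big_seq_delta ?words_uniq // !mem_words eq_sym.
by case: ifP => // /eqP ->.
Qed.

Section Level.
Variable d : nat.

(** The indices of the entries of the k-th tensor power of a matrix, for k < d. *)
Definition square_words : seq bw := flatten [seq biwords k k | k <- iota 0 d].
Local Notation D := square_words.

Lemma mem_square a b : ((a, b) \in D) = (size a == size b) && (size b < d)%N.
Proof.
apply/flatten_mapP/andP => [[k]|[/eqP e lt]].
  by rewrite mem_iota mem_biwords /= add0n => lt /andP[/eqP -> /eqP ->].
by exists (size b); rewrite ?mem_iota // mem_biwords /= e eqxx.
Qed.

Lemma big_square_delta (F : bw -> C) v :
  \sum_(w <- D) F w * (w == v)%:R = if v \in D then F v else 0.
Proof.
case: v => a b; rewrite mem_square big_flatten big_map.
transitivity (\sum_(k <- iota 0 d) F (a, b) * (size a == size b)%:R * (k == size b)%:R).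
  apply: eq_bigr => k _; rewrite big_seq_delta ?biwords_uniq // mem_biwords /=.
  case: (k =P size b) => [->|/eqP ne]; last first.
    by rewrite [size b == k]eq_sym (negbTE ne) andbF mulr0.
  by rewrite eqxx andbT mulr1; case: ifP; rewrite ?mulr1 ?mulr0.
rewrite (big_seq_delta (fun _ => _)) ?iota_uniq // mem_iota /= add0n.
by case: (size a == size b); case: ifP; rewrite ?mulr1 ?mulr0.
Qed.

Lemma dot_actl X x y :
  dot D (act X 1%:M x) y = dot D x (act (map_mx Num.conj X^T) 1%:M y).
Proof.
rewrite /dot !big_flatten !big_map; apply: eq_bigr => k _; rewrite !big_biwords.
rewrite exchange_big [RHS]exchange_big; apply: eq_bigr => b _ /=.
transitivity (\sum_(a <- words k) \sum_(s <- words k)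
    mono X a s * coef (s, b) x * (coef (a, b) y)^*).
  apply: eq_big_seq => a; rewrite mem_words => /eqP ea.
  by rewrite coef_actl ea mulr_suml.
rewrite exchange_big; apply: eq_big_seq => s; rewrite mem_words => /eqP es.
rewrite coef_actl es rmorph_sum mulr_sumr; apply: eq_bigr => a _.
by rewrite rmorphM /= -mono_map conjCK mono_tr mulrCA mulrA.
Qed.

(** The tensor powers of g of order less than d, as one tensor: the words in V^*
    label the columns, and g acts on the left. *)
Definition theta g : T :=
  act g 1%:M (\sum_(k <- iota 0 d) \sum_(s <- words k) basis C (s, s)).

Lemma coef_theta1 a b : coef (a, b) (theta 1%:M) = ((a == b) && (size b < d)%N)%:R.
Proof.
rewrite /theta act1 coef_sum.
transitivity (\sum_(k <- iota 0 d) (a == b)%:R * (k == size b)%:R : C).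
  apply: eq_bigr => k _; rewrite coef_sum.
  transitivity (\sum_(s <- words k) (a == b)%:R * (s == b)%:R : C).
    apply: eq_bigr => s _; rewrite coef_basis xpair_eqE -natrM mulnb.
    by case: (s =P b) => [->|]; rewrite ?andbT ?andbF // eq_sym.
  by rewrite (big_seq_delta (fun _ => _)) ?words_uniq // mem_words eq_sym; case: eqP => _; rewrite ?mulr1 ?mulr0.
rewrite (big_seq_delta (fun _ => _)) ?iota_uniq // mem_iota /= add0n.
by case: ltnP => _; rewrite ?andbT ?andbF.
Qed.

Lemma theta_act g : theta g = act g 1%:M (theta 1%:M).
Proof. by rewrite /theta act_comp mulmx1 mul1mx. Qed.

Lemma coef_theta g a b : size a = size b -> (size b < d)%N ->
  coef (a, b) (theta g) = mono g a b.
Proof.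
move=> e lt; rewrite theta_act coef_actl.
under eq_bigr do rewrite coef_theta1 lt andbT.
by rewrite big_seq_delta ?words_uniq // mem_words e eqxx.
Qed.

Definition supported x := forall w, w \notin D -> coef w x = 0.

Lemma supported_act X x : supported x -> supported (act X 1%:M x).
Proof.
move=> hx [a b] hab; rewrite coef_actl big1_seq // => s /andP[_].
rewrite mem_words => /eqP es; rewrite hx ?mulr0 //.
by move: hab; rewrite !mem_square es.
Qed.

Context (H : set 'M[C]_n) (Hgrp : GL_subgroup H) (Hstar : star_invariant H).

(** The span of the theta g with g in H, defined as the orthogonal of the
    orthogonal. *)
Definition hspan : set T := [set x | supported x /\
  forall y, (forall g, H g -> dot D (theta g) y = 0) -> dot D x y = 0].

Lemma hspan0 : hspan 0.
Proof.
split=> [w _|y _]; first exact: coef0.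
by rewrite -(scale0r (0 : T)) dotZl mul0r.
Qed.

Lemma hspan_lin (c : C) x y : hspan x -> hspan y -> hspan (c *: x + y).
Proof.
move=> [sx hx] [sy hy]; split=> [w hw|z hz].
  by rewrite coefD coefZ sx // sy // mulr0 addr0.
by rewrite dotDl dotZl hx // hy // mulr0 addr0.
Qed.

Lemma theta_supported g : supported (theta g).
Proof.
rewrite theta_act; apply: supported_act => -[a b]; rewrite mem_square coef_theta1.
by move=> /negbTE; case: (a =P b) => [->|//]; rewrite eqxx /= => ->.
Qed.

Lemma hspan_theta g : H g -> hspan (theta g).
Proof. by move=> hg; split=> [|y hy]; [exact: theta_supported | exact: hy]. Qed.

Lemma hspan_act g x : H g -> hspan x -> hspan (act g 1%:M x).
Proof.
move=> hg [sx hx]; split=> [|y hy]; first exact: supported_act.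
rewrite dot_actl; apply: hx => g' hg'.
rewrite -dot_actl theta_act act_comp mul1mx -theta_act; apply: hy.
by case: Hgrp => _ _ hm _; exact: hm.
Qed.

Definition hspan_pr z : T := sval (cid (projection_exists D hspan0 hspan_lin z)).

Lemma hspan_pr_in z : hspan (hspan_pr z).
Proof. by rewrite /hspan_pr; case: cid => p []. Qed.

Lemma hspan_pr_orth z y : hspan y -> dot D (z - hspan_pr z) y = 0.
Proof. by rewrite /hspan_pr; case: cid => p [/= _ h] /h. Qed.

Lemma hspan_pr_unique z (p : T) : hspan p -> (forall y, hspan y -> dot D (z - p) y = 0) ->
  hspan_pr z = p.
Proof.
move=> hp h; apply/subr0_eq; set e := _ - _.
have he : hspan e by rewrite /e -scaleN1r addrC; apply: hspan_lin => //; exact: hspan_pr_in.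
apply: tensorP => w; rewrite coef0; have [wD|] := boolP (w \in D); last by case: he => + _; apply.
apply: (dot_eq0 _ wD).
have {1}-> : e = (z - p) - (z - hspan_pr z) by rewrite opprB addrC subrKA.
by rewrite dotBl h // hspan_pr_orth // subr0.
Qed.

Lemma hspan_pr_lin (c : C) x y : hspan_pr (c *: x + y) = c *: hspan_pr x + hspan_pr y.
Proof.
apply: hspan_pr_unique => [|b hb]; first by apply: hspan_lin; exact: hspan_pr_in.
have -> : c *: x + y - (c *: hspan_pr x + hspan_pr y) = c *: (x - hspan_pr x) + (y - hspan_pr y).
  by rewrite opprD addrACA -scalerBr.
by rewrite dotDl dotZl !hspan_pr_orth // mulr0 addr0.
Qed.

Lemma hspan_pr_id z : hspan z -> hspan_pr z = z.
Proof.
by move=> hz; apply: hspan_pr_unique => // b _; rewrite subrr -(scale0r z) dotZl mul0r.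
Qed.

Lemma hspan_prD x y : hspan_pr (x + y) = hspan_pr x + hspan_pr y.
Proof. by rewrite -{1}[x]scale1r hspan_pr_lin scale1r. Qed.

Lemma hspan_pr0 : hspan_pr 0 = 0.
Proof. exact: hspan_pr_id hspan0. Qed.

Lemma hspan_prZ (c : C) x : hspan_pr (c *: x) = c *: hspan_pr x.
Proof. by rewrite -[c *: x]addr0 hspan_pr_lin hspan_pr0 addr0. Qed.

Lemma hspan_pr_sum I (r : seq I) (F : I -> T) :
  hspan_pr (\sum_(i <- r) F i) = \sum_(i <- r) hspan_pr (F i).
Proof. exact: (big_morph _ hspan_prD hspan_pr0). Qed.

Lemma actB X x y : act X 1%:M (x - y) = act X 1%:M x - act X 1%:M y.
Proof. by rewrite actD -[- y]scaleN1r actZ scaleN1r. Qed.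

Lemma hspan_pr_act g z : H g -> hspan_pr (act g 1%:M z) = act g 1%:M (hspan_pr z).
Proof.
move=> hg; apply: hspan_pr_unique => [|b hb]; first by apply: hspan_act => //; exact: hspan_pr_in.
rewrite -actB dot_actl hspan_pr_orth //; apply: hspan_act => //.
exact: star_invariantP.
Qed.

(** The entries of the projection onto [hspan] that map the label e to the label c
    form a tensor of bidegree (|c|, |e|). *)
Definition block c e : T := of_coefs (biwords (size c) (size e))
  (fun w => coef (w.1, c) (hspan_pr (basis C (w.2, e)))).

Lemma coef_block c e a b : size a = size c -> size b = size e ->
  coef (a, b) (block c e) = coef (a, c) (hspan_pr (basis C (b, e))).
Proof. by move=> e1 e2; rewrite coef_of_coefs_biwords. Qed.

(** In this form, invariance of the block under X says that X commutes with the
    projection. *)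
Lemma block_commutes X c e a b : size a = size c -> size b = size e ->
  (coef (a, b) (act X 1%:M (block c e)) = coef (a, b) (act 1%:M X^T (block c e))) =
  (coef (a, c) (act X 1%:M (hspan_pr (basis C (b, e)))) =
   coef (a, c) (hspan_pr (act X 1%:M (basis C (b, e))))).
Proof.
move=> e1 e2; rewrite coef_actl coef_actr actl_basis hspan_pr_sum [in RHS]coef_actl coef_sum.
congr (_ = _).
  apply: eq_big_seq => s; rewrite mem_words => /eqP es.
  by rewrite coef_block // es.
apply: eq_big_seq => t; rewrite mem_words => /eqP et.
by rewrite hspan_prZ coefZ coef_block ?et // mono_tr.
Qed.

Lemma block_invariant c e : invariants H (block c e).
Proof.
case: Hgrp => gu _ _ _ g hg; apply/unitmx_actK; first exact: gu.
apply: (@homog_coef_eq _ _ (size c) (size e)); try by apply: homog_act; exact: homog_of_coefs.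
move=> [a b] /= e1 e2; rewrite (block_commutes _ e1 e2).
by rewrite hspan_pr_act.
Qed.

(** U fixes the blocks, so it commutes with the projection, which fixes
    theta 1. *)
Lemma theta_hspan U : U \in unitmx -> (forall z, invariants H z -> gl_act U z = z) ->
  hspan (theta U).
Proof.
move=> uU hU.
have comm b : (size b < d)%N ->
    act U 1%:M (hspan_pr (basis C (b, b))) = hspan_pr (act U 1%:M (basis C (b, b))).
  move=> lt; apply: tensorP => -[a c].
  have [hac|hac] := boolP ((a, c) \in D); last first.
    by rewrite (supported_act U (proj1 (hspan_pr_in _)) hac) (proj1 (hspan_pr_in _) _ hac).
  move: hac; rewrite mem_square => /andP[/eqP e1 _].
  rewrite -(block_commutes U e1 (erefl (size b))).
  by have /(unitmx_actK _ uU) -> := hU _ (block_invariant c b).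
have theta1 : hspan_pr (theta 1%:M) = theta 1%:M.
  by apply/hspan_pr_id/hspan_theta; case: Hgrp.
rewrite /theta act1 in theta1.
suff <- : hspan_pr (theta U) = theta U by exact: hspan_pr_in.
rewrite /theta -[in RHS]theta1 !act_sum !hspan_pr_sum act_sum.
apply: eq_big_seq => k; rewrite mem_iota /= add0n => kd.
rewrite !act_sum !hspan_pr_sum act_sum; apply: eq_big_seq => b; rewrite mem_words => /eqP eb.
by rewrite comm // eb.
Qed.

End Level.

(** A polynomial in the entries of g is a linear form in the tensor powers of g. *)
Lemma poly_theta (p : mpoly (n * n) C) : exists d y, forall g,
  meval (fun k => mxvec g 0 k) p = dot (square_words d) (theta d g) y.
Proof.
have /choice[ij hij] (k : 'I_(n * n)) : exists ij : 'I_n * 'I_n, k = mxvec_index ij.1 ij.2.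
  by case/mxvec_indexP: k => i j; exists (i, j).
(* The index pairs of the variables of m, with multiplicity. *)
pose l (m : multinom (n * n)) : seq ('I_n * 'I_n) :=
  flatten [seq nseq (m k) (ij k) | k <- enum 'I_(n * n)].
have lE g m : meval (fun k => mxvec g 0 k) (mpolyX C m) = mono g (unzip1 (l m)) (unzip2 (l m)).
  rewrite mevalX /mono zip_unzip big_flatten big_map big_enum /=.
  apply: eq_bigr => k _; rewrite big_nseq {1}(hij k) mxvecE.
  by elim: (m k) => [|j IH]; rewrite ?expr0 //= exprS IH.
pose d := (\max_(m <- mpoly.msupp p) size (l m)).+1.
exists d; exists (\sum_(m <- mpoly.msupp p)
  (mpoly.mcoeff m p)^* *: basis C (unzip1 (l m), unzip2 (l m))) => g.
rewrite {1}(mpolyE p) (rmorph_sum (meval _)) /=.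
have dotr z (I : Type) (r : seq I) (F : I -> T) : dot (square_words d) z (\sum_(i <- r) F i) =
    \sum_(i <- r) dot (square_words d) z (F i).
  apply: (big_morph _ (fun x y => dotDr _ x y z)).
  by rewrite -(scale0r (0 : T)) dotZr conjC0 mul0r.
rewrite dotr; apply: eq_big_seq => m mp; rewrite mevalZ lE dotZr conjCK; congr (_ * _).
have sz : size (unzip1 (l m)) = size (unzip2 (l m)) by rewrite !size_map.
have lt : (size (unzip2 (l m)) < d)%N.
  by rewrite size_map ltnS; exact: (@leq_bigmax_seq _ _ _ (fun m => size (l m))).
rewrite -(coef_theta g sz lt) /dot.
transitivity (\sum_(w <- square_words d) coef w (theta d g) *
    (w == (unzip1 (l m), unzip2 (l m)))%:R).
  by rewrite big_square_delta mem_square sz eqxx lt.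
by apply: eq_bigr => w _; rewrite coef_basis eq_sym conjC_nat.
Qed.

Lemma invariants_separate (H : set 'M[C]_n) U : algebraic_star_subgroups H ->
  U \in unitmx -> (forall z, invariants H z -> gl_act U z = z) -> H U.
Proof.
move=> [Hgrp [P eH] Hstar] uU hU.
rewrite eH; split=> // p Pp; have [d [y hy]] := poly_theta p.
rewrite hy; have [_] := theta_hspan d Hgrp Hstar uU hU; apply => g hg.
by rewrite -hy; move: hg; rewrite eH => -[_]; apply.
Qed.

End Separation.

(** * The correspondence *)

Section Uncountable.
Context {R : realType}.

(** Nested intervals: the n-th step halves the interval, away from f n. *)
Lemma real_not_enumerable (f : nat -> R) : exists x, forall n, f n != x.
Proof.
pose step n (I : R * R) : R * R := let m := (I.1 + I.2) / 2 in
  if f n <= m then ((m + I.2) / 2, I.2) else (I.1, m).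
pose fix I n : R * R := if n is n'.+1 then step n' (I n') else (0, 1).
have lt n : (I n).1 < (I n).2.
  elim: n => [|n IH] /=; first exact: ltr01.
  by rewrite /step; case: ifP => _ /=; rewrite ?midf_lt.
have nest n : (I n).1 <= (I n.+1).1 /\ (I n.+1).2 <= (I n).2.
  have [h1 h2] := midf_lt (lt n); have [h3 h4] := midf_lt h2.
  rewrite /= /step; case: ifP => _ /=; split=> //; last exact: ltW.
  exact/ltW/(lt_trans h1 h3).
have up n k : (I n).1 <= (I (n + k)%N).1 /\ (I (n + k)%N).2 <= (I n).2.
  elim: k => [|k [h1 h2]]; first by rewrite addn0.
  rewrite addnS; have [h3 h4] := nest (n + k)%N.
  by split; [exact: le_trans h3 | exact: le_trans h2].
have cross n k : (I n).1 <= (I k).2.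
  have [nk|/ltnW kn] := leqP n k.
    by have [+ _] := up n (k - n)%N; rewrite subnKC // => h; apply: le_trans h (ltW (lt k)).
  by have [_] := up k (n - k)%N; rewrite subnKC // => h; apply: le_trans (ltW (lt n)) h.
pose E : set R := range (fun n => (I n).1).
have ubE k : ubound E (I k).2 by move=> _ [n _ <-].
have E0 : E !=set0 by exists (I 0%N).1, 0%N.
exists (sup E) => n.
have ge : (I n.+1).1 <= sup E.
  by apply: ub_le_sup; [exists (I 0%N).2; exact: ubE | exists n.+1].
have le : sup E <= (I n.+1).2 by apply: ge_sup.
have [h1 h2] := midf_lt (lt n); have [h3 h4] := midf_lt h2.
apply/eqP => e; rewrite -e /= /step in ge le.
move: ge le; case: ifP => [fm|/negbT] /=.
  by move=> /(lt_le_trans h3) /lt_le_trans/(_ fm); rewrite ltxx.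
by rewrite -ltNge => fm _ /(lt_le_trans fm); rewrite ltxx.
Qed.

Lemma complex_uncountable : ~ countable [set: R[i]].
Proof.
move=> /countable_injP[g ginj].
pose f n : R := xget 0 [set r | g (r%:C)%C = n].
have [x hx] := real_not_enumerable f.
have : g ((f (g (x%:C)%C))%:C)%C = g (x%:C)%C.
  by rewrite /f; case: xgetP => [y _ //|/(_ x)]; case.
move=> /ginj; rewrite !inE => /(_ I I) [] /eqP.
by rewrite (negbTE (hx _)).
Qed.

End Uncountable.

Section Correspondence.
Context {C : numClosedFieldType} {n : nat}.
Hypothesis uncountable : ~ countable [set: C].
Local Notation T := (tensors C n).
Local Notation groups := (algebraic_star_subgroups : set (set 'M[C]_n)).
Local Notation algebras := (tensor_subalgebras : set (set T)).

Lemma invariants_algebra G : groups G -> algebras (invariants G).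
Proof. by move=> [hG _ sG]; exact: invariants_in. Qed.

Lemma stabilizer_group A : algebras A -> groups (stabilizer A).
Proof. by move=> [_ _ hs _ _]; exact: stabilizer_in. Qed.

Lemma stabilizerK A : algebras A -> invariants (stabilizer A) = A.
Proof.
move=> [hA gA sA cA nA]; apply: (invariants_stabilizer hA sA cA _ gA uncountable).
exact: id_tensor_closed.
Qed.

Lemma invariants_antitone G H : groups G -> groups H ->
  (G `<=` H <-> invariants H `<=` (invariants G : set T)).
Proof.
move=> gG gH; split=> [GH z hz U /GH|sub U GU]; first exact: hz.
apply: (invariants_separate gH) => [|z /sub]; last exact.
by case: gG => [[h _ _ _] _ _]; exact: h.
Qed.

(** An intersection is defined by all the polynomials that vanish on one of the
    groups. *)
Lemma bigcap_group (F : set (set 'M[C]_n)) : F `<=` groups -> F !=set0 ->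
  groups (\bigcap_(G in F) G).
Proof.
move=> sub [G0 FG0]; split.
- split=> [U /(_ _ FG0)|G /sub[[]]//|U V hU hV G FG|U hU G FG].
  + by case: (sub _ FG0) => [[h _ _ _] _ _]; exact: h.
  + by case: (sub _ FG) => [[_ _ h _] _ _]; apply: h; [exact: hU | exact: hV].
  by case: (sub _ FG) => [[_ _ _ h] _ _]; apply: h; exact: hU.
- exists [set p | exists2 G, F G & forall U, G U -> meval (fun k => mxvec U 0 k) p = 0].
  apply/seteqP; split=> [U hU|U [uU hU] G FG].
    split; first by case: (sub _ FG0) => [[h _ _ _] _ _]; apply: h; exact: hU.
    by move=> p [G FG hp]; apply: hp; exact: hU.
  case: (sub _ FG) => [_ [P eG] _]; rewrite eG; split=> // p Pp; apply: hU.
  by exists G => // V; rewrite eG => -[_]; apply.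
have st U : (\bigcap_(G in F) G) U -> (\bigcap_(G in F) G) (map_mx Num.conj U^T).
  by move=> hU G FG; apply: star_invariantP (hU _ FG); case: (sub _ FG).
apply/seteqP; split=> [_ [U hU <-]|U hU]; first exact: st.
by exists (map_mx Num.conj U^T); [exact: st | exact: conj_trmxK].
Qed.

Lemma unitmx_group : groups [set U | U \in unitmx].
Proof.
split.
- split=> //= [|U V|U]; [exact: unitmx1 | by rewrite unitmx_mul => -> -> | by rewrite unitmx_inv].
- by exists set0; apply/seteqP; split=> U; [split | case].
apply/seteqP; split=> [_ [U uU <-]|U uU] /=; first by rewrite map_unitmx unitmx_tr.
by exists (map_mx Num.conj U^T); [rewrite /= map_unitmx unitmx_tr | exact: conj_trmxK].
Qed.

Lemma groups_lattice : is_lattice groups.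
Proof.
move=> G H gG gH; split.
  exists (\bigcap_(K in [set G; H]) K); split.
  - apply: bigcap_group; last by exists G; left.
    by move=> K [->|->].
  - by move=> U; apply; left.
  - by move=> U; apply; right.
  by move=> D _ DG DH U DU K [->|->]; [exact: DG | exact: DH].
exists (\bigcap_(K in [set K | [/\ groups K, G `<=` K & H `<=` K]]) K); split.
- apply: bigcap_group; first by move=> K [].
  exists [set U | U \in unitmx]; split; first exact: unitmx_group.
    by move=> U GU; case: gG => [[h _ _ _] _ _]; exact: h.
  by move=> U HU; case: gH => [[h _ _ _] _ _]; exact: h.
- by move=> U GU K [_ h _]; exact: h.
- by move=> U HU K [_ _ h]; exact: h.
by move=> D gD GD HD U; apply; split.
Qed.

(** The lattice operations are those of the stabilizers, exchanged. *)
Lemma algebras_lattice : is_lattice algebras.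
Proof.
have anti A B : algebras A -> algebras B -> (stabilizer A `<=` stabilizer B <-> B `<=` A).
  move=> aA aB; have := invariants_antitone (stabilizer_group aA) (stabilizer_group aB).
  by rewrite !stabilizerK.
have antil A G : algebras A -> groups G -> (stabilizer A `<=` G <-> invariants G `<=` A).
  by move=> aA gG; rewrite (invariants_antitone (stabilizer_group aA) gG) stabilizerK.
have antir A G : algebras A -> groups G -> (G `<=` stabilizer A <-> A `<=` invariants G).
  by move=> aA gG; rewrite (invariants_antitone gG (stabilizer_group aA)) stabilizerK.
move=> A B aA aB.
have [[M [gM MA MB hM]] [J [gJ AJ BJ hJ]]] :=
  groups_lattice (stabilizer_group aA) (stabilizer_group aB).
split.
  exists (invariants J); split; first exact: invariants_algebra.
  - exact/antil.
  - exact/antil.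
  move=> D aD DA DB; apply/antir => //; apply: hJ; first exact: stabilizer_group.
    exact/anti.
  exact/anti.
exists (invariants M); split; first exact: invariants_algebra.
- exact/antir.
- exact/antir.
move=> D aD AD BD; apply/antil => //; apply: hM; first exact: stabilizer_group.
  exact/anti.
exact/anti.
Qed.

Lemma invariants_bij : set_bij groups algebras invariants.
Proof.
split=> [G|G H|A aA]; first exact: invariants_algebra.
  rewrite !inE => gG gH e; apply/seteqP.
  by split; apply/invariants_antitone; rewrite // e.
by exists (stabilizer A); [exact: stabilizer_group | exact: stabilizerK].
Qed.

End Correspondence.

Theorem mainTheorem4 (R : realType) (n : nat) (n_gt0 : (0 < n)%N) :
  let groups : set (set 'M[R[i]]_n) := algebraic_star_subgroups in
  let algebras : set (set (tensors R[i] n)) := tensor_subalgebras in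
  [/\ is_lattice groups,
      is_lattice algebras,
      set_bij groups algebras invariants &
      forall G H : set 'M[R[i]]_n, groups G -> groups H ->
        (G `<=` H <-> invariants H `<=` invariants G)].
Proof.
move=> groups algebras; split.
- exact: groups_lattice.
- exact: (algebras_lattice complex_uncountable).
- exact: (invariants_bij complex_uncountable).
exact: invariants_antitone.
Qed.
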